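(* For each projective space $\mathbb{FP}^{d-1}$ and each $s$ with $0<s<\dim(\mathbb{FP}^{d-1})$ there exist positive constants $C_s,C_s'$ such that for all $N\ge 2$ $$-C_s N^{1+\frac{s}{\dim(\mathbb{FP}^{d-1})}}\le \mathcal{E}_{K_s}(\mathbb{FP}^{d-1},N)-I_{K_s}(\sigma)N^2\le -C_s' N^{1+\frac{s}{\dim(\mathbb{FP}^{d-1})}}.$$
   Context: Projective spaces: $\mathbb{F}\in\{\mathbb{R},\mathbb{C},\mathbb{H},\mathbb{O}\}$, $d\ge 3$ an integer, with $d=3$ when $\mathbb{F}=\mathbb{O}$. $\mathbb{FP}^{d-1}$ may be realized as the set of Hermitian $d\times d$ matrices $\Pi$ over $\mathbb{F}$ with $\Pi^2=\Pi$ and $\mathrm{Tr}(\Pi)=1$. It carries its isometry-invariant Riemannian metric, normalized so that the geodesic distance $\vartheta$ takes values in $[0,\frac{\pi}{2}]$ (diameter $\frac\pi2$). The chordal metric is $\rho(x,y)=\sin(\vartheta(x,y))$; in the matrix model $\rho(\Pi_1,\Pi_2)=\sqrt{1-\langle\Pi_1,\Pi_2\rangle}$ with $\langle A,B\rangle=\mathrm{Re}\sum_{i,j}a_{ij}\overline{b_{ij}}$. $\sigma$ is the isometry-invariant Borel probability measure (normalized Riemannian volume). $\dim(\mathbb{FP}^{d-1})=(d-1)\dim_{\mathbb{R}}(\mathbb{F})$ is the real dimension. $K_s(x,y)=\rho(x,y)^{-s}$ for $s>0$. $I_K(\mu)=\iint K\,d\mu\,d\mu$; $E_K(\omega_N)=\sum_{i\ne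 j}K(x_i,x_j)$ for $\omega_N=\{x_1,\dots,x_N\}$; $\mathcal{E}_K(\Omega,N)=\min_{\omega_N\subset\Omega}E_K(\omega_N)$, the minimum over $N$-point configurations. *)

(* Defs.v *)
From HB Require Import structures.
From mathcomp Require Import all_boot all_order all_algebra.
From mathcomp Require Import all_classical all_reals all_analysis.
From mathcomp Require Import ring lra.

Set Implicit Arguments.
Unset Strict Implicit.
Unset Printing Implicit Defensive.

Import Order.TTheory GRing.Theory Num.Theory.
Import numFieldNormedType.Exports.

Local Open Scope classical_set_scope.
Local Open Scope ring_scope.

(* Unital, not necessarily associative, algebras with a conjugation and a real
   part; their laws are collected in star_algebra_spec below. *)
Record star_algebra (R : realType) := StarAlgebra {
  sa_sort :> lmodType R ;
  sa_one : sa_sort ;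
  sa_re : sa_sort -> R ;
  sa_conj : sa_sort -> sa_sort ;
  sa_mul : sa_sort -> sa_sort -> sa_sort }.

Definition real_algebra (R : realType) : star_algebra R :=
  @StarAlgebra R R^o 1 id id (fun x y => x * y).

(* Pairs (a, b) with conj (a, b) = (conj a, - b) and
   (a, b)(c, d) = (a c - (conj d) b, d a + b (conj c)). *)
Definition cayley_dickson {R : realType} (A : star_algebra R) :
    star_algebra R :=
  @StarAlgebra R (A * A)%type
    (sa_one A, 0)
    (fun x => sa_re x.1)
    (fun x => (sa_conj x.1, - x.2))
    (fun x y => (sa_mul x.1 y.1 - sa_mul (sa_conj y.2) x.2,
                 sa_mul y.2 x.1 + sa_mul x.2 (sa_conj y.1))).

Variant division_algebra := Reals | Complexes | Quaternions | Octonions.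

Definition scalars (R : realType) (F : division_algebra) : star_algebra R :=
  match F with
  | Reals => real_algebra R
  | Complexes => cayley_dickson (real_algebra R)
  | Quaternions => cayley_dickson (cayley_dickson (real_algebra R))
  | Octonions =>
      cayley_dickson (cayley_dickson (cayley_dickson (real_algebra R)))
  end.

Definition dimR (F : division_algebra) : nat :=
  match F with
  | Reals => 1
  | Complexes => 2
  | Quaternions => 4
  | Octonions => 8
  end.

(* the real dimension of F P^n *)
Definition projdim (F : division_algebra) (n : nat) : nat := (n * dimR F)%N.

Section matrices.
Context {R : realType} {A : star_algebra R} {n : nat}.
Implicit Types P Q : 'M[A]_n.

Definition hermitian P : bool :=
  [forall i, forall j, P j i == sa_conj (P i j)].

(* the library's matrix product requires an associative ring of entries *)
Definition sa_mulmx P Q : 'M[A]_n :=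
  \matrix_(i, j) \sum_l sa_mul (P i l) (Q l j).

Definition sa_trace P : A := \sum_i P i i.

Definition inner_mx P Q : R :=
  sa_re (\sum_i \sum_j sa_mul (P i j) (sa_conj (Q i j))).

Definition is_projector P : bool :=
  [&& hermitian P, sa_mulmx P P == P & sa_trace P == sa_one A].

End matrices.

(* The matrix model of F P^n, with matrices of size n.+1. *)
Record projspace (R : realType) (F : division_algebra) (n : nat) := Projspace {
  projspace_mx :> 'M[scalars R F]_n.+1 ;
  projspaceP : is_projector projspace_mx }.

HB.instance Definition _ R F n := [isSub for @projspace_mx R F n].
HB.instance Definition _ R F n := [Choice of projspace R F n by <:].

Definition chordal {R : realType} {F : division_algebra} {n : nat}
    (x y : projspace R F n) : R :=
  Num.sqrt (1 - inner_mx x y).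

Definition sa_dot {R : realType} {A : star_algebra R} (x y : A) : R :=
  sa_re (sa_mul x (sa_conj y)).

Record star_algebra_spec (R : realType) (A : star_algebra R) : Prop := {
  sa_re_linear : forall a (x y : A),
    sa_re (a *: x + y) = a * sa_re x + sa_re y ;
  sa_re1 : sa_re (sa_one A) = 1 ;
  sa_conj0 : sa_conj (0 : A) = 0 ;
  sa_conj1 : sa_conj (sa_one A) = sa_one A ;
  sa_conjK : involutive (@sa_conj R A) ;
  sa_mul0x : forall x : A, sa_mul 0 x = 0 ;
  sa_mulx0 : forall x : A, sa_mul x 0 = 0 ;
  sa_mul11 : sa_mul (sa_one A) (sa_one A) = sa_one A ;
  sa_dot_linear : forall a (x y z : A),
    sa_dot (a *: x + y) z = a * sa_dot x z + sa_dot y z ;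
  sa_dotC : forall x y : A, sa_dot x y = sa_dot y x ;
  sa_dot_conj : forall x y : A, sa_dot (sa_conj x) (sa_conj y) = sa_dot x y ;
  sa_dot_ge0 : forall x : A, 0 <= sa_dot x x ;
  sa_dot_eq0 : forall x : A, sa_dot x x = 0 -> x = 0 }.

Lemma real_algebra_spec (R : realType) : star_algebra_spec (real_algebra R).
Proof.
split; rewrite /sa_dot //=.
- by move=> x; rewrite mul0r.
- by move=> x; rewrite mulr0.
- by rewrite mulr1.
- by move=> a x y z; rewrite mulrDl -mulrA.
- by move=> x y; rewrite mulrC.
- by move=> x; rewrite -expr2 sqr_ge0.
- by move=> x /eqP; rewrite mulf_eq0 orbb => /eqP.
Qed.

Section cayley_dickson_spec.
Context {R : realType} {A : star_algebra R} (h : star_algebra_spec A).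

Lemma sa_re0 : sa_re (0 : A) = 0.
Proof.
by have := sa_re_linear h (-1) 0 0; rewrite scaler0 addr0 mulN1r addNr.
Qed.

Lemma sa_reD (x y : A) : sa_re (x + y) = sa_re x + sa_re y.
Proof. by have := sa_re_linear h 1 x y; rewrite scale1r mul1r. Qed.

Lemma sa_reN (x : A) : sa_re (- x) = - sa_re x.
Proof.
have := sa_re_linear h (-1) x 0.
by rewrite scaleN1r mulN1r sa_re0 !addr0.
Qed.

Lemma sa_dotNl (x z : A) : sa_dot (- x) z = - sa_dot x z.
Proof.
have d0 : sa_dot 0 z = 0 by rewrite /sa_dot (sa_mul0x h) sa_re0.
have := sa_dot_linear h (-1) x 0 z.
by rewrite d0 scaleN1r mulN1r !addr0.
Qed.

Lemma cayley_dickson_dot (x y : cayley_dickson A) :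
  sa_dot x y = sa_dot x.1 y.1 + sa_dot x.2 y.2.
Proof.
rewrite /sa_dot /= sa_reD sa_reN -/(sa_dot _ _).
rewrite -[X in sa_mul _ X](sa_conjK h) -/(sa_dot _ _) (sa_dot_conj h).
by rewrite sa_dotNl opprK (sa_dotC h y.2).
Qed.

Lemma cayley_dickson_spec : star_algebra_spec (cayley_dickson A).
Proof.
split.
- by move=> a x y; rewrite /= (sa_re_linear h).
- exact: (sa_re1 h).
- by rewrite /= (sa_conj0 h) oppr0.
- by rewrite /= (sa_conj1 h) oppr0.
- by case=> a b; rewrite /= (sa_conjK h) opprK.
- by move=> x; rewrite /= !(sa_mul0x h, sa_mulx0 h) subrr addr0.
- by move=> x; rewrite /= (sa_conj0 h) !(sa_mul0x h, sa_mulx0 h) subrr addr0.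
- rewrite /= (sa_conj0 h) (sa_conj1 h) (sa_mul11 h).
  by rewrite !(sa_mul0x h) subr0 addr0.
- move=> a x y z; rewrite !cayley_dickson_dot !(sa_dot_linear h).
  by rewrite mulrDr addrACA.
- move=> x y; rewrite !cayley_dickson_dot (sa_dotC h x.1).
  by rewrite (sa_dotC h x.2).
- move=> x y; rewrite !cayley_dickson_dot /= (sa_dot_conj h) sa_dotNl.
  by rewrite (sa_dotC h x.2) sa_dotNl opprK (sa_dotC h y.2).
- by move=> x; rewrite cayley_dickson_dot addr_ge0 ?(sa_dot_ge0 h).
- case=> a b; rewrite cayley_dickson_dot /= => /eqP.
  rewrite paddr_eq0 ?(sa_dot_ge0 h)//.
  by move=> /andP[/eqP/(sa_dot_eq0 h)-> /eqP/(sa_dot_eq0 h)->].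
Qed.

End cayley_dickson_spec.

Lemma scalars_spec (R : realType) (F : division_algebra) :
  star_algebra_spec (scalars R F).
Proof.
by case: F; do ?[exact: real_algebra_spec | apply: cayley_dickson_spec].
Qed.

Section inner_mx_theory.
Context {R : realType} {A : star_algebra R} (h : star_algebra_spec A).
Context {n : nat}.
Implicit Types P Q S : 'M[A]_n.

Lemma sa_re_sum I (r : seq I) (f : I -> A) :
  sa_re (\sum_(i <- r) f i) = \sum_(i <- r) sa_re (f i).
Proof. by rewrite (big_morph (@sa_re R A) (sa_reD h) (sa_re0 h)). Qed.

Lemma inner_mxE P Q : inner_mx P Q = \sum_i \sum_j sa_dot (P i j) (Q i j).
Proof.
by rewrite /inner_mx sa_re_sum; apply: eq_bigr => i _; rewrite sa_re_sum.
Qed.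

Lemma inner_mxC P Q : inner_mx P Q = inner_mx Q P.
Proof.
by rewrite !inner_mxE; apply: eq_bigr => i _; apply: eq_bigr => j _;
  rewrite (sa_dotC h).
Qed.

Lemma inner_mx_linear a P Q S :
  inner_mx (map_mx ( *:%R a) P + Q) S = a * inner_mx P S + inner_mx Q S.
Proof.
rewrite !inner_mxE mulr_sumr -big_split; apply: eq_bigr => i _ /=.
rewrite mulr_sumr -big_split; apply: eq_bigr => j _ /=.
by rewrite !mxE (sa_dot_linear h).
Qed.

Lemma inner_mxD P Q S : inner_mx (P + Q) S = inner_mx P S + inner_mx Q S.
Proof.
have := inner_mx_linear 1 P Q S; rewrite mul1r => <-; congr (inner_mx (_ + _)).
by apply/matrixP => i j; rewrite !mxE scale1r.
Qed.

Lemma inner_mxB P Q S : inner_mx (P - Q) S = inner_mx P S - inner_mx Q S.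
Proof.
have := inner_mx_linear (-1) Q P S; rewrite mulN1r [in RHS]addrC => <-.
rewrite [P - Q]addrC; congr (inner_mx (_ + _)).
by apply/matrixP => i j; rewrite !mxE scaleN1r.
Qed.

Lemma inner_mx_ge0 P : 0 <= inner_mx P P.
Proof.
by rewrite inner_mxE; do 2!apply: sumr_ge0 => ? _; exact: (sa_dot_ge0 h).
Qed.

Lemma inner_mx_eq0 P : inner_mx P P = 0 -> P = 0.
Proof.
rewrite inner_mxE => /eqP; rewrite psumr_eq0; last first.
  by move=> i _; apply: sumr_ge0 => j _; exact: (sa_dot_ge0 h).
move/allP => P0; apply/matrixP => i j; rewrite mxE; apply: (sa_dot_eq0 h).
have := P0 i (mem_index_enum i); rewrite psumr_eq0; last first.
  by move=> ? _; exact: (sa_dot_ge0 h).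
by move/allP/(_ j (mem_index_enum j))/eqP.
Qed.

Lemma inner_mx_CS P Q : inner_mx P Q ^+ 2 <= inner_mx P P * inner_mx Q Q.
Proof.
have [Q0|Q0] := eqVneq (inner_mx Q Q) 0.
  rewrite (inner_mx_eq0 Q0) inner_mxC.
  have -> : inner_mx 0 P = 0 by have := inner_mxB P P P; rewrite !subrr.
  by rewrite expr2 mul0r mulr_ge0 ?inner_mx_ge0.
have Qgt0 : 0 < inner_mx Q Q by rewrite lt_neqAle eq_sym Q0 inner_mx_ge0.
set b := inner_mx P Q.
have := inner_mx_ge0 (map_mx ( *:%R (- (b / inner_mx Q Q))) Q + P).
rewrite inner_mx_linear !(inner_mxC _ (_ + _)) !inner_mx_linear.
rewrite [inner_mx Q P]inner_mxC -/b => H.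
have : 0 <= inner_mx P P - b ^+ 2 / inner_mx Q Q.
  by move: H; congr (0 <= _); field.
by rewrite subr_ge0 ler_pdivrMr.
Qed.

Lemma inner_mx_triangle P Q :
  Num.sqrt (inner_mx (P + Q) (P + Q) / 2) <=
  Num.sqrt (inner_mx P P / 2) + Num.sqrt (inner_mx Q Q / 2).
Proof.
have PP := inner_mx_ge0 P; have QQ := inner_mx_ge0 Q.
rewrite -[leRHS]ger0_norm ?addr_ge0 ?sqrtr_ge0// -sqrtr_sqr.
rewrite ler_wsqrtr// sqrrD !sqr_sqrtr ?divr_ge0// -sqrtrM ?divr_ge0//.
rewrite inner_mxD !(inner_mxC _ (P + Q)) !inner_mxD (inner_mxC Q P).
have : inner_mx P Q / 2 <= Num.sqrt (inner_mx P P / 2 * (inner_mx Q Q / 2)).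
  rewrite (le_trans (ler_norm _))// -sqrtr_sqr ler_wsqrtr//.
  by have := inner_mx_CS P Q; lra.
by lra.
Qed.

Lemma inner_mx_projector P : is_projector P -> inner_mx P P = 1.
Proof.
move=> /and3P[/forallP hP /eqP PP /eqP trP].
rewrite -(sa_re1 h) -trP /sa_trace /inner_mx; congr sa_re.
apply: eq_bigr => i _; rewrite -[in RHS]PP mxE; apply: eq_bigr => j _.
by have /forallP/(_ j)/eqP <- := hP i.
Qed.

End inner_mx_theory.

Section projspace_instances.
Context {R : realType} {F : division_algebra} {n : nat}.
Implicit Types x y z : projspace R F n.

Let h := scalars_spec R F.

Let e00 : 'M[scalars R F]_n.+1 :=
  \matrix_(i, j) if (i == 0) && (j == 0) then sa_one _ else 0.

Lemma e00_projector : is_projector e00.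
Proof.
apply/and3P; split.
- apply/forallP => i; apply/forallP => j; rewrite !mxE andbC.
  by case: ifP => _; rewrite ?(sa_conj1 h) ?(sa_conj0 h).
- apply/eqP/matrixP => i j; rewrite !mxE big_ord_recl big1 => [|l _].
    rewrite !mxE !eqxx andbT /= addr0.
    by case: (i == 0); case: (j == 0);
      rewrite ?(sa_mul11 h) ?(sa_mul0x h) ?(sa_mulx0 h).
  by rewrite !mxE andbF (sa_mul0x h).
- apply/eqP; rewrite /sa_trace big_ord_recl big1 => [|l _].
    by rewrite mxE !eqxx addr0.
  by rewrite mxE.
Qed.

HB.instance Definition _ :=
  isPointed.Build (projspace R F n) (Projspace e00_projector).

Lemma chordalE x y :
  let u := projspace_mx x - projspace_mx y in
  chordal x y = Num.sqrt (inner_mx u u / 2).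
Proof.
rewrite /chordal /=; congr Num.sqrt.
rewrite (inner_mxB h) !(inner_mxC h _ (_ - _)) !(inner_mxB h).
rewrite !(inner_mx_projector h) ?projspaceP// (inner_mxC h y x).
by field.
Qed.

Lemma chordalxx x : chordal x x = 0.
Proof.
by rewrite /chordal (inner_mx_projector h) ?projspaceP// subrr sqrtr0.
Qed.

Lemma chordal_eq0 x y : chordal x y = 0 -> x = y.
Proof.
rewrite chordalE /= => /eqP; rewrite sqrtr_eq0 pmulr_lle0 ?invr_gt0// => H.
apply/val_inj/eqP; rewrite -subr_eq0; apply/eqP/(inner_mx_eq0 h)/eqP.
by rewrite eq_le H (inner_mx_ge0 h).
Qed.

Lemma chordalC x y : chordal x y = chordal y x.
Proof. by rewrite /chordal (inner_mxC h). Qed.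

Lemma chordal_triangle y x z : chordal x z <= chordal x y + chordal y z.
Proof.
rewrite !chordalE /=.
have -> : projspace_mx x - projspace_mx z =
    (projspace_mx x - projspace_mx y) + (projspace_mx y - projspace_mx z).
  by rewrite addrA subrK.
exact: (inner_mx_triangle h).
Qed.

HB.instance Definition _ := isMetric.Build R (projspace R F n)
  chordalxx chordal_eq0 chordalC chordal_triangle.

End projspace_instances.

Definition borel_projspace (R : realType) (F : division_algebra) (n : nat) :=
  g_sigma_algebraType (@open (projspace R F n)).

(* The geodesic and the chordal distance have the same isometries, since the
   latter is the sine of the former, which ranges over [0, pi/2]. *)
Definition isometry_invariant {R : realType} {F : division_algebra} {n : nat}
    (mu : set (borel_projspace R F n) -> \bar R) : Prop :=
  forall g : projspace R F n -> projspace R F n,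
    bijective g -> (forall x y, chordal (g x) (g y) = chordal x y) ->
    forall A : set (borel_projspace R F n), measurable A ->
      mu (g @^-1` A) = mu A.

Definition riesz {R : realType} {F : division_algebra} {n : nat} (s : R)
    (x y : projspace R F n) : \bar R :=
  if x == y then +oo%E else (chordal x y `^ (- s))%:E.

Definition energy_integral {R : realType} {d : measure_display}
    {T : measurableType d} (mu : {measure set T -> \bar R})
    (K : T -> T -> \bar R) : \bar R :=
  (\int[mu]_x \int[mu]_y K x y)%E.

Definition config_energy {R : realType} {T : Type} (K : T -> T -> \bar R)
    (N : nat) (w : 'I_N -> T) : \bar R :=
  (\sum_(i < N) \sum_(j < N | j != i) K (w i) (w j))%E.

(* For the Riesz kernels, which are lower semicontinuous on a compact space,
   the infimum is a minimum; a configuration with a repeated point has energy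
   +oo and does not contribute. *)
Definition min_energy {R : realType} {T : Type} (K : T -> T -> \bar R)
    (N : nat) : \bar R :=
  ereal_inf [set config_energy K w | w in [set: 'I_N -> T]].

(* Main.v *)
Require Import Defs.
From mathcomp Require Import all_boot all_order all_algebra.
From mathcomp Require Import all_classical all_reals all_analysis.
From mathcomp Require Import measurable_realfun ring lra.

Set Implicit Arguments.
Unset Strict Implicit.
Unset Printing Implicit Defensive.

Import Order.TTheory GRing.Theory Num.Theory.
Import numFieldNormedType.Exports.

Local Open Scope classical_set_scope.
Local Open Scope ring_scope.


(** Write D for the real dimension and t(x, y) = <x, y> = 1 - rho(x, y)^2, so
    that the Riesz kernel is (1 - t)^(-a) with a = s/2 and singular on the
    diagonal t = 1. The coordinates of the matrices present t as a Gram kernel,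
    and so are its powers. Two facts about the geometry are needed: sigma sees
    the same distribution of t(x, .) from each point x, and balls of radius r
    have measure of order r^D.

    Lower bound. The partial sums S_n of the binomial series of (1 - t)^(-a)
    have nonnegative coefficients and increase to the kernel (bin_sum_cvg). For
    a power t^k, the sum over all ordered pairs of a configuration is at least
    N^2 times its mean m_k, because by homogeneity the difference is the squared
    length of a vector (energy_moment). Hence the energy of N points is at least
    N^2 times the mean of S_n, minus the diagonal N S_n(1), which is of order
    N n^a (bin_sum1_le). The bound on the measure of balls gives m_k of order
    k^(-D/2) (moment_le), so that the mean of S_n differs from I(sigma) by a
    term of order n^(a - D/2); here s < D is used. With n of order N^(2/D) both
    errors are of order N^(1 + s/D) (energy_lower_bound).

    Upper bound. Draw N independent points whose densities add up to N: a fixed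
    fraction of them are uniform on disjoint balls of measure at least 1/N, and
    the others share what remains. The expected energy, diagonal included, is
    N^2 I(sigma), and the diagonal terms of the points confined to balls of
    radius of order N^(-1/D) are at least of order N^(s/D) each
    (jittered_config). Fixing the points one at a time without increasing the
    conditional expectation produces a configuration (derandomization).

    Geometry. A projector of trace one satisfies P_ik P_kj = P_kk P_ij over each
    of the four algebras (projector_rank1): the proof uses the adjunctions that
    follow from |xy| = |x||y| instead of associativity. Conjugation by real
    orthogonal matrices preserves projectors, and so does conjugation by the
    diagonal matrix with a unit u at i, its conjugate at k and 1 elsewhere; for
    3 x 3 matrices over the octonions this is what the Moufang identities say
    (phase_projector). With both kinds of isometry every point can be moved to
    the projector E_00 (equivalent_point). Affine charts are bi-Lipschitz on
    bounded sets, which yields separated families of order r^(-D) points and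
    coverings by order r^(-D) small cells (packing, covering), whence the two
    bounds for the measure of a ball (ball_measure_upper, ball_measure_lower). *)

(** * Composition algebras *)

Local Notation "x ** y" := (sa_mul x y) (at level 38, left associativity).
Local Notation "x ^c" := (sa_conj x) (at level 1, format "x ^c").
Local Notation norm x := (sa_dot x x).

(** Multiplicativity of the norm holds for all four algebras; it takes the place
    of associativity, which the octonions lack. *)
Record composition_spec (R : realType) (A : star_algebra R) : Prop := {
  ca_spec : star_algebra_spec A ;
  ca_mul_linearl : forall a (x y z : A),
    sa_mul (a *: x + y) z = a *: sa_mul x z + sa_mul y z ;
  ca_mul_linearr : forall a (x y z : A),
    sa_mul z (a *: x + y) = a *: sa_mul z x + sa_mul z y ;
  ca_mul1x : forall x : A, sa_mul (sa_one A) x = x ;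
  ca_mulx1 : forall x : A, sa_mul x (sa_one A) = x ;
  ca_conjE : forall x : A, sa_conj x = (sa_re x *+ 2) *: sa_one A - x ;
  ca_norm_mul : forall x y : A,
    sa_dot (sa_mul x y) (sa_mul x y) = sa_dot x x * sa_dot y y }.

Section composition_theory.
Context {R : realType} {A : star_algebra R} (h : composition_spec A).
Implicit Types x y z t : A.

Let hs : star_algebra_spec A := ca_spec h.

Local Notation "[< x , y >]" := (sa_dot x y) (at level 0).
Local Notation one := (sa_one A).

Lemma ca_mulDl x y z : (x + y) ** z = x ** z + y ** z.
Proof. by have := ca_mul_linearl h 1 x y z; rewrite !scale1r. Qed.

Lemma ca_mulDr x y z : z ** (x + y) = z ** x + z ** y.
Proof. by have := ca_mul_linearr h 1 x y z; rewrite !scale1r. Qed.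

Lemma ca_mulZl a x y : (a *: x) ** y = a *: (x ** y).
Proof.
by have := ca_mul_linearl h a x 0 y; rewrite !addr0 (sa_mul0x hs) addr0.
Qed.

Lemma ca_mulZr a x y : x ** (a *: y) = a *: (x ** y).
Proof.
by have := ca_mul_linearr h a y 0 x; rewrite !addr0 (sa_mulx0 hs) addr0.
Qed.

Lemma ca_mulNl x y : (- x) ** y = - (x ** y).
Proof. by rewrite -scaleN1r ca_mulZl scaleN1r. Qed.

Lemma ca_mulNr x y : x ** (- y) = - (x ** y).
Proof. by rewrite -scaleN1r ca_mulZr scaleN1r. Qed.

Lemma ca_mulBl x y z : (x - y) ** z = x ** z - y ** z.
Proof. by rewrite ca_mulDl ca_mulNl. Qed.

Lemma ca_mulBr x y z : z ** (x - y) = z ** x - z ** y.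
Proof. by rewrite ca_mulDr ca_mulNr. Qed.

Lemma dotDl x y z : [< x + y, z >] = [< x, z >] + [< y, z >].
Proof. by have := sa_dot_linear hs 1 x y z; rewrite scale1r mul1r. Qed.

Lemma dotDr x y z : [< z, x + y >] = [< z, x >] + [< z, y >].
Proof. by rewrite !(sa_dotC hs z) dotDl. Qed.

Lemma dot0l x : [< 0, x >] = 0.
Proof. by rewrite /sa_dot (sa_mul0x hs) (sa_re0 hs). Qed.

Lemma dotZl a x y : [< a *: x, y >] = a * [< x, y >].
Proof. by have := sa_dot_linear hs a x 0 y; rewrite addr0 dot0l addr0. Qed.

Lemma dotZr a x y : [< x, a *: y >] = a * [< x, y >].
Proof. by rewrite (sa_dotC hs) dotZl (sa_dotC hs). Qed.

Lemma dotNr x y : [< x, - y >] = - [< x, y >].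
Proof. by rewrite -scaleN1r dotZr mulN1r. Qed.

Lemma dotBl x y z : [< x - y, z >] = [< x, z >] - [< y, z >].
Proof. by rewrite dotDl (sa_dotNl hs). Qed.

Lemma dotBr x y z : [< z, x - y >] = [< z, x >] - [< z, y >].
Proof. by rewrite dotDr dotNr. Qed.

Lemma dot_suml (I : finType) (F : I -> A) x :
  [< \sum_i F i, x >] = \sum_i [< F i, x >].
Proof. exact: (big_morph (fun z => [< z, x >]) (fun y z => dotDl y z x) (dot0l x)). Qed.

Lemma dot_sumr (I : finType) (F : I -> A) x :
  [< x, \sum_i F i >] = \sum_i [< x, F i >].
Proof. by rewrite (sa_dotC hs) dot_suml; apply: eq_bigr => i _; rewrite (sa_dotC hs). Qed.

Lemma dot_ext x y : (forall z, [< x, z >] = [< y, z >]) -> x = y.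
Proof.
move=> xy; apply/eqP; rewrite -subr_eq0; apply/eqP/(sa_dot_eq0 hs).
by rewrite dotBl xy subrr.
Qed.

Lemma conj_linear a x y : (a *: x + y)^c = a *: x^c + y^c.
Proof.
rewrite !(ca_conjE h) (sa_re_linear hs) scalerBr scalerA opprD mulrnDl scalerDl.
by rewrite -mulrnAr addrACA.
Qed.

Lemma conjD x y : (x + y)^c = x^c + y^c.
Proof. by have := conj_linear 1 x y; rewrite !scale1r. Qed.

Lemma conjZ a x : (a *: x)^c = a *: x^c.
Proof. by have := conj_linear a x 0; rewrite !addr0 (sa_conj0 hs) addr0. Qed.

Lemma conjN x : (- x)^c = - x^c.
Proof. by rewrite -scaleN1r conjZ scaleN1r. Qed.

Lemma conjB x y : (x - y)^c = x^c - y^c.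
Proof. by rewrite conjD conjN. Qed.

Lemma conj_sum (I : finType) (F : I -> A) : (\sum_i F i)^c = \sum_i (F i)^c.
Proof. exact: (big_morph _ conjD (sa_conj0 hs)). Qed.

Lemma reZ a x : sa_re (a *: x) = a * sa_re x.
Proof. by have := sa_re_linear hs a x 0; rewrite addr0 (sa_re0 hs) addr0. Qed.

Lemma re_dot1 x : sa_re x = [< x, one >].
Proof. by rewrite /sa_dot (sa_conj1 hs) (ca_mulx1 h). Qed.

Lemma dot11 : [< one, one >] = 1.
Proof. by rewrite -re_dot1 (sa_re1 hs). Qed.

Lemma dot_mull x y z : [< x ** y, x ** z >] = [< x, x >] * [< y, z >].
Proof.
have := ca_norm_mul h x (y + z).
rewrite ca_mulDr !(dotDl, dotDr) !(ca_norm_mul h) (sa_dotC hs (x ** z)).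
by rewrite (sa_dotC hs z y) !mulrDr; lra.
Qed.

Lemma dot_mulr x y z : [< y ** x, z ** x >] = [< x, x >] * [< y, z >].
Proof.
have := ca_norm_mul h (y + z) x.
rewrite ca_mulDl !(dotDl, dotDr) !(ca_norm_mul h) (sa_dotC hs (z ** x)).
by rewrite (sa_dotC hs z y) !mulrDl [X in _ -> _ = X]mulrC; lra.
Qed.

(** The composition law polarised in both factors. With one argument equal to
    1 it makes multiplication by x^c adjoint to multiplication by x, on either
    side; these adjunctions do the work of the associative law. *)
Lemma dot_exchange x y z t :
  [< x ** y, z ** t >] + [< x ** t, z ** y >] = [< x, z >] * [< y, t >] *+ 2.
Proof.
have := dot_mull (x + z) y t.
rewrite !ca_mulDl !(dotDl, dotDr) !dot_mull (sa_dotC hs z x) (sa_dotC hs (z ** y)).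
by rewrite !mulrDl; lra.
Qed.

Lemma dot_adjl x y z : [< x ** y, z >] = [< y, x^c ** z >].
Proof.
have := dot_exchange x y one z; rewrite !(ca_mul1x h) => e.
rewrite (ca_conjE h) ca_mulBl ca_mulZl (ca_mul1x h) dotBr dotZr re_dot1.
by rewrite (sa_dotC hs y (_ ** _)) mulrnAl; lra.
Qed.

Lemma dot_adjr x y z : [< x ** y, z >] = [< x, z ** y^c >].
Proof.
have := dot_exchange x y z one; rewrite !(ca_mulx1 h) => e.
rewrite (ca_conjE h) ca_mulBr ca_mulZr (ca_mulx1 h) dotBr dotZr re_dot1.
by rewrite mulrnAl [_ * [< x, z >]]mulrC; lra.
Qed.

Lemma norm_conj x : [< x^c, x^c >] = [< x, x >].
Proof. exact: (sa_dot_conj hs). Qed.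

Lemma dot_conjl x y : [< x^c, y >] = [< x, y^c >].
Proof. by rewrite -(sa_dot_conj hs) (sa_conjK hs). Qed.

Lemma conj_mulKl x y : x^c ** (x ** y) = [< x, x >] *: y.
Proof.
apply: dot_ext => z.
by rewrite dot_adjl (sa_conjK hs) dot_mull dotZl.
Qed.

Lemma mul_conjKl x y : x ** (x^c ** y) = [< x, x >] *: y.
Proof. by rewrite -{1}(sa_conjK hs x) conj_mulKl norm_conj. Qed.

Lemma mulr_conjK x y : (y ** x) ** x^c = [< x, x >] *: y.
Proof.
apply: dot_ext => z.
by rewrite dot_adjr (sa_conjK hs) dot_mulr dotZl.
Qed.

Lemma conj_mulrK x y : (y ** x^c) ** x = [< x, x >] *: y.
Proof. by rewrite -{2}(sa_conjK hs x) mulr_conjK norm_conj. Qed.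

Lemma mulx_conj x : x ** x^c = [< x, x >] *: one.
Proof. by rewrite -[X in _ ** X](ca_mulx1 h) mul_conjKl. Qed.

Lemma conj_mulx x : x^c ** x = [< x, x >] *: one.
Proof. by rewrite -[X in _ ** X](ca_mulx1 h) conj_mulKl. Qed.

Lemma conjM x y : (x ** y)^c = y^c ** x^c.
Proof.
apply: dot_ext => z; rewrite dot_conjl dot_adjl (sa_dotC hs y) dot_adjr.
by rewrite (sa_conjK hs) [RHS]dot_adjl (sa_conjK hs).
Qed.

(** The left side only depends on the product of y and z: pairing it with t
    and polarising the composition law leaves 2<x,t><yz,x^c> - |x|^2<(yz)^c,t>. *)
Lemma moufang_dot x y z t :
  [< (x ** y) ** (z ** x), t >] =
  [< x, t >] * [< y ** z, x^c >] *+ 2 - [< x, x >] * [< (y ** z)^c, t >].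
Proof.
have e1 : [< y ** z, x^c >] = [< y, x^c ** z^c >] by rewrite dot_adjr.
have e2 : [< (y ** z)^c, t >] = [< z^c, t ** y >].
  by rewrite conjM dot_adjr (sa_conjK hs).
rewrite dot_adjr conjM e1 e2; have := dot_exchange x y t (x^c ** z^c).
by rewrite mul_conjKl dotZl; lra.
Qed.

Lemma moufang_mid x y z : (x ** y) ** (z ** x) = (x ** (y ** z)) ** x.
Proof.
apply: dot_ext => t; rewrite moufang_dot.
have := moufang_dot x (y ** z) one t.
by rewrite (ca_mulx1 h) (ca_mul1x h).
Qed.

Lemma flexible x y : (x ** y) ** x = x ** (y ** x).
Proof. by have := moufang_mid x one y; rewrite (ca_mulx1 h) (ca_mul1x h). Qed.

(** The middle identity, transposed by the adjunctions. *)
Lemma moufang_left x y z : ((x ** y) ** x) ** z = x ** (y ** (x ** z)).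
Proof.
apply: dot_ext => t.
rewrite dot_adjr [RHS]dot_adjl [RHS]dot_adjr conjM.
by rewrite moufang_mid flexible dot_adjl dot_adjr.
Qed.

Lemma moufang_right x y z : ((z ** x) ** y) ** x = z ** (x ** (y ** x)).
Proof.
by apply: (can_inj (sa_conjK hs)); rewrite !conjM moufang_left.
Qed.

Lemma real_scalar x : x^c = x -> x = sa_re x *: one.
Proof.
rewrite (ca_conjE h) => /eqP; rewrite subr_eq -mulr2n => /eqP e.
apply: (@scalerI _ _ 2%:R); first by rewrite pnatr_eq0.
by rewrite scaler_nat -e scalerA mulr_natl.
Qed.

End composition_theory.

Definition sa_assoc (R : realType) (A : star_algebra R) : Prop :=
  forall x y z : A, sa_mul x (sa_mul y z) = sa_mul (sa_mul x y) z.

Definition sa_comm (R : realType) (A : star_algebra R) : Prop :=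
  forall x y : A, sa_mul x y = sa_mul y x.

Lemma real_algebra_composition (R : realType) :
  composition_spec (real_algebra R).
Proof.
split; rewrite /sa_dot /=.
- exact: real_algebra_spec.
- by move=> a x y z; rewrite /= mulrDl scalerAl.
- by move=> a x y z; rewrite /= mulrDr scalerAr.
- by move=> x; rewrite mul1r.
- by move=> x; rewrite mulr1.
- by move=> x; rewrite /GRing.scale /= mulr1 mulr2n addrK.
- by move=> x y; rewrite mulrACA.
Qed.

Section doubling.
Context {R : realType} {A : star_algebra R} (h : composition_spec A).

(** In the norm of a product the two mixed terms are <d(ac),b> and <(da)c,b>,
    which cancel because the halves associate. *)
Lemma cayley_dickson_composition :
  sa_assoc A -> composition_spec (cayley_dickson A).
Proof.
rewrite /sa_assoc => assocA; have hs := ca_spec h; split.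
- exact: (cayley_dickson_spec hs).
- move=> a [x1 x2] [y1 y2] [z1 z2] /=; congr pair => /=.
    rewrite !(ca_mulDl h, ca_mulDr h, ca_mulZl h, ca_mulZr h).
    by rewrite opprD scalerBr addrACA.
  rewrite !(ca_mulDl h, ca_mulDr h, ca_mulZl h, ca_mulZr h).
  by rewrite scalerDr addrACA.
- move=> a [x1 x2] [y1 y2] [z1 z2] /=; congr pair => /=.
    rewrite (conj_linear h) !(ca_mulDl h, ca_mulDr h, ca_mulZl h, ca_mulZr h).
    by rewrite opprD scalerBr addrACA.
  rewrite (conj_linear h) !(ca_mulDl h, ca_mulDr h, ca_mulZl h, ca_mulZr h).
  by rewrite scalerDr addrACA.
- case=> x1 x2 /=; rewrite (ca_mul1x h) (sa_mulx0 hs) (sa_mul0x hs).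
  by rewrite subr0 (ca_mulx1 h) addr0.
- case=> x1 x2 /=; rewrite (sa_conj0 hs) (sa_conj1 hs) !(ca_mulx1 h).
  by rewrite !(sa_mul0x hs) subr0 add0r.
- case=> x1 x2 /=; rewrite (ca_conjE h); congr pair => /=.
  by rewrite scaler0 sub0r.
- move=> [a b] [c d]; rewrite !(cayley_dickson_dot hs) /=.
  rewrite !(dotDl h, dotDr h, sa_dotNl hs, dotNr h) !(ca_norm_mul h).
  rewrite !(norm_conj h).
  have cross : sa_dot (sa_mul b (sa_conj c)) (sa_mul d a) =
      sa_dot (sa_mul (sa_conj d) b) (sa_mul a c).
    by rewrite [LHS](dot_adjr h) [RHS](dot_adjl h) !(sa_conjK hs) -assocA.
  rewrite (sa_dotC hs (sa_mul d a) (sa_mul b _)) cross (sa_dotC hs (sa_mul a c)).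
  by ring.
Qed.

Lemma cayley_dickson_assoc :
  sa_assoc A -> sa_comm A -> sa_assoc (cayley_dickson A).
Proof.
rewrite /sa_assoc /sa_comm => assocA commA [a b] [c d] [e f]; have hs := ca_spec h.
have CA (x y z : A) : sa_mul x (sa_mul y z) = sa_mul y (sa_mul x z).
  by rewrite !assocA (commA x).
rewrite /= !(conjD h, conjB h, conjN h, conjM h) !(sa_conjK hs).
rewrite !(ca_mulDl h, ca_mulDr h, ca_mulBl h, ca_mulBr h, ca_mulNl h, ca_mulNr h).
rewrite -!assocA; congr pair => /=.
  rewrite (CA a _ d) (commA a d) (CA _ _ b) (commA _ b) (CA e) (commA e b).
  rewrite !opprD !addrA (addrAC _ (- sa_mul (sa_conj d) _)).
  by rewrite (addrAC _ (- sa_mul (sa_conj d) _)).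
rewrite (commA c a) (commA _ a) (commA (sa_conj e) (sa_conj c)).
rewrite (commA (sa_conj d) f) (CA b f) (commA b (sa_conj d)).
by rewrite [RHS]addrACA [X in _ = _ + X]addrC.
Qed.

Lemma cayley_dickson_comm : sa_comm A -> (forall x : A, sa_conj x = x) ->
  sa_comm (cayley_dickson A).
Proof.
rewrite /sa_comm => commA conjA [a b] [c d]; rewrite /= !conjA.
by rewrite (commA a) (commA d b) [X in (_, X)]addrC.
Qed.

End doubling.

Lemma real_comm (R : realType) : sa_comm (real_algebra R).
Proof. by move=> x y; exact: mulrC. Qed.

Lemma complex_assoc (R : realType) : sa_assoc (scalars R Complexes).
Proof.
apply: cayley_dickson_assoc (real_algebra_composition R) _ (@real_comm R).
by move=> x y z; exact: mulrA.
Qed.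

Lemma complex_comm (R : realType) : sa_comm (scalars R Complexes).
Proof. exact: cayley_dickson_comm (@real_comm R) _. Qed.

Lemma scalars_assoc (R : realType) (F : division_algebra) :
  F <> Octonions -> sa_assoc (scalars R F).
Proof.
case: F => // _; first by move=> x y z; exact: mulrA.
  exact: complex_assoc.
apply: cayley_dickson_assoc (@complex_assoc R) (@complex_comm R).
apply: cayley_dickson_composition; first exact: real_algebra_composition.
by move=> x y z; exact: mulrA.
Qed.

Lemma scalars_composition (R : realType) (F : division_algebra) :
  composition_spec (scalars R F).
Proof.
have cR := real_algebra_composition R.
have cC : composition_spec (scalars R Complexes).
  by apply: cayley_dickson_composition => // x y z; exact: mulrA.
have cH : composition_spec (scalars R Quaternions).
  by apply: cayley_dickson_composition => //; exact: complex_assoc.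
case: F; [exact: cR | exact: cC | exact: cH |].
by apply: (cayley_dickson_composition cH); exact: (@scalars_assoc R Quaternions).
Qed.

(** Parseval's identity, rather than an expansion of vectors, is the form of
    completeness that turns inner products of matrices into Gram kernels. *)
Definition orthonormal_basis (R : realType) (A : star_algebra R) (J : finType)
    (b : J -> A) : Prop :=
  (forall e f, sa_dot (b e) (b f) = (e == f)%:R) /\
  (forall x y, sa_dot x y = \sum_e sa_dot x (b e) * sa_dot y (b e)).

Lemma cayley_dickson_basis (R : realType) (A : star_algebra R)
    (h : star_algebra_spec A) (J : finType) (b : J -> A) :
  orthonormal_basis b ->
  @orthonormal_basis R (cayley_dickson A) _ (fun e : J + J => match e with
    | inl e => (b e, 0)
    | inr e => (0, b e) end).
Proof.
move=> [ortho parseval].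
have d0l x : sa_dot (0 : A) x = 0 by rewrite /sa_dot (sa_mul0x h) (sa_re0 h).
have d0r (x : A) : sa_dot x 0 = 0 by rewrite (sa_dotC h).
split=> [[e|e] [f|f]|x y]; rewrite (cayley_dickson_dot h).
- by rewrite /= ortho d0l addr0.
- by rewrite /= d0l d0r addr0.
- by rewrite /= d0l d0r addr0.
- by rewrite /= ortho d0l add0r.
rewrite big_sumType parseval [in X in _ + X]parseval; congr (_ + _).
  by apply: eq_bigr => e _; rewrite !(cayley_dickson_dot h) /= !d0r !addr0.
by apply: eq_bigr => e _; rewrite !(cayley_dickson_dot h) /= !d0r !add0r.
Qed.

Lemma scalars_basis (R : realType) (F : division_algebra) :
  exists (J : finType) (b : J -> scalars R F),
    #|J| = dimR F /\ orthonormal_basis b.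
Proof.
have double (A : star_algebra R) (h : star_algebra_spec A) m :
    (exists (J : finType) (b : J -> A), #|J| = m /\ orthonormal_basis b) ->
    exists (J : finType) (b : J -> cayley_dickson A),
      #|J| = (m + m)%N /\ orthonormal_basis b.
  move=> [J [b [<- ob]]]; exists (J + J)%type; eexists; split.
    by rewrite card_sum.
  exact: (cayley_dickson_basis h ob).
have bR : exists (J : finType) (b : J -> real_algebra R),
    #|J| = 1%N /\ orthonormal_basis b.
  exists unit, (fun=> 1); split; first by rewrite card_unit.
  split=> [[] []|x y]; rewrite /sa_dot /= ?mulr1//.
  by rewrite (bigD1 tt)//= big1 ?addr0 ?mulr1// => -[].
have sR := real_algebra_spec R; have sC := cayley_dickson_spec sR.
have sH := cayley_dickson_spec sC.
case: F => //; first exact: (double _ sR 1%N).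
  exact: (double _ sC 2%N (double _ sR 1%N _)).
exact: (double _ sH 4%N (double _ sC 2%N (double _ sR 1%N _))).
Qed.

(** * Projectors of trace one *)

Section projectors.
Context {R : realType} {A : star_algebra R} (h : composition_spec A).
Context {n : nat}.
Implicit Types P : 'M[A]_n.

Let hs : star_algebra_spec A := ca_spec h.

Local Notation one := (sa_one A).

Definition diag_re P i : R := sa_re (P i i).

Lemma hermitianE P : Defs.hermitian P -> forall i j, P j i = (P i j)^c.
Proof. by move=> /forallP hP i j; have /forallP/(_ j)/eqP := hP i. Qed.

Lemma hermitian_diag P : Defs.hermitian P -> forall i, P i i = diag_re P i *: one.
Proof. by move=> hP i; apply: (real_scalar h); rewrite -hermitianE. Qed.

Lemma projector_herm P : is_projector P -> Defs.hermitian P.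
Proof. by case/and3P. Qed.

Lemma projector_sq P : is_projector P ->
  forall i j, \sum_k P i k ** P k j = P i j.
Proof.
by move=> /and3P[_ /eqP PP _] i j; move/matrixP/(_ i j): PP; rewrite mxE.
Qed.

Lemma projector_trace P : is_projector P -> \sum_i diag_re P i = 1.
Proof.
move=> /and3P[_ _ /eqP trP].
by rewrite -(sa_re1 hs) -trP /sa_trace (sa_re_sum hs).
Qed.

Lemma projector_row P : is_projector P ->
  forall i, diag_re P i = \sum_j norm (P i j).
Proof.
move=> pP i; rewrite /diag_re -(projector_sq pP) (sa_re_sum hs).
by apply: eq_bigr => j _; rewrite (hermitianE (projector_herm pP) i j).
Qed.

Lemma diag_re_ge0 P : is_projector P -> forall i, 0 <= diag_re P i.
Proof.
by move=> pP i; rewrite (projector_row pP) sumr_ge0// => j _; exact: (sa_dot_ge0 hs).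
Qed.

Lemma diag_re_eq0 P : is_projector P ->
  forall i, diag_re P i = 0 -> forall j, P i j = 0 /\ P j i = 0.
Proof.
move=> pP i; rewrite (projector_row pP) => /eqP.
rewrite psumr_eq0; last by move=> j _; exact: (sa_dot_ge0 hs).
move=> /allP P0 j; have Pij : P i j = 0.
  by apply: (sa_dot_eq0 hs); apply/eqP; exact: (P0 j (mem_index_enum _)).
by split=> //; rewrite (hermitianE (projector_herm pP) i j) Pij (sa_conj0 hs).
Qed.

(** With p = P_kk, the squared norm of the matrix P_ij - P_ik P_kj / p is
    1 - 2 + 1 = 0. The cross term is computed from the adjunction
    <P_ik P_kj, P_ij> = <P_kj, P_ki P_ij> and from P^2 = P; both are available
    over the octonions. *)
Lemma projector_rank1 P : is_projector P ->
  forall i k j, P i k ** P k j = diag_re P k *: P i j.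
Proof.
move=> pP i k j; have hP := projector_herm pP.
have [p0|p0] := eqVneq (diag_re P k) 0.
  by have [_ ->] := diag_re_eq0 pP p0 i; rewrite p0 scale0r (sa_mul0x hs).
set p := diag_re P k in p0 *.
pose Q i j : A := P i j - p^-1 *: (P i k ** P k j).
have normQ a b : norm (Q a b) =
    norm (P a b) - p^-1 *+ 2 * sa_dot (P k b) (P k a ** P a b)
      + p^-2 * norm (P a k) * norm (P k b).
  rewrite /Q !(dotBl h, dotBr h, dotZl h, dotZr h) (ca_norm_mul h).
  rewrite (sa_dotC hs (P a b)) (dot_adjl h) -(hermitianE hP a k) expr2 invfM.
  by ring.
have colk : \sum_a norm (P a k) = p.
  rewrite /p (projector_row pP); apply: eq_bigr => a _.
  by rewrite (hermitianE hP k a) (norm_conj h).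
have sumQ : \sum_a \sum_b norm (Q a b) = 0.
  under eq_bigr => a _ do under eq_bigr => b _ do rewrite normQ.
  under eq_bigr => a _ do rewrite big_split /= sumrB -!mulr_sumr -(projector_row pP).
  rewrite -(projector_row pP) -/p big_split /= sumrB (projector_trace pP) -mulr_suml.
  rewrite -!mulr_sumr exchange_big /= -/p.
  under [X in _ * X]eq_bigr => b _ do rewrite -(dot_sumr h) (projector_sq pP).
  by rewrite -(projector_row pP) colk -/p; field.
have Q0 : Q i j = 0.
  apply: (sa_dot_eq0 hs); apply/eqP; move/eqP: sumQ.
  rewrite psumr_eq0; last by move=> a _; apply: sumr_ge0 => b _; exact: (sa_dot_ge0 hs).
  move=> /allP/(_ i (mem_index_enum _)); rewrite psumr_eq0; last first.
    by move=> b _; exact: (sa_dot_ge0 hs).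
  by move=> /allP/(_ j (mem_index_enum _)).
by move/eqP: Q0; rewrite subr_eq0 => /eqP ->; rewrite scalerA divff// scale1r.
Qed.

Lemma projector_norm P : is_projector P ->
  forall i j, norm (P i j) = diag_re P i * diag_re P j.
Proof.
move=> pP i j; have hP := projector_herm pP.
have := congr1 (@sa_re R A) (projector_rank1 pP i j i).
by rewrite (hermitianE hP i j) (reZ h) mulrC => <-.
Qed.

(** The product condition is asked of three distinct indices only: in a 3 x 3
    matrix over the octonions these are the three indices in some order, which
    is the configuration that the Moufang identities describe. *)
Lemma rank1_projector P : Defs.hermitian P -> \sum_i diag_re P i = 1 ->
  (forall i j, norm (P i j) = diag_re P i * diag_re P j) ->
  (forall i k j, i != k -> k != j -> i != j ->
     P i k ** P k j = diag_re P k *: P i j) ->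
  is_projector P.
Proof.
move=> hP trP normP rank1; apply/and3P; split=> //; last first.
  apply/eqP; rewrite /sa_trace.
  under eq_bigr => i _ do rewrite (hermitian_diag hP).
  by rewrite -scaler_suml trP scale1r.
apply/eqP/matrixP => i j; rewrite mxE -[RHS]scale1r -trP scaler_suml.
apply: eq_bigr => k _.
have [<-|ik] := eqVneq i k.
  by rewrite [X in X ** _](hermitian_diag hP) (ca_mulZl h) (ca_mul1x h).
have [<-|kj] := eqVneq k j.
  by rewrite [X in _ ** X](hermitian_diag hP) (ca_mulZr h) (ca_mulx1 h).
have [<-|ij] := eqVneq i j; last exact: rank1.
rewrite [in X in _ ** X](hermitianE hP i k) (mulx_conj h) normP.
by rewrite [in RHS](hermitian_diag hP) scalerA mulrC.
Qed.

End projectors.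

(** * Isometries of the matrix model *)

Section real_conjugation.
Context {R : realType} {A : star_algebra R} (h : composition_spec A).
Context {m : nat}.
Implicit Types (P Q : 'M[A]_m) (O : 'M[R]_m).

Let hs : star_algebra_spec A := ca_spec h.

(** The conjugate of P by a real matrix. Real scalars associate with
    everything, so that orthogonal matrices act by isometries over each of the
    four algebras. *)
Definition orth_conj O P : 'M[A]_m :=
  \matrix_(i, j) \sum_k \sum_l (O i k * O j l) *: P k l.

Lemma orth_conj_rows O P i j :
  orth_conj O P i j = \sum_k O i k *: (\sum_l O j l *: P k l).
Proof.
rewrite mxE; apply: eq_bigr => k _; rewrite scaler_sumr.
by apply: eq_bigr => l _; rewrite scalerA.
Qed.

Lemma orth_conj_cols O P i j :
  orth_conj O P i j = \sum_l O j l *: (\sum_k O i k *: P k l).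
Proof.
rewrite mxE exchange_big; apply: eq_bigr => k _; rewrite scaler_sumr.
by apply: eq_bigr => l _; rewrite scalerA mulrC.
Qed.

Lemma orth_conj_comp O O' P : orth_conj O (orth_conj O' P) = orth_conj (O *m O') P.
Proof.
apply/matrixP => i j; rewrite !orth_conj_rows.
under eq_bigr => k _ do under eq_bigr => l _ do rewrite orth_conj_cols.
have E k : \sum_l O j l *: (\sum_b O' l b *: (\sum_a O' k a *: P a b)) =
    \sum_a O' k a *: (\sum_b (O *m O') j b *: P a b).
  under eq_bigr => l _ do rewrite scaler_sumr.
  rewrite exchange_big /=.
  under [in RHS]eq_bigr => a _ do rewrite scaler_sumr.
  rewrite [RHS]exchange_big /=; apply: eq_bigr => b _.
  under eq_bigr => l _ do rewrite scalerA.
  rewrite -scaler_suml mxE scaler_sumr; apply: eq_bigr => a _.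
  by rewrite !scalerA mulrC.
under eq_bigr => k _ do rewrite E scaler_sumr.
rewrite exchange_big /=; apply: eq_bigr => a _.
by under eq_bigr => k _ do rewrite scalerA; rewrite -scaler_suml mxE.
Qed.

Lemma orth_conj1 P : orth_conj 1%:M P = P.
Proof.
apply/matrixP => i j; rewrite orth_conj_rows (bigD1 i)//= [X in _ + X]big1.
  rewrite addr0 mxE eqxx scale1r (bigD1 j)//= big1.
    by rewrite addr0 mxE eqxx scale1r.
  by move=> l lj; rewrite mxE eq_sym (negbTE lj) scale0r.
by move=> k ki; rewrite mxE eq_sym (negbTE ki) scale0r.
Qed.

Section orthogonal.
Variable O : 'M[R]_m.
Hypothesis OTO : O^T *m O = 1%:M.

Lemma orth_col k l : \sum_i O i k * O i l = (k == l)%:R.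
Proof.
have /matrixP/(_ k l) := OTO; rewrite !mxE => <-.
by apply: eq_bigr => i _; rewrite mxE.
Qed.

(** Applied to the product of the algebra it gives O P O^T O P O^T = O P P O^T,
    and applied to the inner product it gives the isometry. *)
Lemma orth_sum (W : lmodType R) (B : A -> A -> W) :
  (forall a x y z, B (a *: x + y) z = a *: B x z + B y z) ->
  (forall a x y z, B z (a *: x + y) = a *: B z x + B z y) ->
  forall x y : 'I_m -> A,
  \sum_i B (\sum_k O i k *: x k) (\sum_l O i l *: y l) = \sum_k B (x k) (y k).
Proof.
move=> Bl Br x y.
have B0l z : B 0 z = 0.
  by have := Bl (-1) 0 0 z; rewrite scaler0 addr0 scaleN1r addNr.
have B0r z : B z 0 = 0.
  by have := Br (-1) 0 0 z; rewrite scaler0 addr0 scaleN1r addNr.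
have suml (a : 'I_m -> R) (u : 'I_m -> A) z :
    B (\sum_k a k *: u k) z = \sum_k a k *: B (u k) z.
  by elim/big_rec2: _ => [|k u1 u2 _ e]; rewrite ?B0l// Bl e.
have sumr (a : 'I_m -> R) (u : 'I_m -> A) z :
    B z (\sum_k a k *: u k) = \sum_k a k *: B z (u k).
  by elim/big_rec2: _ => [|k u1 u2 _ e]; rewrite ?B0r// Br e.
under eq_bigr => i _.
  rewrite suml; under eq_bigr => k _ do rewrite sumr scaler_sumr.
  over.
rewrite exchange_big /=; apply: eq_bigr => k _.
rewrite exchange_big /= (bigD1 k)//= [X in _ + X]big1 => [|l lk].
  under eq_bigr => i _ do rewrite scalerA.
  by rewrite -scaler_suml orth_col eqxx scale1r addr0.
under eq_bigr => i _ do rewrite scalerA.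
by rewrite -scaler_suml orth_col eq_sym (negbTE lk) scale0r.
Qed.

Lemma orth_conj_inner P Q : inner_mx (orth_conj O P) (orth_conj O Q) = inner_mx P Q.
Proof.
rewrite !(inner_mxE hs).
have dl a (x y z : A) : sa_dot (a *: x + y) z = a *: (sa_dot x z : R^o) + sa_dot y z.
  exact: (sa_dot_linear hs).
have dr a (x y z : A) : sa_dot z (a *: x + y) = a *: (sa_dot z x : R^o) + sa_dot z y.
  by rewrite (sa_dotC hs z) dl !(sa_dotC hs z).
under eq_bigr => i _.
  under eq_bigr => j _ do rewrite !orth_conj_cols.
  rewrite (orth_sum (W := R^o) dl dr).
  over.
rewrite exchange_big [RHS]exchange_big /=; apply: eq_bigr => l _.
exact: (orth_sum (W := R^o) dl dr).
Qed.

Lemma orth_conj_projector P : is_projector P -> is_projector (orth_conj O P).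
Proof.
move=> pP; have hP := projector_herm pP; apply/and3P; split.
- apply/forallP => i; apply/forallP => j; apply/eqP.
  rewrite orth_conj_rows orth_conj_cols (conj_sum h); apply: eq_bigr => k _.
  rewrite (conjZ h) (conj_sum h); congr (_ *: _); apply: eq_bigr => l _.
  by rewrite (conjZ h) (hermitianE hP l k).
- apply/eqP/matrixP => i j; rewrite mxE.
  under eq_bigr => k _ do rewrite orth_conj_cols orth_conj_rows.
  rewrite (orth_sum (ca_mul_linearl h) (ca_mul_linearr h)) orth_conj_rows.
  have mulsuml (a : 'I_m -> R) (u : 'I_m -> A) z :
      sa_mul (\sum_k a k *: u k) z = \sum_k a k *: sa_mul (u k) z.
    by elim/big_rec2: _ => [|k u1 u2 _ <-];
      rewrite ?(sa_mul0x hs)// (ca_mul_linearl h).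
  have mulsumr (a : 'I_m -> R) (u : 'I_m -> A) z :
      sa_mul z (\sum_k a k *: u k) = \sum_k a k *: sa_mul z (u k).
    by elim/big_rec2: _ => [|k u1 u2 _ <-];
      rewrite ?(sa_mulx0 hs)// (ca_mul_linearr h).
  under eq_bigr => k _ do rewrite mulsuml.
  rewrite exchange_big /=; apply: eq_bigr => a _; rewrite -scaler_sumr.
  congr (_ *: _); under [LHS]eq_bigr => k _ do rewrite mulsumr.
  rewrite exchange_big /=; apply: eq_bigr => b _; rewrite -scaler_sumr.
  by rewrite (projector_sq pP).
- apply/eqP; have /and3P[_ _ /eqP <-] := pP; rewrite /sa_trace.
  under eq_bigr => i _ do rewrite mxE.
  rewrite exchange_big /=; apply: eq_bigr => k _.
  rewrite exchange_big /= (bigD1 k)//= [X in _ + X]big1 => [|l lk].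
    by rewrite -scaler_suml orth_col eqxx scale1r addr0.
  by rewrite -scaler_suml orth_col eq_sym (negbTE lk) scale0r.
Qed.

End orthogonal.
End real_conjugation.

Lemma ord3_cover n (a b c z : 'I_n.+1) : n = 2%N ->
  a != b -> b != c -> a != c -> [|| z == a, z == b | z == c].
Proof.
move=> n2; rewrite -!val_eqE /=.
case: a b c z => [a al] [b bl] [c cl] [z zl] /=; move: al bl cl zl; rewrite n2.
by move: a b c z => [|[|[|a]]]// [|[|[|b]]]// [|[|[|c]]]// [|[|[|z]]].
Qed.

Section phases.
Context {R : realType} {A : star_algebra R} (h : composition_spec A).
Context {n : nat}.
Hypothesis hA : sa_assoc A \/ n = 2%N.
Implicit Types (P Q : 'M[A]_n.+1) (u x y : A).

Let hs : star_algebra_spec A := ca_spec h.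

Local Notation one := (sa_one A).

(** The opposite phase at a third index k is what the Moufang identities ask
    for; a single phase at i would not respect octonionic products. *)
Definition phase_vec u (i k l : 'I_n.+1) : A :=
  if l == i then u else if l == k then u^c else one.

Definition phase (d : 'I_n.+1 -> A) P : 'M[A]_n.+1 :=
  \matrix_(i, j) ((d i ** P i j) ** (d j)^c).

Lemma flexible_conj u x : (u ** x) ** u^c = u ** (x ** u^c).
Proof.
rewrite (ca_conjE h) !(ca_mulBr h) (flexible h) !(ca_mulZr h) !(ca_mulx1 h).
by [].
Qed.

Lemma phase_vec_assoc u i k a b x :
  (phase_vec u i k a ** x) ** (phase_vec u i k b)^c =
  phase_vec u i k a ** (x ** (phase_vec u i k b)^c).
Proof.
rewrite /phase_vec; case: ifP => _; [|case: ifP => _; last by rewrite !(ca_mul1x h)].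
- case: ifP => _; first exact: flexible_conj.
  by case: ifP => _; rewrite ?(sa_conjK hs) ?(flexible h)// (sa_conj1 hs) !(ca_mulx1 h).
- case: ifP => _; first exact: (flexible h).
  case: ifP => _; last by rewrite (sa_conj1 hs) !(ca_mulx1 h).
  exact: flexible_conj.
Qed.

Section unit_phase.
Variables (u : A) (i k : 'I_n.+1).
Hypotheses (u1 : norm u = 1) (ik : i != k).

Let d := phase_vec u i k.

Lemma phase_vec_norm l : norm (d l) = 1.
Proof.
by rewrite /d /phase_vec; do 2?case: ifP => _;
  rewrite ?(norm_conj h) ?u1 ?(dot11 h).
Qed.

Lemma phase_vecK l x : (d l)^c ** (d l ** x) = x.
Proof. by rewrite (conj_mulKl h) phase_vec_norm scale1r. Qed.

Lemma phase_vecKr l x : (x ** (d l)^c) ** d l = x.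
Proof. by rewrite (conj_mulrK h) phase_vec_norm scale1r. Qed.

Lemma phase_mul a b c x y : a != b -> b != c -> a != c ->
  ((d a ** x) ** (d b)^c) ** ((d b ** y) ** (d c)^c) =
  (d a ** (x ** y)) ** (d c)^c.
Proof.
move=> ab bc ac; case: hA => [assocA|n2].
  rewrite -assocA [X in _ ** X]assocA [X in _ ** (X ** _)]assocA.
  by rewrite (conj_mulx h) phase_vec_norm scale1r (ca_mul1x h) !assocA.
(* three distinct indices exhaust a 3 x 3 matrix, so i and k are two of a, b, c;
   each of the six cases is an instance of a Moufang identity *)
have third z := ord3_cover z n2 ab bc ac.
have uK x' : u^c ** (u ** x') = x' by rewrite (conj_mulKl h) u1 scale1r.
have uK' x' : u ** (u^c ** x') = x' by rewrite (mul_conjKl h) u1 scale1r.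
have uKr x' : (x' ** u) ** u^c = x' by rewrite (mulr_conjK h) u1 scale1r.
have uKr' x' : (x' ** u^c) ** u = x' by rewrite (conj_mulrK h) u1 scale1r.
have ki : k != i by rewrite eq_sym.
have := third i; have := third k; rewrite /d /phase_vec.
move=> /or3P[]/eqP/esym ek /or3P[]/eqP/esym ei;
  try (by move: ik; rewrite -ei -ek eqxx);
  rewrite ?ei ?ek in ab bc ac *;
  rewrite !eqxx ?(negbTE ki) ?(negbTE ik) ?(negbTE ab) ?(negbTE bc) ?(negbTE ac);
  rewrite ?[_ == i]eq_sym ?[_ == k]eq_sym;
  rewrite ?(negbTE ki) ?(negbTE ik) ?(negbTE ab) ?(negbTE bc) ?(negbTE ac);
  rewrite ?(sa_conjK hs) ?(sa_conj1 hs) ?(ca_mul1x h) ?(ca_mulx1 h);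
  first [ by rewrite (moufang_mid h)
        | by rewrite (moufang_left h) ?uK ?uK'
        | by rewrite [X in _ ** X](flexible h) -(moufang_right h) ?uKr ?uKr' ].
Qed.

Lemma phase_inner P Q : inner_mx (phase d P) (phase d Q) = inner_mx P Q.
Proof.
rewrite !(inner_mxE hs); apply: eq_bigr => a _; apply: eq_bigr => b _.
by rewrite !mxE (dot_mulr h) (dot_mull h) (norm_conj h) !phase_vec_norm !mul1r.
Qed.

Lemma phase_hermitian P : Defs.hermitian P -> Defs.hermitian (phase d P).
Proof.
move=> hP; apply/forallP => a; apply/forallP => b; apply/eqP.
by rewrite !mxE phase_vec_assoc !(conjM h) (sa_conjK hs) -(hermitianE hP).
Qed.

Lemma phase_diag P : Defs.hermitian P ->
  forall l, diag_re (phase d P) l = diag_re P l.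
Proof.
move=> hP l; rewrite /diag_re mxE [in LHS](hermitian_diag h hP).
rewrite (ca_mulZr h) (ca_mulx1 h) (ca_mulZl h) (mulx_conj h) phase_vec_norm.
by rewrite !(reZ h) (sa_re1 hs) !mulr1.
Qed.

Lemma phase_projector P : is_projector P -> is_projector (phase d P).
Proof.
move=> pP; have hP := projector_herm pP; apply: (rank1_projector h).
- exact: phase_hermitian.
- by under eq_bigr => l _ do rewrite (phase_diag hP); exact: (projector_trace h pP).
- move=> a b; rewrite mxE (ca_norm_mul h) (ca_norm_mul h) (norm_conj h).
  by rewrite !phase_vec_norm mul1r mulr1 (projector_norm h pP) !(phase_diag hP).
- move=> a b c ab bc ac; rewrite !mxE (phase_mul _ _ ab bc ac).
  rewrite (projector_rank1 h pP) (ca_mulZr h) (ca_mulZl h).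
  by rewrite [in RHS](phase_diag hP).
Qed.

End unit_phase.

Lemma phase_vec_conj u i k : i != k ->
  forall l, phase_vec u^c i k l = (phase_vec u i k l)^c.
Proof.
move=> ik l; rewrite /phase_vec; case: ifP => // _.
by case: ifP => // _; rewrite (sa_conj1 hs).
Qed.

Lemma phaseK u i k P : norm u = 1 -> i != k ->
  phase (phase_vec u^c i k) (phase (phase_vec u i k) P) = P.
Proof.
move=> u1 ik; apply/matrixP => a b; rewrite !mxE !(phase_vec_conj _ ik).
by rewrite phase_vec_assoc (phase_vecK _ _ u1) (sa_conjK hs) (phase_vecKr _ _ u1).
Qed.

End phases.

(** * Homogeneity *)

Section homogeneity.
Context {R : realType} {F : division_algebra} {n : nat}.
Hypotheses (n2 : (2 <= n)%N) (hO : F = Octonions -> n = 2%N).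
Local Notation A := (scalars R F).
Local Notation T := (projspace R F n).
Implicit Types (x y z : T) (P Q : 'M[A]_n.+1).

Let h : composition_spec A := scalars_composition R F.
Let hs : star_algebra_spec A := ca_spec h.

Lemma assoc_or_plane : sa_assoc A \/ n = 2%N.
Proof.
have [/hO ->|FO] : F = Octonions \/ F <> Octonions by case: F; [right|right|right|left].
  by right.
by left; exact: scalars_assoc.
Qed.

Definition equivalent x y : Prop := exists g : T -> T,
  [/\ bijective g, forall a b, chordal (g a) (g b) = chordal a b & g x = y].

Lemma equivalent_refl x : equivalent x x.
Proof. by exists id; split=> //; exists id. Qed.

Lemma equivalent_trans x y z : equivalent x y -> equivalent y z -> equivalent x z.
Proof.
move=> [f [fb fi fx]] [g [gb gi gy]]; exists (g \o f); split.
- exact: bij_comp.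
- by move=> a b; rewrite /= gi fi.
- by rewrite /= fx gy.
Qed.

(** An isometry of the space of matrices that preserves projectors, together
    with its inverse, restricts to projective space. *)
Lemma equivalent_matrix (f g : 'M[A]_n.+1 -> 'M[A]_n.+1) :
  (forall P, is_projector P -> is_projector (f P)) ->
  (forall P, is_projector P -> is_projector (g P)) ->
  (forall P, g (f P) = P) -> (forall P, f (g P) = P) ->
  (forall P Q, inner_mx (f P) (f Q) = inner_mx P Q) ->
  forall x, exists2 y, equivalent x y & projspace_mx y = f x.
Proof.
move=> fP gP fK gK fI x.
pose phi y : T := Projspace (fP _ (projspaceP y)).
pose psi y : T := Projspace (gP _ (projspaceP y)).
exists (phi x) => //; exists phi; split=> //.
  by exists psi => y; apply: val_inj; rewrite /= ?fK ?gK.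
by move=> a b; rewrite /chordal /= fI.
Qed.

(** The place of the opposite phase that straightening P_0j requires. *)
Lemma third_index (i j : 'I_n.+1) : exists k, (i != k) && (j != k).
Proof.
have : (0 < #|~: [set i; j]%SET|)%N.
  rewrite -(ltn_add2l #|[set i; j]%SET|) addn0 cardsC card_ord.
  by rewrite cards2 ltnS; case: (_ != _); rewrite ?(ltnW n2).
by case/card_gt0P => k; rewrite !inE negb_or ![k == _]eq_sym; exists k.
Qed.

(** The phase straightens P_0j to a nonnegative scalar and leaves the diagonal
    alone. *)
Lemma straighten x (j : 'I_n.+1) : j != ord0 -> exists y,
  [/\ equivalent x y, forall l, diag_re y l = diag_re x l &
      y ord0 j = Num.sqrt (diag_re x ord0 * diag_re x j) *: sa_one A].
Proof.
move=> j0; have pP := projspaceP x; have hP := projector_herm pP.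
have N := projector_norm h pP.
set a : A := projspace_mx x ord0 j.
have [a0|an0] := eqVneq (sa_dot a a) 0.
  exists x; split=> //; first exact: equivalent_refl.
  by rewrite -N -/a a0 sqrtr0 scale0r (sa_dot_eq0 hs a0).
have apos : 0 < sa_dot a a by rewrite lt_neqAle eq_sym an0 (sa_dot_ge0 hs).
have sa := sqr_sqrtr (ltW apos); have sapos : 0 < Num.sqrt (sa_dot a a) by rewrite sqrtr_gt0.
pose u := (Num.sqrt (sa_dot a a))^-1 *: sa_conj a.
have u1 : sa_dot u u = 1.
  rewrite /u (dotZl h) (dotZr h) (norm_conj h) -{3}sa; field.
  by rewrite gt_eqF.
have uc1 : sa_dot (sa_conj u) (sa_conj u) = 1 by rewrite (norm_conj h).
have [k /andP[ik jk]] := third_index ord0 j.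
have hA := assoc_or_plane.
have [| | | | |y xy yE] := @equivalent_matrix (phase (phase_vec u ord0 k))
  (phase (phase_vec (sa_conj u) ord0 k)) _ _ _ _ _ x.
- by move=> P; exact: (phase_projector h hA u1 ik).
- by move=> P; exact: (phase_projector h hA uc1 ik).
- by move=> P; exact: (phaseK h P u1 ik).
- by move=> P; rewrite -{1}(sa_conjK hs u); exact: (phaseK h P uc1 ik).
- by move=> P Q; exact: (phase_inner h ord0 k u1).
exists y; split=> // [l|]; first by rewrite yE (phase_diag h _ _ u1 hP).
rewrite yE mxE /phase_vec eqxx (negbTE j0) (negbTE jk) (sa_conj1 hs) (ca_mulx1 h).
rewrite -N -/a /u (ca_mulZl h) (conj_mulx h) scalerA -{2}sa expr2 mulrA.
by rewrite mulVf ?mul1r// gt_eqF.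
Qed.

(** Householder reflection, in the real plane of the indices 0 and j, taking
    (sqrt P_00, sqrt P_jj) to the first axis. *)
Lemma clear_diagonal x (j : 'I_n.+1) : j != ord0 -> 0 < diag_re x j -> exists y,
  [/\ equivalent x y, diag_re y j = 0 &
      forall l, l != ord0 -> l != j -> diag_re y l = diag_re x l].
Proof.
move=> j0 q0; have [z [xz zx zj]] := straighten x j0.
rewrite -!zx in q0 zj *; have pP := projspaceP z; have hP := projector_herm pP.
set P := projspace_mx z in q0 zj pP hP zx *.
set p := diag_re P ord0 in zj; set q := diag_re P j in q0 zj.
have p0 : 0 <= p by exact: (diag_re_ge0 h pP).
pose s := Num.sqrt (p + q); have s0 : 0 < s by rewrite sqrtr_gt0; lra.
have ss : s ^+ 2 = p + q by rewrite sqr_sqrtr; lra.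
pose c := Num.sqrt p / s; pose sg := Num.sqrt q / s.
have pp : Num.sqrt p ^+ 2 = p by rewrite sqr_sqrtr.
have qq : Num.sqrt q ^+ 2 = q by rewrite sqr_sqrtr// ltW.
have cs : c ^+ 2 + sg ^+ 2 = 1.
  by rewrite /c /sg !expr_div_n pp qq ss -mulrDl divff//; lra.
have c1 : 0 < 1 - c.
  by rewrite subr_gt0 /c ltr_pdivrMr// mul1r ltr_sqrt//; lra.
pose k := (1 - c)^-1.
pose v : 'cV[R]_n.+1 :=
  \col_l (if l == ord0 then c - 1 else if l == j then sg else 0).
have vTv : v^T *m v = (2 - 2 * c)%:M.
  apply/matrixP => a b; rewrite !ord1 mxE [RHS]mxE eqxx mulr1n.
  rewrite (bigD1 ord0)//= (bigD1 j)//= big1 ?addr0.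
    by rewrite !mxE !eqxx (negbTE j0) -!expr2; move: cs; lra.
  by move=> l /andP[l0 lj]; rewrite !mxE (negbTE l0) (negbTE lj) mulr0.
pose O : 'M[R]_n.+1 := 1%:M - k *: (v *m v^T).
have vE l : v l ord0 = if l == ord0 then c - 1 else if l == j then sg else 0.
  by rewrite mxE.
have OE a b : O a b = (a == b)%:R - k * (v a ord0 * v b ord0).
  by rewrite [LHS]mxE [X in X + _]mxE [X in _ + X]mxE [X in - X]mxE [X in k * X]mxE
    big_ord1 [v^T _ _]mxE.
have OT : O^T = O by rewrite /O linearB linearZ /= trmx_mul trmxK trmx1.
have OO : O *m O = 1%:M.
  rewrite /O mulmxBl mul1mx mulmxBr mulmx1 -scalemxAl -scalemxAr mulmxA.
  rewrite -[v *m v^T *m v]mulmxA vTv mul_mx_scalar -scalemxAl !scalerA.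
  have -> : k * (k * (2 - 2 * c)) = k * 2.
    by rewrite /k; field; rewrite gt_eqF.
  rewrite (mulrC k) -scalerA scaler_nat mulr2n.
  by rewrite opprB addrK subrK.
have OTO : O^T *m O = 1%:M by rewrite OT.
have Oj l : O j l = if l == ord0 then sg else if l == j then - c else 0.
  rewrite OE !vE (negbTE j0) eqxx (eq_sym j).
  case: (eqVneq l ord0) => [->|l0]; last case: eqVneq => _.
  - by rewrite eq_sym (negbTE j0) mulr0n /k; field; rewrite gt_eqF.
  - rewrite mulr1n -expr2; have -> : sg ^+ 2 = (1 - c) * (1 + c) by move: cs; lra.
    by rewrite /k mulrA mulVf ?gt_eqF//; lra.
  - by rewrite mulr0 mulr0 subr0.
have Ol l m : l != ord0 -> l != j -> O l m = (l == m)%:R.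
  move=> l0 lj.
  by rewrite OE vE (negbTE l0) (negbTE lj) mul0r mulr0 subr0.
have rowj (u : 'I_n.+1 -> A) : \sum_l O j l *: u l = sg *: u ord0 - c *: u j.
  rewrite (bigD1 ord0)//= (bigD1 j)//= big1 => [|l /andP[l0 lj]].
    by rewrite !Oj eqxx (negbTE j0) eqxx addr0 scaleNr.
  by rewrite Oj (negbTE l0) (negbTE lj) scale0r.
have rowl l (u : 'I_n.+1 -> A) : l != ord0 -> l != j ->
    \sum_m O l m *: u m = u l.
  move=> l0 lj; rewrite (bigD1 l)//= big1 => [|m ml].
    by rewrite Ol// eqxx scale1r addr0.
  by rewrite Ol// eq_sym (negbTE ml) scale0r.
have [| | | | |y zy yE] := @equivalent_matrix (orth_conj O) (orth_conj O) _ _ _ _ _ z.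
- by move=> Q; exact: (orth_conj_projector h OTO).
- by move=> Q; exact: (orth_conj_projector h OTO).
- by move=> Q; rewrite orth_conj_comp OO orth_conj1.
- by move=> Q; rewrite orth_conj_comp OO orth_conj1.
- by move=> Q Q'; exact: (orth_conj_inner h OTO).
exists y; split=> [| |l l0 lj]; first exact: equivalent_trans zy.
- rewrite /diag_re yE orth_conj_rows rowj !rowj.
  rewrite !(sa_reD hs, sa_reN hs, reZ h) (hermitianE hP ord0 j) zj (conjZ h).
  rewrite (sa_conj1 hs) !(reZ h) (sa_re1 hs) -/(diag_re P ord0) -/(diag_re P j).
  have ep : Num.sqrt p = c * s by rewrite /c divfK// gt_eqF.
  have eq : Num.sqrt q = sg * s by rewrite /sg divfK// gt_eqF.
  have pE : p = (c * s) ^+ 2 by rewrite -ep pp.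
  have qE : q = (sg * s) ^+ 2 by rewrite -eq qq.
  rewrite -/p -/q sqrtrM// ep eq pE qE.
  by ring.
- by rewrite -zx /diag_re yE orth_conj_rows rowl// rowl.
Qed.

Lemma concentrated x : (forall l, l != ord0 -> diag_re x l = 0) -> x = point.
Proof.
move=> x0; have pP := projspaceP x; apply: val_inj; apply/matrixP => i j /=.
rewrite mxE; case: eqVneq => [->|i0]; last first.
  by have [-> _] := diag_re_eq0 h pP (x0 i i0) j.
case: eqVneq => [->|j0]; last first.
  by have [_ ->] := diag_re_eq0 h pP (x0 j j0) ord0.
rewrite (hermitian_diag h (projector_herm pP)).
have := projector_trace h pP; rewrite (bigD1 ord0)//= big1 // addr0 => ->.
by rewrite scale1r.
Qed.

(** Homogeneity, by induction on the number of nonzero diagonal entries other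
    than the first: clearing one of them leaves the others alone. *)
Lemma equivalent_point x : equivalent x point.
Proof.
pose bad y := [set j | (j != ord0) && (diag_re (projspace_mx y) j != 0)]%SET.
move: {2}#|bad x| (leqnn #|bad x|) => m.
elim: m x => [|m IHm] x; last first.
  have [/eqP|/set0Pn[j]] := boolP (bad x == finset.set0).
    by move=> b0 _; apply: IHm; rewrite b0 cards0.
  rewrite inE => /andP[j0 xj] bx; have pP := projspaceP x.
  have xj0 : 0 < diag_re x j by rewrite lt_neqAle eq_sym xj (diag_re_ge0 h pP).
  have [y [xy yj yl]] := clear_diagonal j0 xj0.
  apply: equivalent_trans xy _; apply: IHm; rewrite -ltnS; apply: leq_trans bx.
  apply: proper_card; apply/properP; split; last first.
    by exists j; rewrite inE ?j0 ?xj// yj eqxx andbF.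
  apply/fintype.subsetP => l; rewrite !inE => /andP[l0].
  have [->|lj] := eqVneq l j; first by rewrite yj eqxx.
  by rewrite yl// l0.
rewrite leqn0 cards_eq0 => /eqP b0; rewrite (_ : x = point).
  exact: equivalent_refl.
apply: concentrated => l l0; apply/eqP; apply/negPn/negP => xl.
by have := finset.in_set0 l; rewrite -b0 inE l0 xl.
Qed.

Lemma inner_chordal x y : inner_mx x y = 1 - chordal x y ^+ 2.
Proof.
have t1 : inner_mx x y <= 1.
  have := inner_mx_CS hs x y; rewrite !(inner_mx_projector hs) ?projspaceP//.
  by rewrite mulr1 => t2; rewrite (le_trans (ler_norm _))// -(ler_pXn2r (n := 2))
    ?nnegrE// real_normK ?num_real// expr1n.
by rewrite /chordal sqr_sqrtr ?subr_ge0// opprB addrC subrK.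
Qed.

Lemma equivalent_inner x : exists g : T -> T,
  [/\ bijective g, forall a b, chordal (g a) (g b) = chordal a b, g x = point &
      forall a b, inner_mx (projspace_mx (g a)) (g b) = inner_mx a b].
Proof.
have [g [gb gi gx]] := equivalent_point x; exists g; split=> // a b.
by rewrite !inner_chordal gi.
Qed.

Lemma inner_point x : inner_mx (projspace_mx (point : T)) x = diag_re x ord0.
Proof.
rewrite (inner_mxE hs) (bigD1 ord0)//= (bigD1 ord0)//= !big1 ?addr0.
- by rewrite mxE eqxx /= (sa_dotC hs) -(re_dot1 h).
- by move=> i i0; rewrite big1// => j _; rewrite mxE (negbTE i0) (dot0l h).
- by move=> j j0; rewrite mxE (negbTE j0) andbF (dot0l h).
Qed.

(** After moving x to the base point, <x, y> is a diagonal entry of y. *)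
Lemma inner_ge0 x y : 0 <= inner_mx x y.
Proof.
have [g [_ _ gx <-]] := equivalent_inner x; rewrite gx inner_point.
exact: (diag_re_ge0 h (projspaceP _)).
Qed.

Lemma inner_le1 x y : inner_mx x y <= 1.
Proof. by rewrite inner_chordal lerBlDr lerDl sqr_ge0. Qed.

Lemma chordal_ge0 x y : 0 <= chordal x y.
Proof. exact: sqrtr_ge0. Qed.

Lemma chordal_le1 x y : chordal x y <= 1.
Proof.
by rewrite -[leRHS]sqrtr1 ler_wsqrtr// lerBlDr lerDl inner_ge0.
Qed.

End homogeneity.

(** * Affine charts *)

Section charts.
Context {R : realType} {F : division_algebra} {n : nat}.
Hypothesis hO : F = Octonions -> n = 2%N.
Local Notation A := (scalars R F).
Local Notation T := (projspace R F n).
Implicit Types (x y z : T) (P Q : 'M[A]_n.+1) (w : 'I_n.+1 -> A).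

Let h : composition_spec A := scalars_composition R F.
Let hs : star_algebra_spec A := ca_spec h.

Local Notation one := (sa_one A).

Lemma norm_ge0 (a : A) : 0 <= norm a. Proof. exact: (sa_dot_ge0 hs). Qed.

Lemma normD_le (a b : A) : norm (a + b) <= 2 * (norm a + norm b).
Proof.
have := norm_ge0 (a - b); rewrite !(dotDl h, dotDr h, sa_dotNl hs, dotNr h).
by rewrite (sa_dotC hs b a); lra.
Qed.

(** Young's inequality. With the mesh of a grid as eta it bounds the variation
    of the norm linearly in the mesh. *)
Lemma dot_le (eta : R) (a b : A) : 0 < eta ->
  `|sa_dot a b| <= (norm a / eta + eta * norm b) / 2.
Proof.
move=> e0; have := norm_ge0 (a - eta *: b); have := norm_ge0 (a + eta *: b).
rewrite !(dotDl h, dotDr h, sa_dotNl hs, dotNr h, dotZl h, dotZr h).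
rewrite (sa_dotC hs b a) => H1 H2.
have -> : norm a / eta + eta * norm b = (norm a + eta ^+ 2 * norm b) / eta.
  by field; rewrite gt_eqF.
rewrite -mulrA -invfM ler_pdivlMr ?mulr_gt0//.
have [ge0|lt0] := leP 0 (sa_dot a b).
  by rewrite ger0_norm//; move: H1 H2; rewrite expr2; lra.
by rewrite ltr0_norm//; move: H1 H2; rewrite expr2; lra.
Qed.

Definition chart_scale w : R := (\sum_l norm (w l))^-1.

(** The projector onto the line spanned by w. *)
Definition chart_mx w : 'M[A]_n.+1 :=
  \matrix_(i, j) (chart_scale w *: ((w i)^c ** w j)).

Lemma chart_sum_ge1 w i : w i = one -> 1 <= \sum_l norm (w l).
Proof.
move=> wi; rewrite (bigD1 i)//= wi (dot11 h) lerDl.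
by apply: sumr_ge0 => l _; exact: norm_ge0.
Qed.

(** The coordinate w_0 = 1 makes the entries multiply as they should: in a
    3 x 3 matrix a product over three distinct indices involves w_0, and what
    remains is an identity in two elements. *)
Lemma chart_projector w : w ord0 = one -> is_projector (chart_mx w).
Proof.
move=> w0; set p := chart_scale w.
have S0 : \sum_l norm (w l) != 0.
  by rewrite gt_eqF// (lt_le_trans ltr01)// (chart_sum_ge1 w0).
have dE l : diag_re (chart_mx w) l = p * norm (w l).
  by rewrite /diag_re mxE (conj_mulx h) !(reZ h) (sa_re1 hs) mulr1.
apply: (rank1_projector h).
- apply/forallP => i; apply/forallP => j; rewrite !mxE (conjZ h) (conjM h).
  by rewrite (sa_conjK hs).
- under eq_bigr => l _ do rewrite dE.
  by rewrite -mulr_sumr mulVf.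
- move=> i j; rewrite !dE mxE (dotZl h) (dotZr h) (ca_norm_mul h) (norm_conj h).
  by rewrite -/p; ring.
- move=> i k j ik kj ij; rewrite dE !mxE -/p (ca_mulZl h) (ca_mulZr h) !scalerA.
  rewrite [p * norm _ * p]mulrAC -[RHS]scalerA; congr (_ *: _).
  case: (@assoc_or_plane R F n hO) => [assocA|n2'].
    rewrite assocA -[_ ** w k ** _]assocA (mulx_conj h).
    by rewrite (ca_mulZr h) (ca_mulZl h) (ca_mulx1 h).
  have /or3P[] := ord3_cover ord0 n2' ik kj ij; move=> /eqP e; move: w0; rewrite e => w0.
  + by rewrite w0 (sa_conj1 hs) !(ca_mul1x h) (mul_conjKl h).
  + by rewrite w0 (sa_conj1 hs) (dot11 h) scale1r (ca_mulx1 h) (ca_mul1x h).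
  + by rewrite w0 !(ca_mulx1 h) (mulr_conjK h).
Qed.

(** In the chart the point is read off from its first row: w_j = P_0j / P_00.
    The bound L on the sum of the norms keeps P_00 away from 0. *)
Lemma chart_separated w w' (L : R) j : w ord0 = one -> w' ord0 = one ->
  \sum_l norm (w l) <= L -> \sum_l norm (w' l) <= L ->
  norm (w j - w' j) <=
  8 * L ^+ 3 * (inner_mx (chart_mx w - chart_mx w') (chart_mx w - chart_mx w') / 2).
Proof.
move=> w0 w'0 wL w'L; set p := chart_scale w; set p' := chart_scale w'.
set U := chart_mx w - chart_mx w'.
have L1 : 1 <= L := le_trans (chart_sum_ge1 w0) wL.
have L0 : 0 < L := lt_le_trans ltr01 L1.
have S0 : 0 < \sum_l norm (w l) by rewrite (lt_le_trans ltr01)// (chart_sum_ge1 w0).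
have p0 : 0 < p by rewrite invr_gt0.
have pL : p^-1 <= L by rewrite invrK.
have w'jL : norm (w' j) <= L.
  by apply: le_trans w'L; rewrite (bigD1 j)//= lerDl sumr_ge0// => l _; exact: norm_ge0.
have UE k : norm (U ord0 k) <= inner_mx U U.
  rewrite (inner_mxE hs) (bigD1 ord0)//= (bigD1 k)//= -addrA lerDl addr_ge0//.
    by rewrite sumr_ge0// => l _; exact: norm_ge0.
  by rewrite sumr_ge0// => l _; rewrite sumr_ge0// => l' _; exact: norm_ge0.
have U0 : norm (U ord0 ord0) = (p - p') ^+ 2.
  rewrite !mxE w0 w'0 (sa_conj1 hs) (ca_mul1x h) -scalerBl (dotZl h) (dotZr h).
  by rewrite (dot11 h) mulr1 expr2.
have wE : w j - w' j = p^-1 *: (U ord0 j + (p' - p) *: w' j).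
  rewrite !mxE w0 w'0 (sa_conj1 hs) !(ca_mul1x h) -/p -/p' scalerBl.
  by rewrite addrA subrK -scalerBr scalerA mulVf ?scale1r// gt_eqF.
rewrite wE (dotZl h) (dotZr h) mulrA.
apply: (@le_trans _ _ (L ^+ 2 * (2 * (norm (U ord0 j) + norm ((p' - p) *: w' j))))).
  apply: ler_pM; rewrite ?normD_le ?norm_ge0 ?mulr_ge0 ?invr_ge0 ?(ltW S0)//.
  by rewrite expr2 ler_pM ?invr_ge0 ?invrK ?(ltW S0)// -/p.
rewrite (dotZl h) (dotZr h).
have H1 := UE j; have := UE ord0; rewrite U0 => H2.
have e2 : (p' - p) * ((p' - p) * norm (w' j)) = (p - p') ^+ 2 * norm (w' j) by ring.
rewrite e2; have H3 : (p - p') ^+ 2 * norm (w' j) <= inner_mx U U * L.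
  by rewrite ler_pM ?sqr_ge0 ?norm_ge0.
have I0 := inner_mx_ge0 hs U.
have -> : 8 * L ^+ 3 * (inner_mx U U / 2) = L ^+ 2 * (2 * (2 * (L * inner_mx U U))).
  by field.
rewrite ler_wpM2l ?sqr_ge0// ler_wpM2l//.
have : inner_mx U U <= L * inner_mx U U by rewrite ler_peMl.
by move: H1 H3; rewrite [X in _ -> _ <= X -> _]mulrC; lra.
Qed.

Section basis.
Variables (J : finType) (b : J -> A).
Hypotheses (cardJ : #|J| = dimR F) (ob : orthonormal_basis b).

Lemma norm_parseval a : norm a = \sum_e sa_dot a (b e) ^+ 2.
Proof. by rewrite (ob.2 a a); apply: eq_bigr => e _; rewrite expr2. Qed.

Lemma card_grid m : #|{: {ffun 'I_n * J -> 'I_m}}| = (m ^ projdim F n)%N.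
Proof. by rewrite card_ffun card_ord card_prod card_ord cardJ. Qed.

(** A point of the chart for each node of a grid in the unit cube. *)
Definition grid_vec m (g : {ffun 'I_n * J -> 'I_m}) (l : 'I_n.+1) : A :=
  if unlift ord0 l is Some j then \sum_e ((g (j, e))%:R / m%:R) *: b e else one.

Lemma grid_vec0 m (g : {ffun 'I_n * J -> 'I_m}) : grid_vec g ord0 = one.
Proof. by rewrite /grid_vec unlift_none. Qed.

Lemma grid_vec_coord m (g : {ffun 'I_n * J -> 'I_m}) j e :
  sa_dot (grid_vec g (lift ord0 j)) (b e) = (g (j, e))%:R / m%:R.
Proof.
rewrite /grid_vec liftK (dot_suml h) (bigD1 e)//= big1 => [|f fe].
  by rewrite (dotZl h) ob.1 eqxx mulr1 addr0.
by rewrite (dotZl h) ob.1 (negbTE fe) mulr0.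
Qed.

Lemma grid_vec_bound m (g : {ffun 'I_n * J -> 'I_m}) :
  \sum_l norm (grid_vec g l) <= (1 + projdim F n)%:R.
Proof.
rewrite big_ord_recl (grid_vec0 g) (dot11 h) natrD lerD2l /projdim natrM -cardJ.
apply: (@le_trans _ _ (\sum_(j < n) #|J|%:R)); last first.
  by rewrite sumr_const card_ord mulr_natl.
apply: ler_sum => j _; rewrite norm_parseval.
apply: (@le_trans _ _ (\sum_(e : J) 1)); last by rewrite sumr_const.
apply: ler_sum => e _.
have m0 : (0 < m)%N by case: m g => // g; case: (g (j, e)).
rewrite grid_vec_coord expr_le1// ?divr_ge0// ler_pdivrMr ?ltr0n// mul1r ler_nat.
exact: ltnW.
Qed.

End basis.

(** Nodes of a grid of mesh of order r in a cube of the affine chart: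
    distinct nodes differ by at least the mesh in one of the D coordinates. *)
Lemma packing : exists2 c : R, 0 < c & forall r, 0 < r ->
  exists (I : finType) (x : I -> T), [/\ (0 < #|I|)%N,
    c <= #|I|%:R * r ^+ projdim F n &
    forall i j, i != j -> r <= chordal (x i) (x j)].
Proof.
have [J [b [cardJ ob]]] := scalars_basis R F.
set D := projdim F n; pose L : R := (1 + D)%:R.
have L1 : 1 <= L by rewrite ler1n.
pose M : R := 8 * L ^+ 3.
have M1 : 1 <= M by have := exprn_ege1 3 L1; rewrite /M; lra.
have M0 : 0 < M := lt_le_trans ltr01 M1.
exists ((2 * M) ^+ D)^-1; first by rewrite invr_gt0 exprn_gt0// mulr_gt0.
move=> r r0; have [rM|rM] := ltP 1 (M * r).
  exists unit, (fun=> point); split; rewrite ?card_unit//.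
  rewrite mul1r -exprVn lerXn2r ?nnegrE ?invr_ge0 ?mulr_ge0 ?(ltW M0) ?(ltW r0)//.
  by rewrite -[X in X <= _]mul1r ler_pdivrMr ?mulr_gt0//; lra.
pose m := Num.truncn (M * r)^-1.
have Mr0 : 0 < M * r by rewrite mulr_gt0.
have /andP[mle mgt] : m%:R <= (M * r)^-1 < m.+1%:R.
  by apply: truncn_itv; rewrite invr_ge0 ltW.
have m0 : (0 < m)%N by rewrite truncn_gt0 invf_ge1.
exists {ffun 'I_n * J -> 'I_m},
  (fun g => Projspace (chart_projector (grid_vec0 b g))).
split.
- by rewrite (card_grid cardJ) expn_gt0 m0.
- rewrite (card_grid cardJ) natrX -exprMn -exprVn lerXn2r//.
  + by rewrite nnegrE invr_ge0 mulr_ge0// ltW.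
  + by rewrite nnegrE mulr_ge0// ltW.
  have : (M * r)^-1 <= 2 * m%:R.
    apply: (le_trans (ltW mgt)); rewrite -natr1 mulr_natl mulr2n lerD2l ler1n//.
  rewrite -[X in X <= _]mul1r ler_pdivrMr// => H.
  by rewrite -[X in X <= _]mul1r ler_pdivrMr ?mulr_gt0//; lra.
move=> g g' gg'.
have [[j e] /= ge] : exists je, g je != g' je.
  apply/existsP; rewrite -negb_forall; apply: contra gg' => /forallP H.
  by apply/eqP/ffunP => je; apply/eqP.
have := chart_separated (lift ord0 j) (grid_vec0 b g) (grid_vec0 b g')
  (grid_vec_bound cardJ ob g) (grid_vec_bound cardJ ob g').
rewrite -/L -/M => H.
have mR0 : (0 : R) < m%:R by rewrite ltr0n.
have m1 : (m%:R^-1) ^+ 2 <= norm (grid_vec b g (lift ord0 j) - grid_vec b g' (lift ord0 j)).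
  rewrite (norm_parseval ob) (bigD1 e)//= (dotBl h) !(grid_vec_coord ob) -mulrBl.
  rewrite exprMn ler_wpDr ?sumr_ge0// => [f _|]; first exact: sqr_ge0.
  rewrite ler_peMl ?sqr_ge0//.
  rewrite -real_normK ?num_real// exprn_ege1//.
    have : g (j, e) != g' (j, e) :> nat by [].
    rewrite neq_ltn => /orP[lt|lt].
      rewrite distrC ger0_norm ?subr_ge0 ?ler_nat ?(ltnW lt)//.
      by rewrite lerBrDr addrC natr1 ler_nat.
    rewrite ger0_norm ?subr_ge0 ?ler_nat ?(ltnW lt)//.
    by rewrite lerBrDr addrC natr1 ler_nat.
rewrite chordalE /=.
set U := chart_mx _ - chart_mx _ in H *.
rewrite -[leLHS]ger0_norm ?(ltW r0)// -sqrtr_sqr ler_wsqrtr//.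
have H2 : (M * r) ^+ 2 <= (m%:R^-1) ^+ 2.
  rewrite lerXn2r ?nnegrE ?invr_ge0 ?(ltW mR0) ?(ltW Mr0)//.
  by rewrite -[leLHS]invrK lef_pV2 ?posrE ?invr_gt0.
have H3 : M * r ^+ 2 <= (M * r) ^+ 2.
  by rewrite exprMn ler_wpM2r ?sqr_ge0// expr2 ler_peMl// ltW.
by rewrite -(ler_pM2l M0); apply: le_trans H3 _; apply: le_trans H2 _; apply: le_trans m1 H.
Qed.

End charts.

Section cells.
Context {R : realType} {F : division_algebra} {n : nat}.
Local Notation A := (scalars R F).
Local Notation T := (projspace R F n).
Implicit Types (x y z : T) (P Q : 'M[A]_n.+1).

Let h : composition_spec A := scalars_composition R F.
Let hs : star_algebra_spec A := ca_spec h.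

Local Notation one := (sa_one A).
Local Notation L := (n.+1%:R : R).

Lemma large_diagonal x : exists i, L^-1 <= diag_re x i.
Proof.
apply/not_existsP => small.
have := projector_trace h (projspaceP x); apply/eqP; rewrite lt_eqF//.
apply: (@lt_le_trans _ _ (\sum_(i < n.+1) L^-1)); last first.
  by rewrite sumr_const card_ord -(mulr_natr L^-1) mulVf.
apply: ltr_sum => [|i _]; first by apply/hasP; exists ord0; rewrite ?mem_index_enum.
by rewrite ltNge; apply/negP/small.
Qed.

(** The affine coordinates of x in the chart whose i-th coordinate is 1. *)
Definition chart_coord x i j : A := (diag_re x i)^-1 *: projspace_mx x i j.

Section chart.
Variables (x : T) (i : 'I_n.+1).
Hypothesis xi : L^-1 <= diag_re x i.

Let p := diag_re x i.
Let w := chart_coord x i.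
Let pP := projspaceP x.

Lemma chart_diag_gt0 : 0 < p.
Proof. by apply: lt_le_trans xi; rewrite invr_gt0. Qed.

Lemma chart_diag_le1 : p <= 1.
Proof.
have := projector_trace h pP; rewrite (bigD1 i)//= -/p => <-.
by rewrite lerDl sumr_ge0// => j _; exact: (diag_re_ge0 h pP).
Qed.

Lemma chart_coord_norm j : p * norm (w j) = diag_re x j.
Proof.
rewrite /w /chart_coord (dotZl h) (dotZr h) (projector_norm h pP) -/p.
by field; rewrite gt_eqF// chart_diag_gt0.
Qed.

Lemma chart_coord_diag : w i = one.
Proof.
rewrite /w /chart_coord (hermitian_diag h (projector_herm pP)) scalerA mulVf.
  by rewrite scale1r.
by rewrite gt_eqF// chart_diag_gt0.
Qed.

Lemma chart_coord_sum : p * \sum_j norm (w j) = 1.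
Proof.
rewrite mulr_sumr -(projector_trace h pP); apply: eq_bigr => j _.
exact: chart_coord_norm.
Qed.

Lemma chart_coord_sum_le : \sum_j norm (w j) <= L.
Proof.
rewrite -[leLHS]mul1r -{1}(mulVf (lt0r_neq0 chart_diag_gt0)) -mulrA chart_coord_sum.
by rewrite mulr1 -[leRHS]invrK lef_pV2 ?posrE ?invr_gt0 ?chart_diag_gt0.
Qed.

Lemma chart_coord_le j : norm (w j) <= L.
Proof.
apply: le_trans chart_coord_sum_le; rewrite (bigD1 j)//= lerDl.
by rewrite sumr_ge0// => k _; exact: (sa_dot_ge0 hs).
Qed.

Lemma chart_coordE j k : projspace_mx x j k = p *: ((w j)^c ** w k).
Proof.
have p0 := lt0r_neq0 chart_diag_gt0.
rewrite /w /chart_coord (conjZ h) (ca_mulZl h) (ca_mulZr h).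
rewrite -(hermitianE (projector_herm pP)) (projector_rank1 h pP) !scalerA -/p.
by rewrite !mulrA mulfV// mul1r mulVf// scale1r.
Qed.

End chart.

(** The entries of x are p w_j^c w_k, where 1/p is the sum of the norms of the
    w_j and p >= 1/L: they depend on the coordinates in a Lipschitz way. *)
Lemma chart_lipschitz x y i (m delta : R) : 0 <= m -> 0 < delta ->
  L^-1 <= diag_re x i -> L^-1 <= diag_re y i ->
  (forall j, norm (chart_coord x i j - chart_coord y i j) <= m * delta ^+ 2) ->
  chordal x y ^+ 2 <= 3 / 2 * L ^+ 8 * (m + 4) ^+ 2 * delta ^+ 2.
Proof.
move=> m0 d0 xi yi close.
set p := diag_re x i; set p' := diag_re y i.
set w := chart_coord x i; set w' := chart_coord y i.
have L1 : 1 <= L by rewrite ler1n.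
have N0 (a : A) : 0 <= norm a by exact: (sa_dot_ge0 hs).
have [p0 p1] := (chart_diag_gt0 xi, chart_diag_le1 x i).
have [p'0 p'1] := (chart_diag_gt0 yi, chart_diag_le1 y i).
have wL j : norm (w j) <= L := chart_coord_le xi j.
have w'L j : norm (w' j) <= L := chart_coord_le yi j.
have dnorm j : `|norm (w' j) - norm (w j)| <= (m + 4 * L) * delta.
  have -> : norm (w' j) - norm (w j) = - sa_dot (w j - w' j) (w j + w' j).
    rewrite !(dotDl h, dotDr h, sa_dotNl hs) (sa_dotC hs (w j) (w' j)); ring.
  rewrite normrN; apply: (le_trans (dot_le _ _ d0)).
  have H1 : norm (w j - w' j) / delta <= m * delta.
    by rewrite ler_pdivrMr// -mulrA -expr2; exact: close.
  have H2 : delta * norm (w j + w' j) <= delta * (4 * L).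
    rewrite ler_wpM2l ?(ltW d0)//; apply: (le_trans (normD_le _ _)).
    by have := wL j; have := w'L j; lra.
  have H3 : 0 <= m * delta by rewrite mulr_ge0// ltW.
  have H4 : 0 <= delta * (4 * L) by rewrite !mulr_ge0// ltW.
  by move: H1 H2 H3 H4; lra.
have dp : `|p - p'| <= L * (m + 4 * L) * delta.
  have -> : p - p' = p * p' * \sum_j (norm (w' j) - norm (w j)).
    rewrite sumrB; set S := \sum_j norm (w j); set S' := \sum_j norm (w' j).
    have -> : p * p' * (S' - S) = p * (p' * S') - p' * (p * S) by ring.
    by rewrite (chart_coord_sum xi) (chart_coord_sum yi) !mulr1.
  rewrite normrM ger0_norm ?mulr_ge0 ?(ltW p0) ?(ltW p'0)//.
  rewrite -[leRHS]mul1r ler_pM ?mulr_ge0 ?(ltW p0) ?(ltW p'0)//.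
    by rewrite -[leRHS]mul1r ler_pM ?(ltW p0) ?(ltW p'0).
  apply: (le_trans (ler_norm_sum _ _ _)).
  apply: (@le_trans _ _ (\sum_(j < n.+1) (m + 4 * L) * delta)).
    by apply: ler_sum => j _; exact: dnorm.
  by rewrite sumr_const card_ord -(mulr_natl (_ * delta)) mulrA.
have entry j k : norm ((projspace_mx x - projspace_mx y) j k) <=
    3 * L ^+ 6 * (m + 4) ^+ 2 * delta ^+ 2.
  set e := (m + 4) ^+ 2 * delta ^+ 2.
  have D2 : 0 <= delta ^+ 2 by exact: sqr_ge0.
  have me : 16 * (m * delta ^+ 2) <= e.
    rewrite /e mulrA ler_wpM2r//; have := sqr_ge0 (m - 4); rewrite !expr2; lra.
  have -> : (projspace_mx x - projspace_mx y) j k =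
      (p - p') *: ((w j)^c ** w k) +
      p' *: ((w j - w' j)^c ** w k + (w' j)^c ** (w k - w' k)).
    rewrite [LHS]mxE [X in _ + X]mxE (chart_coordE xi) (chart_coordE yi) -/p -/p' -/w -/w'.
    rewrite (conjB h) (ca_mulBl h) (ca_mulBr h) addrA subrK scalerBl scalerBr.
    by rewrite addrA subrK.
  have b1 : norm ((p - p') *: ((w j)^c ** w k)) <= L ^+ 6 * e.
    rewrite (dotZl h) (dotZr h) (ca_norm_mul h) (norm_conj h) mulrA -expr2.
    have -> : L ^+ 6 * e = (L * (L * (m + 4)) * delta) ^+ 2 * (L * L).
      by rewrite /e; ring.
    apply: ler_pM; [exact: sqr_ge0 | by rewrite mulr_ge0 | | by rewrite ler_pM].
    rewrite -real_normK ?num_real// lerXn2r ?nnegrE// ?mulr_ge0 ?(ltW d0) ?addr_ge0//.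
    apply: (le_trans dp); rewrite ler_wpM2r ?(ltW d0)// ler_wpM2l//.
    by rewrite mulrDr [4 * L]mulrC lerD2r ler_peMl.
  have b2 : norm ((w j - w' j)^c ** w k) <= m * delta ^+ 2 * L.
    by rewrite (ca_norm_mul h) (norm_conj h) ler_pM//; exact: close.
  have b3 : norm ((w' j)^c ** (w k - w' k)) <= m * delta ^+ 2 * L.
    by rewrite (ca_norm_mul h) (norm_conj h) mulrC ler_pM//; exact: close.
  have b4 : norm (p' *: ((w j - w' j)^c ** w k + (w' j)^c ** (w k - w' k))) <=
      4 * (m * delta ^+ 2 * L).
    rewrite (dotZl h) (dotZr h) mulrA -expr2 -[leRHS]mul1r.
    rewrite ler_pM ?sqr_ge0 ?expr_le1 ?(ltW p'0)//.
    by apply: (le_trans (normD_le _ _)); move: b2 b3; lra.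
  have b5 : 8 * (m * delta ^+ 2 * L) <= L ^+ 6 * e.
    have -> : 8 * (m * delta ^+ 2 * L) = L * (8 * (m * delta ^+ 2)) by ring.
    have md0 : 0 <= m * delta ^+ 2 by rewrite mulr_ge0.
    apply: ler_pM => //; [by rewrite mulr_ge0 | | by move: md0 me; lra].
    by rewrite -[leLHS]expr1 ler_weXn2l.
  apply: (le_trans (normD_le _ _)).
  have -> : 3 * L ^+ 6 * (m + 4) ^+ 2 * delta ^+ 2 = 3 * (L ^+ 6 * e).
    by rewrite /e; ring.
  by move: b1 b4 b5; lra.
rewrite chordalE /= sqr_sqrtr ?divr_ge0 ?(inner_mx_ge0 hs)// (inner_mxE hs).
rewrite ler_pdivrMr//.
apply: (@le_trans _ _ (\sum_(j < n.+1) \sum_(k < n.+1)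
    (3 * L ^+ 6 * (m + 4) ^+ 2 * delta ^+ 2))).
  by apply: ler_sum => j _; apply: ler_sum => k _; exact: entry.
rewrite !sumr_const !card_ord -[X in X <= _]mulr_natl -[X in _ * X <= _]mulr_natl.
by rewrite le_eqVlt; apply/orP; left; apply/eqP; field.
Qed.

(** The trace is 1, so each point has a diagonal entry at least 1/(n+1) and
    bounded coordinates in the corresponding chart. The cells are the cubes of
    a mesh proportional to r in the n+1 charts. *)
Lemma covering : exists2 C : R, 0 < C & forall r, 0 < r -> r <= 1 ->
  exists (I : finType) (cell : T -> I), #|I|%:R * r ^+ projdim F n <= C /\
    forall x y, cell x = cell y -> chordal x y < r.
Proof.
have [J [b [cardJ ob]]] := scalars_basis R F.
have L0 : 0 < L by rewrite ltr0n.
have L1 : 1 <= L by rewrite ler1n.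
pose dm : R := #|J|%:R.
have dm0 : 0 <= dm by rewrite ler0n.
pose G : R := 3 / 2 * L ^+ 8 * (dm + 4) ^+ 2.
have G0 : 0 <= G by apply: mulr_ge0 (sqr_ge0 _); apply: mulr_ge0 => //; exact: exprn_ge0.
set D := projdim F n.
exists (L * (2 * L * (G + 1) + 1) ^+ D).
  by rewrite mulr_gt0// exprn_gt0// addr_gt0// !mulr_gt0// ltr_wpDl.
move=> r r0 r1; pose delta := r / (G + 1).
have G1 : 0 < G + 1 by rewrite ltr_wpDl.
have d0 : 0 < delta by rewrite divr_gt0.
pose m' := Num.truncn (2 * L / delta).
have chart x : {i | L^-1 <= diag_re x i} := cid (large_diagonal x).
pose chart_of x := projT1 (chart x).
have chartP x : L^-1 <= diag_re x (chart_of x) := projT2 (chart x).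
pose X x (je : 'I_n * J) := (sa_dot (chart_coord x (chart_of x)
  (lift (chart_of x) je.1)) (b je.2) + L) / delta.
have Xbound x je : 0 <= X x je < m'.+1%:R.
  pose a := sa_dot (chart_coord x (chart_of x) (lift (chart_of x) je.1)) (b je.2).
  rewrite -[X x je]/((a + L) / delta).
  have a2 : a ^+ 2 <= L ^+ 2.
    apply: (@le_trans _ _ L); last by rewrite expr2 ler_peMl// ltW.
    apply: le_trans (chart_coord_le (chartP x) (lift (chart_of x) je.1)).
    rewrite (norm_parseval ob) (bigD1 je.2)//= lerDl.
    by rewrite sumr_ge0// => f _; exact: sqr_ge0.
  move: a2; rewrite -(ler_sqrt _ (exprn_ge0 2 (ltW L0))) !sqrtr_sqr (ger0_norm (ltW L0)).
  rewrite ler_norml => /andP[lo hi]; apply/andP; split.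
    by rewrite divr_ge0 ?(ltW d0)// -lerBlDr sub0r.
  apply: (@le_lt_trans _ _ (2 * L / delta)); last exact: truncnS_gt.
  by rewrite ler_pM2r ?invr_gt0//; lra.
pose cell x : 'I_n.+1 * {ffun 'I_n * J -> 'I_m'.+1} :=
  (chart_of x, [ffun je => inord (Num.truncn (X x je))]).
exists ('I_n.+1 * {ffun 'I_n * J -> 'I_m'.+1})%type, cell; split.
  rewrite card_prod card_ord (card_grid cardJ) -/D natrM natrX -mulrA -exprMn.
  rewrite ler_wpM2l// lerXn2r ?nnegrE//.
  - by rewrite mulr_ge0// ltW.
  - by rewrite addr_ge0// !mulr_ge0// ltW.
  rewrite -natr1 mulrDl mul1r lerD//.
  apply: (@le_trans _ _ (2 * L / delta * r)).
    rewrite ler_wpM2r ?(ltW r0)// truncn_le (divr_ge0 _ (ltW d0))// mulr_ge0.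
  rewrite le_eqVlt; apply/orP; left; apply/eqP; rewrite /delta; field.
  by rewrite !gt_eqF.
move=> x y [cxy fxy].
have close j : norm (chart_coord x (chart_of x) j - chart_coord y (chart_of x) j)
    <= dm * delta ^+ 2.
  have [->|] := eqVneq j (chart_of x).
    rewrite (chart_coord_diag (chartP x)) cxy (chart_coord_diag (chartP y)).
    by rewrite subrr (dot0l h) mulr_ge0// sqr_ge0.
  rewrite eq_sym => /unlift_some[k ->] _; rewrite (norm_parseval ob).
  apply: (@le_trans _ _ (\sum_(e : J) delta ^+ 2)); last first.
    by rewrite sumr_const -mulr_natl.
  apply: ler_sum => e _.
  have := congr1 (fun g : {ffun _ -> _} => g (k, e)) fxy; rewrite !ffunE.
  move=> /(congr1 val); rewrite /= !inordK => [tE| |].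
  - have /andP[x0 _] := Xbound x (k, e); have /andP[y0 _] := Xbound y (k, e).
    have /andP[xl xu] := truncn_itv x0; have /andP[yl yu] := truncn_itv y0.
    have : `|X x (k, e) - X y (k, e)| < 1.
      by rewrite ltr_distl; move: xl xu yl yu; rewrite tE -!natr1; lra.
    rewrite /X /= -cxy -mulrBl opprD addrACA subrr addr0 -(dotBl h).
    rewrite normrM (gtr0_norm (x := delta^-1)) ?invr_gt0// ltr_pdivrMr// mul1r => lt.
    rewrite -real_normK ?num_real//; apply: lerXn2r; by rewrite ?nnegrE ?normr_ge0 ?(ltW d0) ?(ltW lt).
  - have /andP[Xge Xlt] := Xbound y (k, e).
    by rewrite -(ltr_nat R) (le_lt_trans _ Xlt)// truncn_le.
  - have /andP[Xge Xlt] := Xbound x (k, e).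
    by rewrite -(ltr_nat R) (le_lt_trans _ Xlt)// truncn_le.
have := chart_lipschitz dm0 d0 (chartP x) _ close.
rewrite {1}cxy => /(_ (chartP y)) H.
have H2 : chordal x y ^+ 2 < r ^+ 2.
  apply: (le_lt_trans H); rewrite -/G /delta expr_div_n mulrA.
  rewrite ltr_pdivrMr ?exprn_gt0// mulrC ltr_pM2l ?exprn_gt0//.
  by rewrite expr2; have := mulr_ge0 G0 G0; lra.
by rewrite -(ltr_pXn2r (n := 2)) ?nnegrE ?sqrtr_ge0// ltW.
Qed.

End cells.

(** * The binomial series *)

Section binomial_series.
Context {R : realType} (a : R).
Hypothesis a0 : 0 < a.
Implicit Types (t u : R) (k n : nat).

(** The coefficients of (1 - t)^(-a). *)
Definition bin_coef k : R := \prod_(i < k) ((a + i%:R) / i.+1%:R).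

Definition bin_sum n t : R := \sum_(k < n) bin_coef k * t ^+ k.

Lemma bin_coef_ge0 k : 0 <= bin_coef k.
Proof. by apply: prodr_ge0 => i _; rewrite divr_ge0// addr_ge0// ltW. Qed.

Lemma bin_coefS k : k.+1%:R * bin_coef k.+1 = (a + k%:R) * bin_coef k.
Proof. by rewrite /bin_coef big_ord_recr /=; field. Qed.

Lemma bin_sumS n t : bin_sum n.+1 t = bin_sum n t + bin_coef n * t ^+ n.
Proof. by rewrite /bin_sum big_ord_recr. Qed.

Lemma bin_sum0 n : bin_sum n.+1 0 = 1.
Proof.
rewrite /bin_sum big_ord_recl /bin_coef big_ord0 mulr1 big1 ?addr0// => i _.
by rewrite expr0n mulr0.
Qed.

Lemma bin_sum_ge0 n t : 0 <= t -> 0 <= bin_sum n t.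
Proof.
by move=> t0; apply: sumr_ge0 => k _; rewrite mulr_ge0 ?bin_coef_ge0 ?exprn_ge0.
Qed.

Lemma le_bin_sum n t u : 0 <= t -> t <= u -> bin_sum n t <= bin_sum n u.
Proof.
move=> t0 tu; apply: ler_sum => k _; rewrite ler_wpM2l ?bin_coef_ge0//.
by rewrite lerXn2r ?nnegrE// (le_trans t0).
Qed.

Lemma bin_sum_nondecreasing t : 0 <= t ->
  {homo (bin_sum^~ t) : m n / (m <= n)%N >-> m <= n}.
Proof.
move=> t0; apply: homo_leq; [exact: lexx | exact: le_trans|] => n.
by rewrite bin_sumS lerDl mulr_ge0 ?bin_coef_ge0 ?exprn_ge0.
Qed.

Definition bin_deriv n t : R := \sum_(k < n) bin_coef k * (k%:R * t ^+ k.-1).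

Lemma is_derive_bin_sum n t : is_derive t 1 (bin_sum n) (bin_deriv n t).
Proof.
elim: n => [|n IHn].
  have -> : bin_sum 0 = cst 0 by apply/funext => x; rewrite /bin_sum big_ord0.
  by rewrite /bin_deriv big_ord0; exact: is_derive_cst.
have -> : bin_sum n.+1 = bin_sum n + (bin_coef n *: (id ^+ n)).
  apply/funext => x; rewrite bin_sumS; congr (_ + _).
  by rewrite [RHS]/GRing.scale /= fctE.
rewrite /bin_deriv big_ord_recr /=; apply: is_deriveD.
apply: is_derive_eq; rewrite /GRing.scale /=.
by rewrite mulr1.
Qed.

(** The truncated series almost solves (1 - t) S' = a S: only the last
    coefficient is left over. *)
Lemma bin_ode n t :
  (1 - t) * bin_deriv n.+1 t - a * bin_sum n.+1 t =
  - (n.+1%:R * bin_coef n.+1 * t ^+ n).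
Proof.
elim: n => [|n IHn].
  rewrite /bin_deriv /bin_sum !big_ord_recr !big_ord0 /= bin_coefS.
  by rewrite !expr0; ring.
rewrite bin_sumS /bin_deriv big_ord_recr /= -/(bin_deriv n.+1 t).
rewrite !mulrDr opprD addrACA IHn (bin_coefS n.+1) !exprS.
by ring.
Qed.

(** By the differential equation the derivative of S(t) (1 - t)^a consists of
    the leftover term alone; the mean value theorem on [0, t] concludes. *)
Lemma bin_sum_defect n t : 0 <= t -> t < 1 ->
  0 <= 1 - bin_sum n.+1 t * (1 - t) `^ a <=
  n.+1%:R * bin_coef n.+1 * t ^+ n / (1 - t).
Proof.
move=> t0 t1.
pose g (x : R) : R := bin_sum n.+1 x * (1 - x) `^ a.
pose dg (x : R) : R := - (n.+1%:R * bin_coef n.+1 * x ^+ n) * (1 - x) `^ (a - 1).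
have dgE (x : R) : x < 1 -> is_derive x (1 : R) g (dg x).
  move=> x1; have x10 : 0 < 1 - x by rewrite subr_gt0.
  have d1 : is_derive x (1 : R) (fun y : R => 1 - y) (-1).
    have := @is_deriveB R R R (cst 1) id x 1 0 1 _ _; rewrite sub0r; apply.
  have d2 := @is_derive1_comp R (@powR R ^~ a) (fun y : R => 1 - y) x _ _
    (is_derive1_powR a x10) d1.
  have d3 := is_deriveM (is_derive_bin_sum n.+1 x) d2.
  apply: is_derive_eq d3 _.
  rewrite /GRing.scale /= -(mulr_powRB1 (ltW x10) a0) /dg -bin_ode.
  by ring.
have [| |c] := @MVT_segment R g dg 0 t t0.
- by move=> x; rewrite in_itv /= => /andP[_ xt]; apply: dgE; exact: lt_trans t1.
- apply: derivable_within_continuous => x; rewrite in_itv /= => /andP[_ xt].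
  by case: (dgE x (le_lt_trans xt t1)).
rewrite in_itv /= => /andP[c0 ct]; rewrite /g bin_sum0 subr0 subr0 powR1 mul1r => gE.
have c1 : 0 < 1 - c by rewrite subr_gt0 (le_lt_trans ct).
have -> : 1 - bin_sum n.+1 t * (1 - t) `^ a =
    n.+1%:R * bin_coef n.+1 * (c ^+ n * t * (1 - c) `^ (a - 1)).
  by move: gE; rewrite /dg; lra.
have M0 : 0 <= n.+1%:R * bin_coef n.+1 by rewrite mulr_ge0 ?bin_coef_ge0.
apply/andP; split; first by rewrite !mulr_ge0 ?exprn_ge0 ?powR_ge0 ?bin_coef_ge0.
rewrite -[leRHS]mulrA ler_wpM2l//.
have e : (1 - c) `^ (a - 1) <= (1 - t)^-1.
  have : (1 - c) `^ a <= 1.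
    have one_pow : 1 `^ a = 1 :> R by rewrite powR1.
    rewrite -[leRHS]one_pow; apply: ge0_ler_powR; rewrite ?nnegrE ?(ltW a0) ?(ltW c1)//.
    by rewrite gerBl.
  rewrite -(mulr_powRB1 (ltW c1) a0) => le1.
  rewrite -[leLHS]mul1r -{1}(mulVf (lt0r_neq0 c1)) -mulrA.
  apply: (@le_trans _ _ ((1 - c)^-1 * 1)); first by rewrite ler_wpM2l// invr_ge0 ltW.
  by rewrite mulr1 lef_pV2 ?posrE ?subr_gt0//; lra.
rewrite ler_pM ?mulr_ge0 ?exprn_ge0 ?powR_ge0//.
rewrite -[leRHS]mulr1 ler_pM ?exprn_ge0// ?(ltW t1)//.
by rewrite lerXn2r ?nnegrE.
Qed.

Lemma bin_sum_le n t : 0 <= t -> t < 1 -> bin_sum n t <= (1 - t) `^ (- a).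
Proof.
move=> t0 t1; apply: (@le_trans _ _ (bin_sum n.+1 t)).
  exact: bin_sum_nondecreasing.
have /andP[H _] := bin_sum_defect n t0 t1.
by rewrite powRN -[leRHS]mul1r ler_pdivlMr ?powR_gt0 ?subr_gt0// -subr_ge0.
Qed.

Lemma bin_sum_cvg t : 0 <= t -> t < 1 ->
  bin_sum n t @[n --> \oo] --> (1 - t) `^ (- a).
Proof.
move=> t0 t1.
(* t <= u^3 splits the defect into n u^n and c_n u^n, which are bounded, and a
   third factor u^n, which tends to 0 *)
pose u := 1 - (1 - t) / 3.
have [u0 u1] : 0 < u /\ u < 1 by rewrite /u; split; lra.
have tu3 : t <= u ^+ 3.
  have -> : u = 1 - (1 - t) / 3 by [].
  set y := (1 - t) / 3; have -> : t = 1 - 3 * y by rewrite /y; field.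
  have y0 : 0 <= y by rewrite /y; lra.
  have y1 : y <= 1 by rewrite /y; lra.
  have := mulr_ge0 (sqr_ge0 y) (_ : 0 <= 3 - y); rewrite !exprS expr0; lra.
have nu n : n%:R * u ^+ n <= (1 - u)^-1.
  rewrite -[leRHS]mul1r ler_pdivlMr ?subr_gt0//.
  have : (1 - u) * \sum_(i < n) u ^+ i = 1 - u ^+ n.
    by have := subrX1 u n; lra.
  have : n%:R * u ^+ n <= \sum_(i < n) u ^+ i.
    rewrite mulr_natl -[n in _ *+ n]card_ord -sumr_const; apply: ler_sum => i _.
    by rewrite ler_wiXn2l ?(ltW u0) ?(ltW u1)// ltnW.
  have : 0 <= u ^+ n by rewrite exprn_ge0// ltW.
  have v0 : 0 < 1 - u by rewrite subr_gt0.
  by move=> p1 p2 p3; have := ler_wpM2r (ltW v0) p2; lra.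
have cu n : bin_coef n * u ^+ n <= (1 - u) `^ (- a).
  apply: le_trans (bin_sum_le n.+1 (ltW u0) u1).
  by rewrite bin_sumS lerDr bin_sum_ge0// ltW.
pose K := (1 - u)^-1 * (1 - u) `^ (- a) / t / (1 - t).
have t1' : 0 < 1 - t by rewrite subr_gt0.
have [->|tn0] := eqVneq t 0.
  rewrite subr0 powR1; apply: cvg_near_cst; exists 1 => // -[//|n] _.
  by rewrite bin_sum0.
have tpos : 0 < t by rewrite lt_neqAle eq_sym tn0.
have p0 : 0 < (1 - t) `^ a by rewrite powR_gt0.
have defect n : (1 - t) `^ (- a) - K * (1 - t) `^ (- a) * u ^+ n.+1 <=
    bin_sum n.+1 t.
  have /andP[_ H] := bin_sum_defect n t0 t1.
  have tn : n.+1%:R * bin_coef n.+1 * t ^+ n.+1 <=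
      (1 - u)^-1 * (1 - u) `^ (- a) * u ^+ n.+1.
    apply: (@le_trans _ _ ((n.+1%:R * u ^+ n.+1) *
        (bin_coef n.+1 * u ^+ n.+1) * u ^+ n.+1)).
      have -> : n.+1%:R * u ^+ n.+1 * (bin_coef n.+1 * u ^+ n.+1) * u ^+ n.+1 =
          n.+1%:R * bin_coef n.+1 * (u ^+ 3) ^+ n.+1.
        by rewrite -exprM mulnC exprM; ring.
      by rewrite ler_wpM2l ?mulr_ge0 ?bin_coef_ge0// lerXn2r ?nnegrE ?exprn_ge0// ltW.
    rewrite ler_wpM2r ?exprn_ge0 ?(ltW u0)//.
    by rewrite ler_pM ?mulr_ge0 ?bin_coef_ge0 ?exprn_ge0 ?(ltW u0).
  have H' : 1 - bin_sum n.+1 t * (1 - t) `^ a <= K * u ^+ n.+1.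
    apply: (le_trans H).
    have -> : n.+1%:R * bin_coef n.+1 * t ^+ n / (1 - t) =
        n.+1%:R * bin_coef n.+1 * t ^+ n.+1 / t / (1 - t).
      by rewrite exprS; field; rewrite !gt_eqF.
    have -> : K * u ^+ n.+1 =
        (1 - u)^-1 * (1 - u) `^ (- a) * u ^+ n.+1 / t / (1 - t).
      by rewrite /K; field; rewrite !gt_eqF// subr_gt0.
    by rewrite !ler_wpM2r ?invr_ge0 ?(ltW tpos) ?(ltW t1').
  rewrite powRN -(ler_pM2r p0) mulrBl mulVf ?gt_eqF// mulrAC mulfVK ?gt_eqF//.
  by move: H'; lra.
rewrite -cvg_shiftS.
apply: (@squeeze_cvgr _ _ _ _
  (fun n => (1 - t) `^ (- a) - K * (1 - t) `^ (- a) * u ^+ n.+1)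
  (fun=> (1 - t) `^ (- a))).
- by near=> n; rewrite defect /= bin_sum_le.
- rewrite -[X in _ --> X]subr0; apply: cvgB; first exact: cvg_cst.
  rewrite -[X in _ --> X](mulr0 (K * (1 - t) `^ (- a))); apply: cvgM; first exact: cvg_cst.
  have := @cvg_expr R u; rewrite ger0_norm ?(ltW u0)// => /(_ u1).
  by rewrite -cvg_shiftS.
- exact: cvg_cst.
Unshelve. all: by end_near. Qed.

(** Evaluating at 1 - 1/(2n), where the n-th power is still at least 1/2. *)
Lemma bin_sum1_le n : (0 < n)%N -> bin_sum n 1 <= 2 * (2 * n%:R) `^ a.
Proof.
move=> n0; have nR : (1 : R) <= n%:R by rewrite ler1n.
pose y : R := (2 * n%:R)^-1.
have y0 : 0 < y by rewrite invr_gt0; lra.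
have y1 : y <= 1 / 2 by rewrite /y -[1 / 2]/(1 * _) mul1r lef_pV2 ?posrE; lra.
have ny : n%:R * y = 1 / 2 by rewrite /y; field; rewrite pnatr_eq0 -lt0n.
have bern m : 1 - m%:R * y <= (1 - y) ^+ m.
  elim: m => [|m IHm]; first by rewrite mul0r subr0 expr0.
  rewrite exprSr -natr1; have m0 : 0 <= m%:R * y by rewrite mulr_ge0// ltW.
  have y2 : 0 <= 1 - y by lra.
  have := ler_wpM2r y2 IHm; have := mulr_ge0 m0 (ltW y0); lra.
have yn : 1 / 2 <= (1 - y) ^+ n by apply: le_trans (bern n); lra.
have := @bin_sum_le n (1 - y); have -> : 1 - (1 - y) = y by ring.
have -> : y `^ (- a) = (2 * n%:R) `^ a.
  rewrite -[y]/((2 * n%:R)^-1) -powR_inv1; last by lra.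
  by rewrite -powRrM mulrNN mul1r.
move=> /(_ _ _)/le_trans H.
have H1 : bin_sum n 1 <= 2 * bin_sum n (1 - y).
  rewrite /bin_sum mulr_sumr; apply: ler_sum => k _; rewrite expr1n mulr1.
  have kn : (1 - y) ^+ n <= (1 - y) ^+ k.
    by rewrite ler_wiXn2l ?(ltnW (ltn_ord k))//; lra.
  have := ler_wpM2l (bin_coef_ge0 k) (le_trans yn kn); lra.
apply: (le_trans H1); rewrite ler_wpM2l//; apply: H => //; lra.
Qed.

End binomial_series.

(** * Moments of a homogeneous Gram kernel *)

Section bounded_integrals.
Context {d : measure_display} {T : measurableType d} {R : realType}.
Variable sigma : probability T R.

Lemma bounded_measurable_integrable (f : T -> R) (M : R) :
  measurable_fun setT f -> (forall x, `|f x| <= M) ->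
  sigma.-integrable setT (EFin \o f).
Proof.
move=> mf fM; apply: measurable_bounded_integrable => //.
  by rewrite (le_lt_trans (probability_le1 sigma _)) ?ltry.
exists M; split; first by rewrite num_real.
by move=> r Mr x _; exact: le_trans (fM x) (ltW Mr).
Qed.

Lemma Rintegral_sumZ (I : finType) (c : I -> R) (f : I -> T -> R) (M : I -> R) :
  (forall i, measurable_fun setT (f i)) -> (forall i x, `|f i x| <= M i) ->
  \int[sigma]_x (\sum_i c i * f i x) = \sum_i c i * \int[sigma]_x f i x.
Proof.
move=> mf fM.
have int i : sigma.-integrable setT (EFin \o f i).
  exact: bounded_measurable_integrable (mf i) (fM i).
elim: (index_enum I) => [|i s IHs].
  under eq_Rintegral do rewrite big_nil.
  by rewrite big_nil Rintegral_cst// mul0r.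
under eq_Rintegral do rewrite big_cons.
rewrite big_cons RintegralD//; first by rewrite RintegralZl// IHs.
- apply: (@bounded_measurable_integrable _ (`|c i| * M i)).
    by apply: measurable_funM => //; exact: mf.
  by move=> x; rewrite normrM ler_wpM2l.
- apply: (@bounded_measurable_integrable _ (\sum_(i <- s) `|c i| * M i)).
    by apply: measurable_sum => j; apply: measurable_funM => //; exact: mf.
  move=> x; apply: (le_trans (ler_norm_sum _ _ _)); apply: ler_sum => j _.
  by rewrite normrM ler_wpM2l.
Qed.

End bounded_integrals.

Section gram.
Context {d : measure_display} {T : measurableType d} {R : realType}.
Variables (sigma : probability T R) (J : finType) (X : J -> T -> R).
Hypothesis mX : forall j, measurable_fun setT (X j).

Definition gram x y : R := \sum_j X j x * X j y.
Local Notation t := gram.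

Hypothesis t01 : forall x y, 0 <= t x y <= 1.

Lemma gram_ge0 x y : 0 <= t x y. Proof. by have /andP[] := t01 x y. Qed.
Lemma gram_le1 x y : t x y <= 1. Proof. by have /andP[] := t01 x y. Qed.

Lemma measurable_gram : measurable_fun setT (fun z : T * T => t z.1 z.2).
Proof.
apply: measurable_sum => j; apply: measurable_funM.
  by apply: measurableT_comp (mX j) _; exact: measurable_fst.
by apply: measurableT_comp (mX j) _; exact: measurable_snd.
Qed.

Lemma measurable_gram1 x : measurable_fun setT (t x).
Proof. by apply: measurable_sum => j; apply: measurable_funM. Qed.

Hypothesis homogeneous : forall (f : R -> \bar R), measurable_fun setT f ->
  (forall r, (0 <= f r)%E) -> forall x x',
  (\int[sigma]_y f (t x y) = \int[sigma]_y f (t x' y))%E.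

Variable o : T.

Definition moment k : R := \int[sigma]_y (t o y ^+ k).

Lemma momentE k x : (\int[sigma]_y (t x y ^+ k)%:E)%E = (moment k)%:E.
Proof.
have tk z : (fun y => (t z y ^+ k)%:E) = (fun y => (`|t z y| ^+ k)%:E).
  by apply/funext => y; rewrite ger0_norm// gram_ge0.
have -> : (\int[sigma]_y (t x y ^+ k)%:E = \int[sigma]_y (t o y ^+ k)%:E)%E.
  rewrite !tk; apply: (homogeneous (f := fun r => (`|r| ^+ k)%:E)) => [|r].
    apply/measurable_EFinP; apply: measurable_funX; exact: normr_measurable.
  by rewrite lee_fin exprn_ge0.
rewrite /moment /Rintegral fineK//; apply: integrable_fin_num => //.
apply: (@bounded_measurable_integrable _ _ _ _ (fun y => t o y ^+ k) 1).
  by apply: measurable_funX; exact: measurable_gram1.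
by move=> y; rewrite ger0_norm ?exprn_ge0 ?gram_ge0// exprn_ile1 ?gram_ge0 ?gram_le1.
Qed.

Definition feature k (f : {ffun 'I_k -> J}) x : R := \prod_l X (f l) x.

Lemma gramX k x y : t x y ^+ k = \sum_f feature (k := k) f x * feature f y.
Proof.
rewrite -[X in _ ^+ X]card_ord -prodr_const bigA_distr_bigA /=.
by apply: eq_bigr => f _; rewrite /feature big_split.
Qed.

Lemma feature_le1 k (f : {ffun 'I_k -> J}) x : `|feature f x| <= 1.
Proof.
rewrite normr_prod; apply: prodr_ile1 => l _; rewrite normr_ge0 /=.
rewrite -(@ler_pXn2r _ 2)// ?nnegrE// real_normK ?num_real// expr1n.
apply: le_trans _ (gram_le1 x x); rewrite /gram (bigD1 (f l))//= -expr2 lerDl.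
by apply: sumr_ge0 => j _; rewrite -expr2 sqr_ge0.
Qed.

Lemma measurable_feature k (f : {ffun 'I_k -> J}) : measurable_fun setT (feature f).
Proof. exact: measurable_prod. Qed.

Lemma Rmoment k x : \int[sigma]_y (t x y ^+ k) = moment k.
Proof. by rewrite /Rintegral momentE. Qed.

(** The powers of a Gram kernel are Gram kernels; by homogeneity the mean
    feature vector V satisfies <feature x, V> = moment for each x, and the
    inequality says that |sum_i feature(w_i) - N V|^2 is nonnegative. *)
Lemma energy_moment k N (w : 'I_N -> T) :
  N%:R ^+ 2 * moment k <= \sum_i \sum_j t (w i) (w j) ^+ k.
Proof.
pose V (f : {ffun 'I_k -> J}) := \int[sigma]_y feature f y.
pose S (f : {ffun 'I_k -> J}) := \sum_i feature f (w i).
have fV x : \sum_f feature f x * V f = moment k.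
  rewrite -(Rmoment k x); under eq_Rintegral do rewrite gramX.
  by rewrite (@Rintegral_sumZ _ _ _ _ _ _ _ (fun=> 1))//; first exact: measurable_feature;
    move=> f y; exact: feature_le1.
have SS : \sum_f S f ^+ 2 = \sum_i \sum_j t (w i) (w j) ^+ k.
  under [RHS]eq_bigr => i _ do under eq_bigr => j _ do rewrite gramX.
  under [RHS]eq_bigr => i _ do rewrite exchange_big.
  rewrite [RHS]exchange_big /=; apply: eq_bigr => f _.
  by rewrite expr2 /S big_distrlr.
have SV : \sum_f S f * V f = N%:R * moment k.
  under eq_bigr => f _ do rewrite /S mulr_suml.
  rewrite exchange_big /=; under eq_bigr => i _ do rewrite fV.
  by rewrite sumr_const card_ord -(mulr_natl (moment k)).
have VV : \sum_f V f ^+ 2 = moment k.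
  transitivity (\int[sigma]_x (\sum_f V f * feature f x)).
    rewrite (@Rintegral_sumZ _ _ _ _ _ _ _ (fun=> 1)).
    - by apply: eq_bigr => f _; rewrite expr2.
    - exact: measurable_feature.
    - by move=> f y; exact: feature_le1.
  under eq_Rintegral => x _ do (under eq_bigr => f _ do rewrite mulrC; rewrite fV).
  by rewrite Rintegral_cst// [fine _](congr1 fine (probability_setT sigma)) mulr1.
have : 0 <= \sum_f (S f - N%:R * V f) ^+ 2 by apply: sumr_ge0 => f _; exact: sqr_ge0.
have -> : \sum_f (S f - N%:R * V f) ^+ 2 =
    \sum_f S f ^+ 2 - N%:R *+ 2 * (\sum_f S f * V f) + N%:R ^+ 2 * (\sum_f V f ^+ 2).
  rewrite !mulr_sumr -sumrB -big_split; apply: eq_bigr => f _ /=; ring.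
by rewrite SS SV VV; lra.
Qed.

(** In projective space 1 - t is the squared chordal distance. *)
Definition gram_ball x (r : R) : set T := [set y | 1 - t x y < r ^+ 2].

Lemma measurable_gram_ball x r : measurable (gram_ball x r).
Proof.
rewrite (_ : gram_ball x r = setT `&` t x @^-1` `]1 - r ^+ 2, +oo[%classic).
  by apply: measurable_gram1 => //; exact: measurable_itv.
rewrite setTI; apply/seteqP; split=> y /=; rewrite in_itv /= andbT /gram_ball /=.
  by rewrite ltrBlDr ltrBlDl.
by rewrite ltrBlDr ltrBlDl.
Qed.

Lemma sum_inv_sq_le m : \sum_(l < m.+1) (l.+1%:R ^+ 2)^-1 <= 2 - m.+1%:R^-1 :> R.
Proof.
elim: m => [|m IHm]; first by rewrite big_ord_recr big_ord0 /= expr1n invr1; lra.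
rewrite big_ord_recr /=; apply: (le_trans (lerD IHm (lexx _))).
set n := m.+1%:R : R; have n0 : 0 < n by rewrite ltr0n.
have -> : m.+2%:R = n + 1 :> R by rewrite natr1.
have -> : 2 - (n + 1)^-1 = 2 - n^-1 + (n * (n + 1))^-1.
  by field; rewrite !gt_eqF// addr_gt0.
rewrite lerD2l lef_pV2 ?posrE ?exprn_gt0 ?mulr_gt0 ?addr_gt0//.
by rewrite expr2 ler_wpM2r ?ler_wpDr// addr_ge0// ltW.
Qed.

(** tau^k <= exp(-x) <= (q / x)^q with x = k (1 - tau), from 1 + y <= exp y;
    rounding x up keeps the denominator away from 0. *)
Lemma pow_decay q k (tau : R) : (0 < q)%N -> 0 <= tau -> tau <= 1 ->
  tau ^+ k <= q%:R ^+ q / (Num.truncn (k%:R * (1 - tau))).+1%:R ^+ q.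
Proof.
move=> q0 tau0 tau1; set x := k%:R * (1 - tau).
have qR : (1 : R) <= q%:R by rewrite ler1n.
have qR0 : (0 : R) < q%:R by rewrite ltr0n.
have x0 : 0 <= x by rewrite mulr_ge0// subr_ge0.
have /andP[lx _] := truncn_itv x0.
have e1 : tau ^+ k <= expR (- x).
  rewrite /x -mulrN expRM_natl.
  rewrite lerXn2r ?nnegrE ?expR_ge0//; have := expR_ge1Dx (- (1 - tau)); lra.
have e2 : ((Num.truncn x).+1%:R / q%:R) ^+ q <= expR x.
  apply: (@le_trans _ _ (expR (x / q%:R) ^+ q)); last first.
    by rewrite -expRM_natr divfK ?gt_eqF.
  rewrite lerXn2r ?nnegrE ?expR_ge0 ?divr_ge0//.
  apply: le_trans (expR_ge1Dx _); rewrite -natr1 ler_pdivrMr// mulrDl divfK ?gt_eqF//.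
  by lra.
have e3 : tau ^+ k * ((Num.truncn x).+1%:R / q%:R) ^+ q <= 1.
  rewrite -[leRHS](expRxMexpNx_1 x) [leLHS]mulrC.
  by apply: ler_pM => //; rewrite exprn_ge0 ?divr_ge0.
rewrite ler_pdivlMr ?exprn_gt0// -[leRHS]mul1r -ler_pdivrMr ?exprn_gt0//.
by rewrite -mulrA -expr_div_n.
Qed.

(** On the layer l <= k (1 - t) < l + 1 the power t^k is at most of order
    (l+1)^(-D-2), and the layer is contained in a ball of radius sqrt((l+1)/k); the
    sum over l of (l+1)^(-D-2) ((l+1)/k)^(D/2) is of order k^(-D/2). *)
Lemma moment_le D (C : R) : (0 < D)%N -> 0 < C ->
  (forall r, 0 < r -> (sigma (gram_ball o r) <= (C * r ^+ D)%:E)%E) ->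
  exists2 C' : R, 0 < C' & forall k, (0 < k)%N ->
    moment k <= C' / Num.sqrt k%:R ^+ D.
Proof.
move=> D0 C0 ballC; pose q := D.+2; pose Q : R := q%:R ^+ q.
have Q0 : 0 < Q by rewrite exprn_gt0.
exists (2 * C * Q); first by apply: mulr_gt0 Q0; exact: mulr_gt0.
move=> k k0; have kR : (0 : R) < k%:R by rewrite ltr0n.
pose r l : R := Num.sqrt (l.+1%:R / k%:R).
have r0 l : 0 < r l by rewrite sqrtr_gt0 divr_gt0 ?ltr0n.
pose c l : R := Q / l.+1%:R ^+ q.
have c0 l : 0 <= c l by rewrite divr_ge0 ?(ltW Q0) ?exprn_ge0.
rewrite -lee_fin -(momentE k o).
apply: (@le_trans _ _ (\int[sigma]_y \sum_(l < k.+1)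
    ((c l)%:E * (\1_(gram_ball o (r l)) y)%:E))%E).
  apply: ge0_le_integral => //.
  - by move=> y _; rewrite lee_fin exprn_ge0 ?gram_ge0.
  - by apply/measurable_EFinP; apply: measurable_funX; exact: measurable_gram1.
  - apply: emeasurable_sum => l; apply: measurable_funeM.
    by apply/measurable_EFinP; apply: measurable_indic; exact: measurable_gram_ball.
  move=> y _; set tau := t o y; set l := Num.truncn (k%:R * (1 - tau)).
  have [tau0 tau1] : 0 <= tau /\ tau <= 1 by rewrite gram_ge0 gram_le1.
  have x0 : 0 <= k%:R * (1 - tau) by rewrite mulr_ge0// subr_ge0.
  have /andP[_ lx] := truncn_itv x0.
  have lk : (l < k.+1)%N.
    rewrite ltnS -(ler_nat R); apply: (@le_trans _ _ (k%:R * (1 - tau))).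
      by rewrite truncn_le.
    by rewrite ler_piMr// gerBl.
  rewrite (bigD1 (Ordinal lk))//=.
  apply: (@le_trans _ _ ((c l)%:E * (\1_(gram_ball o (r l)) y)%:E)%E); last first.
    rewrite leeDl//; apply: sume_ge0 => j _; rewrite mule_ge0 ?lee_fin ?c0//.
  rewrite indicE mem_set; last first.
    rewrite /gram_ball /= -/tau sqr_sqrtr ?divr_ge0// ltr_pdivlMr// mulrC.
    exact: lx.
  by rewrite mule1 lee_fin; exact: pow_decay.
rewrite ge0_integral_sum//; last 2 first.
  - move=> l; apply: measurable_funeM.
    by apply/measurable_EFinP; apply: measurable_indic; exact: measurable_gram_ball.
  - by move=> l y _; rewrite mule_ge0 ?lee_fin ?c0.
apply: (@le_trans _ _ (\sum_(l < k.+1) (c l * (C * r l ^+ D))%:E)%E).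
  apply: lee_sum => l _; rewrite ge0_integralZl//; last 2 first.
  - by apply/measurable_EFinP; apply: measurable_indic; exact: measurable_gram_ball.
  - by rewrite lee_fin.
  rewrite integral_indic// ?setIT ?EFinM ?lee_wpmul2l ?lee_fin ?c0//; last first.
    exact: measurable_gram_ball.
  exact: ballC.
rewrite sumEFin lee_fin.
have sk : 0 < Num.sqrt k%:R :> R by rewrite sqrtr_gt0.
apply: (@le_trans _ _ (\sum_(l < k.+1)
    (C * Q / Num.sqrt k%:R ^+ D) * (l.+1%:R ^+ 2)^-1)).
  apply: ler_sum => l _.
  have l0 : (0 : R) < l.+1%:R by rewrite ltr0n.
  have -> : r l ^+ D = Num.sqrt l.+1%:R ^+ D / Num.sqrt k%:R ^+ D.
    by rewrite /r sqrtrM// sqrtrV// expr_div_n.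
  have -> : C * Q / Num.sqrt k%:R ^+ D / l.+1%:R ^+ 2 =
      c l * (C * (l.+1%:R ^+ D / Num.sqrt k%:R ^+ D)).
    rewrite /c /q !exprS; field.
    by rewrite expf_neq0 ?gt_eqF// expf_neq0// gt_eqF.
  rewrite ler_wpM2l// ler_wpM2l ?(ltW C0)// ler_wpM2r ?invr_ge0 ?exprn_ge0 ?(ltW sk)//.
  rewrite lerXn2r ?nnegrE ?sqrtr_ge0//.
  by rewrite -[leRHS]ger0_norm// -sqrtr_sqr ler_wsqrtr// expr2 ler_peMl// ler1n.
rewrite -mulr_sumr.
have := sum_inv_sq_le k; have : (0 : R) <= k.+1%:R^-1 by rewrite invr_ge0.
move=> H1 H2; have H3 : \sum_(l < k.+1) (l.+1%:R ^+ 2)^-1 <= 2 :> R.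
  by apply: (le_trans H2); rewrite gerBl.
have -> : 2 * C * Q / Num.sqrt k%:R ^+ D = C * Q / Num.sqrt k%:R ^+ D * 2 by ring.
by rewrite ler_wpM2l// divr_ge0 ?(exprn_ge0 _ (ltW sk)) ?(mulr_ge0 (ltW C0) (ltW Q0)).
Qed.

End gram.

(** * The lower bound *)

(** The Riesz kernel of exponent s = 2a, as a function of t = 1 - rho^2. *)
Definition riesz_profile {R : realType} (a tau : R) : \bar R :=
  if tau == 1 then +oo%E else ((1 - tau) `^ (- a))%:E.

Section profile.
Context {R : realType} (a : R).
Hypothesis a0 : 0 < a.

Lemma riesz_profile_ge0 (tau : R) : (0 <= riesz_profile a tau)%E.
Proof. by rewrite /riesz_profile; case: ifP => // _; rewrite lee_fin powR_ge0. Qed.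

Lemma measurable_riesz_profile : measurable_fun setT (riesz_profile a).
Proof.
apply: measurable_fun_ifT.
- exact: measurable_fun_eqr.
- exact: measurable_cst.
- apply/measurable_EFinP; apply: measurableT_comp (measurable_powR _) _.
  exact: measurable_funB.
Qed.

Lemma bin_sum_le_profile n (tau : R) : 0 <= tau -> tau <= 1 ->
  ((bin_sum a n tau)%:E <= riesz_profile a tau)%E.
Proof.
move=> tau0 tau1; rewrite /riesz_profile; case: eqVneq => [_|ne1].
  by rewrite leey.
by rewrite lee_fin bin_sum_le// lt_neqAle ne1.
Qed.

Lemma bin_sum_cvg_profile (tau : R) : 0 <= tau -> tau <= 1 ->
  (bin_sum a n tau)%:E @[n --> \oo] --> riesz_profile a tau.
Proof.
move=> tau0 tau1; rewrite /riesz_profile; case: eqVneq => [->|ne1]; last first.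
  apply: cvg_EFin; first by near=> n.
  by apply: bin_sum_cvg => //; rewrite lt_neqAle ne1.
(* the partial sums at 1 dominate those at 1 - y, whose limit exceeds A *)
apply/cvgeyPge => A; set B := Num.max A 1 + 1.
have B1 : 1 < B by rewrite /B ltr_pwDr// le_max lexx orbT.
have B0 : 0 < B by rewrite (lt_trans _ B1).
pose y := B `^ (- a^-1).
have y0 : 0 < y by rewrite powR_gt0.
have y1 : y < 1.
  rewrite /y powRN invf_lt1 ?powR_gt0//.
  have one_pow : 1 `^ a^-1 = 1 :> R by rewrite powR1.
  by rewrite -[ltLHS]one_pow gt0_ltr_powR ?nnegrE ?invr_gt0// ltW.
have := @bin_sum_cvg R a a0 (1 - y); have -> : 1 - (1 - y) = y by ring.
have -> : y `^ (- a) = B.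
  by rewrite /y -powRrM mulrNN mulVf ?gt_eqF// powRr1// ltW.
move=> /(_ _ _)/cvgr_gt H.
have AB : A < B by rewrite /B (le_lt_trans (_ : A <= Num.max A 1)) ?le_max ?lexx// ltrDl.
have y1' : 0 <= 1 - y by rewrite subr_ge0 ltW.
have y2' : 1 - y < 1 by rewrite gtrBl.
near=> n; rewrite lee_fin; apply: (@le_trans _ _ (bin_sum a n (1 - y))).
  by apply/ltW; near: n; exact: (H y1' y2' _ AB).
by apply: le_bin_sum => //; exact: ltW.
Unshelve. all: by end_near. Qed.

End profile.

Lemma sqrtr_expn_powR (R : realType) (x : R) n : 0 <= x -> Num.sqrt x ^+ n = x `^ (n%:R / 2).
Proof. by move=> x0; rewrite -powR12_sqrt// -powR_mulrn ?powR_ge0// -powRrM mulrC. Qed.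

Section lower_bound.
Context {d : measure_display} {T : measurableType d} {R : realType}.
Variables (sigma : probability T R) (J : finType) (X : J -> T -> R).
Hypothesis mX : forall j, measurable_fun setT (X j).
Local Notation t := (gram X).
Hypothesis t01 : forall x y, 0 <= t x y <= 1.
Hypothesis homogeneous : forall (f : R -> \bar R), measurable_fun setT f ->
  (forall r, (0 <= f r)%E) -> forall x x',
  (\int[sigma]_y f (t x y) = \int[sigma]_y f (t x' y))%E.
Variables (o : T) (D : nat) (a : R).
Hypotheses (a0 : 0 < a) (aD : a < D%:R / 2).
Variable C : R.
Hypothesis C0 : 0 < C.
Hypothesis ballC : forall r, 0 < r -> (sigma (gram_ball X o r) <= (C * r ^+ D)%:E)%E.

Let m := moment sigma X o.
Let beta := D%:R / 2 - a.

Let beta0 : 0 < beta. Proof. by rewrite subr_gt0. Qed.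
Let D0 : (0 < D)%N. Proof. by case: D aD => //; rewrite mul0r => /(lt_trans a0); rewrite ltxx. Qed.

(** The energy integral of the kernel with profile bin_sum a n. *)
Definition truncated_energy n : R := \sum_(k < n) bin_coef a k * m k.

Lemma moment_ge0 k : 0 <= m k.
Proof.
rewrite -lee_fin -(momentE mX t01 homogeneous o k o).
by apply: integral_ge0 => y _; rewrite lee_fin exprn_ge0// gram_ge0.
Qed.

Lemma truncated_energyS n :
  truncated_energy n.+1 = truncated_energy n + bin_coef a n * m n.
Proof. by rewrite /truncated_energy big_ord_recr. Qed.

Lemma truncated_energy_nondecreasing :
  {homo truncated_energy : i j / (i <= j)%N >-> i <= j}.
Proof.
apply: homo_leq; [exact: lexx | exact: le_trans|] => n.
by rewrite truncated_energyS lerDl mulr_ge0 ?bin_coef_ge0 ?moment_ge0.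
Qed.

Lemma measurable_bin_sum_gram n x : measurable_fun setT (fun y => bin_sum a n (t x y)).
Proof.
apply: measurable_sum => k; apply: measurable_funM => //.
by apply: measurable_funX; exact: measurable_gram1.
Qed.

Lemma integral_bin_sum n x :
  (\int[sigma]_y (bin_sum a n (t x y))%:E = (truncated_energy n)%:E)%E.
Proof.
rewrite /bin_sum /truncated_energy.
under eq_integral do rewrite -sumEFin.
rewrite ge0_integral_sum//; last 2 first.
- move=> k; apply/measurable_EFinP; apply: measurable_funM => //.
  by apply: measurable_funX; exact: measurable_gram1.
- by move=> k y _; rewrite lee_fin mulr_ge0 ?bin_coef_ge0 ?exprn_ge0 ?gram_ge0.
rewrite -sumEFin; apply: eq_bigr => k _.
under eq_integral do rewrite EFinM.
rewrite ge0_integralZl//; first by rewrite (momentE mX t01 homogeneous o k x) EFinM.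
- by apply/measurable_EFinP; apply: measurable_funX; exact: measurable_gram1.
- by move=> y _; rewrite lee_fin exprn_ge0 ?gram_ge0.
- by rewrite lee_fin bin_coef_ge0.
Qed.

Lemma truncated_energy_cvg x :
  (truncated_energy n)%:E @[n --> \oo] -->
  (\int[sigma]_y riesz_profile a (t x y))%E.
Proof.
have -> : (\int[sigma]_y riesz_profile a (t x y) =
    \int[sigma]_y limn (fun n => (bin_sum a n (t x y))%:E))%E.
  apply: eq_integral => y _; apply/esym/cvg_lim => //.
  by apply: bin_sum_cvg_profile; rewrite ?gram_ge0 ?gram_le1.
under eq_fun do rewrite -(integral_bin_sum _ x).
apply: cvg_monotone_convergence => //.
- by move=> n; apply/measurable_EFinP; exact: measurable_bin_sum_gram.
- by move=> n y _; rewrite lee_fin bin_sum_ge0// gram_ge0.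
- move=> y _ i j ij; rewrite lee_fin; apply: bin_sum_nondecreasing => //.
  exact: gram_ge0.
Qed.

(** Doubling the number of terms adds at most the largest moment involved
    times the sum of the first 2n coefficients, of order n^a. *)
Lemma truncated_energy_doubling : exists2 K : R, 0 < K &
  forall n, (0 < n)%N ->
    truncated_energy (2 * n)%N <= truncated_energy n + K * n%:R `^ (- beta).
Proof.
have [C' C'0 mC'] := moment_le mX t01 homogeneous D0 C0 ballC.
exists (C' * 2 * 4 `^ a); first by rewrite !mulr_gt0// powR_gt0.
move=> n n0; have nR : (0 : R) < n%:R by rewrite ltr0n.
have sn : 0 < Num.sqrt n%:R :> R by rewrite sqrtr_gt0.
have block j : truncated_energy (n + j) <= truncated_energy n +
    C' / Num.sqrt n%:R ^+ D * \sum_(k < j) bin_coef a (n + k).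
  elim: j => [|j IHj]; first by rewrite addn0 big_ord0 mulr0 addr0.
  rewrite addnS truncated_energyS big_ord_recr /= mulrDr addrA lerD//.
  rewrite mulrC ler_wpM2r ?bin_coef_ge0//.
  apply: (le_trans (mC' _ _)); first by rewrite addn_gt0 n0.
  rewrite ler_wpM2l ?(ltW C'0)// lef_pV2 ?posrE ?exprn_gt0 ?sqrtr_gt0 ?ltr0n ?addn_gt0 ?n0//.
  by rewrite lerXn2r ?nnegrE ?sqrtr_ge0// ler_wsqrtr// ler_nat leq_addr.
rewrite mul2n -addnn; apply: (le_trans (block n)); rewrite lerD2l.
have coefs : \sum_(k < n) bin_coef a (n + k) <= 2 * (4 * n%:R) `^ a.
  apply: (@le_trans _ _ (bin_sum a (n + n) 1)).
    rewrite /bin_sum big_split_ord /=.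
    under [X in _ <= _ + X]eq_bigr do rewrite expr1n mulr1.
    by rewrite lerDr sumr_ge0// => k _; rewrite mulr_ge0 ?bin_coef_ge0 ?exprn_ge0.
  apply: (le_trans (bin_sum1_le a0 _)); first by rewrite addn_gt0 n0.
  by rewrite natrD le_eqVlt; apply/orP; left; apply/eqP; congr (2 * _ `^ a); ring.
have -> : C' * 2 * 4 `^ a * n%:R `^ (- beta) =
    C' / Num.sqrt n%:R ^+ D * (2 * (4 * n%:R) `^ a).
  have -> : n%:R `^ (- beta) = n%:R `^ a / n%:R `^ (D%:R / 2).
    by rewrite /beta opprB powRB//; apply/implyP => _; rewrite gt_eqF.
  rewrite sqrtr_expn_powR ?(ltW nR)// [(4 * _) `^ a]powRM//.
  by field; rewrite gt_eqF// powR_gt0.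
by rewrite ler_wpM2l// divr_ge0 ?exprn_ge0 ?(ltW sn)// ltW.
Qed.

(** The doubling estimate, summed along n, 2n, 4n, ...: a geometric series of
    ratio 2^(-beta). *)
Lemma truncated_energy_tail : exists2 K : R, 0 < K &
  forall n l, (0 < n)%N ->
    truncated_energy l <= truncated_energy n + K * n%:R `^ (- beta).
Proof.
have [K K0 doubling] := truncated_energy_doubling.
pose theta : R := 2 `^ (- beta).
have th0 : 0 < theta by rewrite powR_gt0.
have th1 : theta < 1.
  have one_pow : 1 `^ beta = 1 :> R by rewrite powR1.
  rewrite /theta powRN invf_lt1 ?powR_gt0// -[ltLHS]one_pow.
  by rewrite gt0_ltr_powR ?nnegrE// ltr1n.
exists (K / (1 - theta)); first by rewrite divr_gt0// subr_gt0.
move=> n l n0; have nR : (0 : R) < n%:R by rewrite ltr0n.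
have iter j : truncated_energy (2 ^ j * n)%N <= truncated_energy n +
    K * n%:R `^ (- beta) * \sum_(i < j) theta ^+ i.
  elim: j => [|j IHj]; first by rewrite mul1n big_ord0 mulr0 addr0.
  rewrite expnS -mulnA; apply: (le_trans (doubling _ _)).
    by rewrite muln_gt0 expn_gt0.
  rewrite big_ord_recr /= mulrDr addrA lerD//.
  have -> : (2 ^ j * n)%:R `^ (- beta) = theta ^+ j * n%:R `^ (- beta).
    by rewrite natrM powRM// natrX -powR_mulrn// powRAC -/theta powR_mulrn// ltW.
  by rewrite mulrA mulrAC.
have ln : (l <= 2 ^ l * n)%N.
  by rewrite (leq_trans (ltnW (ltn_expl l (ltnSn 1))))// leq_pmulr.
apply: (le_trans (truncated_energy_nondecreasing ln)).
apply: (le_trans (iter l)); rewrite lerD2l mulrAC ler_wpM2r ?powR_ge0//.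
rewrite ler_wpM2l ?(ltW K0)// -[leRHS]mul1r ler_pdivlMr ?subr_gt0//.
by have := subrX1 theta l; have := exprn_ge0 l (ltW th0); lra.
Qed.

Lemma potential_truncation : exists (u K : R),
  [/\ forall x, (\int[sigma]_y riesz_profile a (t x y) = u%:E)%E, 0 < K &
      forall n, (0 < n)%N -> u <= truncated_energy n + K * n%:R `^ (- beta)].
Proof.
have [K K0 tail] := truncated_energy_tail.
pose U x := (\int[sigma]_y riesz_profile a (t x y))%E.
have Ule x n : (0 < n)%N -> (U x <= (truncated_energy n + K * n%:R `^ (- beta))%:E)%E.
  move=> n0; apply: (cvge_to_le (@truncated_energy_cvg x)).
  by near=> l; rewrite lee_fin tail.
have Ufin x : U x \is a fin_num.
  rewrite ge0_fin_numE; last by apply: integral_ge0 => y _; exact: riesz_profile_ge0.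
  exact: le_lt_trans (Ule x 1%N isT) (ltry _).
exists (fine (U o)), K; split=> [x||n n0] //.
  rewrite (fineK (Ufin o)); apply: (homogeneous (measurable_riesz_profile a)).
  exact: riesz_profile_ge0.
by rewrite -lee_fin (fineK (Ufin o)) Ule.
Unshelve. all: by end_near. Qed.

(** The truncated kernel lies below the Riesz kernel and is a nonnegative
    combination of powers of t, whose full double sums are at least N^2 times
    their means; the price is the diagonal, N times the value at 1. *)
Lemma config_truncation N (w : 'I_N -> T) n :
  ((N%:R ^+ 2 * truncated_energy n - N%:R * bin_sum a n 1)%:E <=
   \sum_i \sum_(j | j != i) riesz_profile a (t (w i) (w j)))%E.
Proof.
apply: (@le_trans _ _ (\sum_i \sum_(j | j != i) bin_sum a n (t (w i) (w j)))%:E);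
  last first.
  rewrite -sumEFin; apply: lee_sum => i _; rewrite -sumEFin; apply: lee_sum => j _.
  by apply: bin_sum_le_profile; rewrite ?gram_ge0 ?gram_le1.
rewrite lee_fin.
have -> : \sum_i \sum_(j | j != i) bin_sum a n (t (w i) (w j)) =
    \sum_i \sum_j bin_sum a n (t (w i) (w j)) - \sum_i bin_sum a n (t (w i) (w i)).
  by rewrite -sumrB; apply: eq_bigr => i _; rewrite [in RHS](bigD1 i)//= [RHS]addrC addKr.
apply: lerB.
  rewrite /truncated_energy mulr_sumr.
  have -> : \sum_i \sum_j bin_sum a n (t (w i) (w j)) =
      \sum_(k < n) bin_coef a k * \sum_i \sum_j t (w i) (w j) ^+ k.
    rewrite /bin_sum; under eq_bigr => i _ do rewrite exchange_big.
    rewrite exchange_big; apply: eq_bigr => k _; rewrite mulr_sumr.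
    by apply: eq_bigr => i _; rewrite mulr_sumr.
  apply: ler_sum => k _; rewrite mulrCA ler_wpM2l ?bin_coef_ge0//.
  exact: energy_moment.
rewrite mulr_natl -[N in _ *+ N]card_ord -sumr_const; apply: ler_sum => i _.
by apply: le_bin_sum; rewrite ?gram_ge0 ?gram_le1.
Qed.

(** The truncation error N^2 n^(a - D/2) and the diagonal N n^a balance for n
    of order N^(2/D), the inverse square of the distance between neighbours. *)
Lemma energy_lower_bound : exists (u C' : R),
  [/\ forall x, (\int[sigma]_y riesz_profile a (t x y) = u%:E)%E, 0 < C' &
      forall N (w : 'I_N -> T), (0 < N)%N ->
      ((u * N%:R ^+ 2 - C' * N%:R `^ (1 + a *+ 2 / D%:R))%:E <=
       \sum_i \sum_(j | j != i) riesz_profile a (t (w i) (w j)))%E].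
Proof.
have [u [K [Uu K0 trunc]]] := potential_truncation.
exists u, (K + 2 * 4 `^ a); split=> //.
  by rewrite addr_gt0// mulr_gt0// powR_gt0.
move=> N w N0; have NR1 : (1 : R) <= N%:R by rewrite ler1n.
have NR : (0 : R) < N%:R by rewrite ltr0n.
have DR : (0 : R) < D%:R by rewrite ltr0n.
pose z : R := N%:R `^ (2 / D%:R).
have z1 : 1 <= z.
  have one_pow : 1 `^ (2 / D%:R) = 1 :> R by rewrite powR1.
  by rewrite -[leLHS]one_pow ge0_ler_powR ?nnegrE ?divr_ge0.
have z0 : 0 < z := lt_le_trans ltr01 z1.
pose n := (Num.truncn z).+1.
have /andP[nz zn] := truncn_itv (ltW z0).
have nle : n%:R <= 2 * z by rewrite /n -natr1; lra.
apply: le_trans (config_truncation w n); rewrite lee_fin.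
have H1 := trunc n isT; have H2 := bin_sum1_le a0 (isT : (0 < n)%N).
have z2 : n%:R `^ (- beta) <= z `^ (- beta).
  rewrite !powRN lef_pV2 ?posrE ?powR_gt0//.
  by rewrite ge0_ler_powR ?nnegrE ?(ltW beta0) ?(ltW z0) ?(ltW zn).
have z3 : N%:R ^+ 2 * z `^ (- beta) = N%:R `^ (1 + a *+ 2 / D%:R).
  rewrite /z -powRrM -powR_mulrn ?(ltW NR)// -powRD; last first.
    by apply/implyP => _; rewrite gt_eqF.
  by congr (_ `^ _); rewrite /beta; field; rewrite gt_eqF.
have z4 : N%:R * (2 * n%:R) `^ a <= 4 `^ a * N%:R `^ (1 + a *+ 2 / D%:R).
  apply: (@le_trans _ _ (N%:R * (4 * z) `^ a)).
    rewrite ler_wpM2l// ge0_ler_powR ?nnegrE ?(ltW a0) ?mulr_ge0 ?(ltW z0)//.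
    by move: nle; lra.
  rewrite powRM ?(ltW z0)// mulrCA ler_wpM2l ?powR_ge0//.
  rewrite /z -powRrM -{1}[N%:R]powRr1 ?(ltW NR)// -powRD; last first.
    by apply/implyP => _; rewrite gt_eqF.
  by rewrite le_eqVlt; apply/orP; left; apply/eqP; congr (_ `^ _); field; rewrite gt_eqF.
have H3 := ler_wpM2l (ltW (exprn_gt0 2 NR)) H1.
have H4 := ler_wpM2l (ltW NR) H2.
have H5 : N%:R ^+ 2 * (K * n%:R `^ (- beta)) <= K * N%:R `^ (1 + a *+ 2 / D%:R).
  by rewrite mulrCA ler_wpM2l ?(ltW K0)// -z3 ler_wpM2l// exprn_ge0 ?(ltW NR).
by move: H3 H4 H5 z4; rewrite mulrDr; lra.
Qed.

End lower_bound.

(** * The upper bound *)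

Section derandomization.
Context {d : measure_display} {T : measurableType d} {R : realType}.
Variables (sigma : probability T R) (K : T -> T -> \bar R).
Hypothesis mK : measurable_fun setT (fun z : T * T => K z.1 z.2).
Hypothesis K0 : forall x y, (0 <= K x y)%E.
Implicit Types (f g : T -> R) (h : T -> \bar R).

Definition density f : Prop :=
  [/\ measurable_fun setT f, forall x, 0 <= f x &
      (\int[sigma]_x (f x)%:E = 1)%E].

Definition mean f h : \bar R := (\int[sigma]_x (h x * (f x)%:E))%E.

Definition potential g x : \bar R := mean g (K x).

Definition mutual_energy f g : \bar R := mean f (potential g).

Lemma measurable_mean f h : density f -> measurable_fun setT h ->
  measurable_fun setT (fun x => h x * (f x)%:E)%E.
Proof. by move=> [mf _ _] mh; apply: emeasurable_funM => //; exact/measurable_EFinP. Qed.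

Lemma measurable_kernel_row x : measurable_fun setT (K x).
Proof.
have := measurableT_comp mK (@pair1_measurable _ _ T T x).
by apply: eq_measurable_fun.
Qed.

Lemma meanD f h h' : density f -> measurable_fun setT h -> measurable_fun setT h' ->
  (forall x, (0 <= h x)%E) -> (forall x, (0 <= h' x)%E) ->
  mean f (fun x => h x + h' x)%E = (mean f h + mean f h')%E.
Proof.
move=> df mh mh' h0 h'0; have [mf f0 _] := df; rewrite /mean -ge0_integralD//.
- by apply: eq_integral => x _; rewrite ge0_muleDl.
- by move=> x _; rewrite mule_ge0// lee_fin.
- exact: measurable_mean.
- by move=> x _; rewrite mule_ge0// lee_fin.
- exact: measurable_mean.
Qed.

Lemma mean_sum (I : finType) f (h : I -> T -> \bar R) : density f ->
  (forall i, measurable_fun setT (h i)) -> (forall i x, (0 <= h i x)%E) ->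
  mean f (fun x => \sum_i h i x)%E = (\sum_i mean f (h i))%E.
Proof.
move=> df mh h0; have [mf f0 _] := df; rewrite /mean -ge0_integral_sum//.
- apply: eq_integral => x _; rewrite ge0_sume_distrl//.
- by move=> i; exact: measurable_mean.
- by move=> i x _; rewrite mule_ge0// lee_fin.
Qed.

Lemma mean_ge0 f h : density f -> (forall x, (0 <= h x)%E) -> (0 <= mean f h)%E.
Proof.
by move=> [_ f0 _] h0; apply: integral_ge0 => x _; rewrite mule_ge0// lee_fin.
Qed.

Lemma mean_cst f (c : R) : density f -> 0 <= c -> mean f (fun=> c%:E) = c%:E.
Proof.
move=> [mf f0 f1] c0; rewrite /mean ge0_integralZl ?f1 ?mule1//.
- exact/measurable_EFinP.
- by move=> x _; rewrite lee_fin.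
Qed.

(** Otherwise h - mean f h is positive everywhere and has mean 0, which forces
    f to vanish almost everywhere, against its integral being 1. *)
Lemma exists_le_mean f h : density f -> measurable_fun setT h ->
  (forall x, (0 <= h x)%E) -> exists x, (h x <= mean f h)%E.
Proof.
move=> df mh h0; apply/not_existsP => big; have [mf f0 f1] := df.
have {}big x : (mean f h < h x)%E by rewrite ltNge; apply/negP/big.
have fin : mean f h \is a fin_num.
  by rewrite ge0_fin_numE ?mean_ge0// (lt_le_trans (big point)) ?leey.
pose c := fine (mean f h).
have cE : mean f h = c%:E by rewrite fineK.
have c0 : 0 <= c by rewrite -lee_fin -cE mean_ge0.
pose h' x := (h x - c%:E)%E.
have h'0 x : (0 < h' x)%E by rewrite sube_gt0 -cE.
have mh' : measurable_fun setT h' by apply: emeasurable_funB => //; exact: measurable_cst.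
have hE : h = (fun x => h' x + c%:E)%E by apply/funext => x; rewrite subeK.
have mean0 : mean f h' = 0%E.
  have cE0 : forall x : T, (0 <= c%:E)%E by move=> x; rewrite lee_fin.
  have := cE; rewrite {1}hE (meanD df mh' (measurable_cst _) (fun x => ltW (h'0 x)) cE0).
  rewrite mean_cst// => e.
  have : (mean f h' + c%:E - c%:E = c%:E - c%:E)%E by rewrite e.
  by rewrite addeK// subee.
have f_ae : ae_eq sigma setT (fun x => (f x)%:E) (cst 0%E).
  have : (\int[sigma]_x `|h' x * (f x)%:E| = 0)%E.
    rewrite -[RHS]mean0; apply: eq_integral => x _.
    by rewrite gee0_abs// mule_ge0 ?lee_fin// ltW.
  move=> /(ae_eq_integral_abs sigma measurableT (measurable_mean df mh')).1.
  apply: filterS => x /= H _; move/eqP: (H I); rewrite mule_eq0.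
  by rewrite gt_eqF//= => /eqP.
have : (\int[sigma]_x (f x)%:E = \int[sigma]_x cst 0 x)%E.
  by apply: ae_eq_integral => //; exact/measurable_EFinP.
by rewrite f1 integral_cst// mul0e => /eqP; rewrite onee_eq0.
Qed.

Lemma measurable_weighted_kernel f g : density f -> density g ->
  measurable_fun setT (fun z : T * T => K z.1 z.2 * (g z.2)%:E * (f z.1)%:E)%E.
Proof.
move=> [mf _ _] [mg _ _]; apply: emeasurable_funM; first apply: emeasurable_funM => //.
  by apply/measurable_EFinP; exact: measurableT_comp mg (@measurable_snd _ _ T T).
by apply/measurable_EFinP; exact: measurableT_comp mf (@measurable_fst _ _ T T).
Qed.

Lemma potential_ge0 g x : density g -> (0 <= potential g x)%E.
Proof. by move=> dg; apply: mean_ge0. Qed.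

Lemma measurable_potential g : density g -> measurable_fun setT (potential g).
Proof.
move=> [mg g0 _].
apply: (measurable_fun_fubini_tonelli_F (m2 := sigma)
  (fun z : T * T => K z.1 z.2 * (g z.2)%:E)%E).
- apply: emeasurable_funM => //.
  by apply/measurable_EFinP; exact: measurableT_comp mg (@measurable_snd _ _ T T).
- by move=> z; rewrite mule_ge0// lee_fin.
Qed.

Hypothesis Ksym : forall x y, K x y = K y x.

Lemma mutual_energyC f g : density f -> density g ->
  mutual_energy f g = mutual_energy g f.
Proof.
move=> df dg; have [mf f0 _] := df; have [mg g0 _] := dg.
have E f1 g1 : density f1 -> density g1 -> mutual_energy f1 g1 =
    (\int[sigma]_x \int[sigma]_y (K x y * (g1 y)%:E * (f1 x)%:E))%E.
  move=> [mf1 f10 _] dg1; have [mg1 g10 _] := dg1.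
  apply: eq_integral => x _; rewrite muleC -ge0_integralZl ?lee_fin//.
  - by apply: eq_integral => y _; rewrite muleC.
  - by apply: measurable_mean => //; exact: measurable_kernel_row.
  - by move=> y _; rewrite mule_ge0// lee_fin.
rewrite (E f g df dg) (E g f dg df).
rewrite (@fubini_tonelli _ _ T T R sigma sigma
  (fun z : T * T => K z.1 z.2 * (g z.2)%:E * (f z.1)%:E)%E).
- apply: eq_integral => y _; apply: eq_integral => x _ /=.
  by rewrite Ksym -!muleA [((g _)%:E * _)%E]muleC.
- exact: measurable_weighted_kernel.
- by move=> z; rewrite !mule_ge0// lee_fin.
Qed.

Lemma sum_off_diagonal_recl N (B : 'I_N.+1 -> 'I_N.+1 -> \bar R) :
  (\sum_i \sum_(j | j != i) B i j =
   \sum_j B ord0 (lift ord0 j) + \sum_j B (lift ord0 j) ord0 +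
   \sum_i \sum_(j | j != i) B (lift ord0 i) (lift ord0 j))%E.
Proof.
rewrite big_ord_recl; rewrite big_mkcond big_ord_recl /= add0e -addeA.
congr (_ + _)%E; rewrite -big_split /=; apply: eq_bigr => i _.
rewrite big_mkcond big_ord_recl /=; congr (_ + _)%E.
by rewrite [RHS]big_mkcond; apply: eq_bigr => j _; rewrite (inj_eq lift_inj).
Qed.

(** Replacing the random points one at a time: with the others fixed, the
    energy is affine in the law of each point, so some deterministic position
    does at least as well. The fields h record the points already fixed. *)
Lemma derandomization N (f : 'I_N -> T -> R) (h : 'I_N -> T -> \bar R) :
  (forall i, density (f i)) -> (forall i, measurable_fun setT (h i)) ->
  (forall i x, (0 <= h i x)%E) -> exists w : 'I_N -> T,
  (\sum_i h i (w i) + \sum_i \sum_(j | j != i) K (w i) (w j) <=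
   \sum_i mean (f i) (h i) +
   \sum_i \sum_(j | j != i) mutual_energy (f i) (f j))%E.
Proof.
elim: N f h => [|N IHN] f h df mh h0.
  by exists (fun=> point); rewrite !big_ord0.
pose f' (i : 'I_N) := f (lift ord0 i).
pose g x := (h ord0 x + (\sum_i potential (f' i) x + \sum_i potential (f' i) x))%E.
have mP i := measurable_potential (df (lift ord0 i)).
have P0 i x : (0 <= potential (f' i) x)%E by apply: potential_ge0; exact: df.
have mS : measurable_fun setT (fun x => \sum_i potential (f' i) x)%E.
  exact: emeasurable_sum.
have S0 x : (0 <= \sum_i potential (f' i) x)%E by apply: sume_ge0 => i _.
have [x0 gx0] : exists x0, (g x0 <= mean (f ord0) g)%E.
  apply: exists_le_mean; first exact: df.
    by apply: emeasurable_funD => //; exact: emeasurable_funD.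
  by move=> x; rewrite !adde_ge0.
pose h' i x := (h (lift ord0 i) x + (K x0 x + K x0 x))%E.
have mKx := measurable_kernel_row x0.
have [| | |w' IH] := IHN f' h'.
- by move=> i; exact: df.
- by move=> i; apply: emeasurable_funD => //; exact: emeasurable_funD.
- by move=> i x; rewrite !adde_ge0.
pose w i := if unlift ord0 i is Some j then w' j else x0.
have w0 : w ord0 = x0 by rewrite /w unlift_none.
have wl j : w (lift ord0 j) = w' j by rewrite /w liftK.
exists w; rewrite !sum_off_diagonal_recl big_ord_recl [in leRHS]big_ord_recl w0.
have -> : (\sum_j K x0 (w (lift ord0 j)) = \sum_j K x0 (w' j))%E.
  by apply: eq_bigr => j _; rewrite wl.
have -> : (\sum_j K (w (lift ord0 j)) x0 = \sum_j K x0 (w' j))%E.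
  by apply: eq_bigr => j _; rewrite wl Ksym.
have -> : (\sum_i \sum_(j | j != i) K (w (lift ord0 i)) (w (lift ord0 j)) =
    \sum_i \sum_(j | j != i) K (w' i) (w' j))%E.
  by apply: eq_bigr => i _; apply: eq_bigr => j _; rewrite !wl.
have -> : (\sum_i h (lift ord0 i) (w (lift ord0 i)) =
    \sum_i h (lift ord0 i) (w' i))%E.
  by apply: eq_bigr => i _; rewrite wl.
have -> : (\sum_j mutual_energy (f (lift ord0 j)) (f ord0) =
    \sum_j mutual_energy (f ord0) (f' j))%E.
  by apply: eq_bigr => j _; rewrite mutual_energyC.
have hw : (\sum_i h' i (w' i) = \sum_i h (lift ord0 i) (w' i) +
    (\sum_j K x0 (w' j) + \sum_j K x0 (w' j)))%E.
  by rewrite -!big_split.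
have hm : (\sum_i mean (f' i) (h' i) = \sum_i mean (f' i) (h (lift ord0 i)) +
    (\sum_j potential (f' j) x0 + \sum_j potential (f' j) x0))%E.
  rewrite -!big_split /=; apply: eq_bigr => i _.
  rewrite meanD//; last 3 first.
  - exact: df.
  - exact: emeasurable_funD.
  - by move=> x; rewrite adde_ge0.
  by rewrite meanD//; exact: df.
have mg : (mean (f ord0) g = mean (f ord0) (h ord0) +
    (\sum_j mutual_energy (f ord0) (f' j) + \sum_j mutual_energy (f ord0) (f' j)))%E.
  rewrite meanD//; last 2 first.
  - exact: emeasurable_funD.
  - by move=> x; rewrite adde_ge0.
  by rewrite meanD// mean_sum.
rewrite hw hm in IH; rewrite {}mg in gx0.
rewrite -/f'.
set m0 := mean (f ord0) (h ord0) in gx0 *.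
set m1 := (\sum_i mean (f' i) (h (lift ord0 i)))%E in IH *.
set m2 := (\sum_j mutual_energy (f ord0) (f' j))%E in gx0 *.
set m3 := (\sum_i \sum_(j | j != i) mutual_energy (f' i) (f' j))%E in IH *.
set p := (\sum_j potential (f' j) x0)%E in IH *.
set s1 := (\sum_i h _ _)%E in IH *; set s2 := (\sum_j K x0 (w' j))%E in IH *.
set s3 := (\sum_i \sum_(j | j != i) K (w' i) (w' j))%E in IH *.
apply: (@le_trans _ _ (h ord0 x0 + (m1 + (p + p) + m3))%E).
  by rewrite -addeA (addeA s1) leeD2l.
apply: (@le_trans _ _ (g x0 + (m1 + m3))%E).
  by rewrite /g -/p (addeC m1) -!addeA.
apply: (le_trans (leeD gx0 (lexx _))).
by rewrite -!addeA leeD2l// (addeCA m1) (addeCA m1).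
Qed.

End derandomization.

Section jittered.
Context {d : measure_display} {T : measurableType d} {R : realType}.
Variables (sigma : probability T R) (K : T -> T -> \bar R).
Hypothesis mK : measurable_fun setT (fun z : T * T => K z.1 z.2).
Hypothesis K0 : forall x y, (0 <= K x y)%E.
Hypothesis Ksym : forall x y, K x y = K y x.
Variable u : R.
Hypothesis Ku : forall x, (\int[sigma]_y K x y = u%:E)%E.

Lemma mean_ge (f : T -> R) (h : T -> \bar R) (c : R) : density sigma f ->
  measurable_fun setT h -> (forall x, (0 <= h x)%E) -> 0 <= c ->
  (forall x, f x != 0 -> (c%:E <= h x)%E) -> (c%:E <= mean sigma f h)%E.
Proof.
move=> df mh h0 c0 ch; rewrite -{1}(mean_cst df c0); have [mf f0 _] := df.
apply: ge0_le_integral => //.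
- by move=> x _; rewrite mule_ge0 ?lee_fin.
- exact: measurable_mean df (measurable_cst _).
- exact: measurable_mean df mh.
move=> x _; have [->|fx] := eqVneq (f x) 0; first by rewrite !mule0.
by rewrite lee_wpmul2r ?lee_fin ?ch.
Qed.

Variables (M L : nat) (B : 'I_M -> set T) (kappa : R).
Hypotheses (L0 : (0 < L)%N) (kappa0 : 0 <= kappa).
Hypothesis mB : forall i, measurable (B i).
Hypothesis disjB : forall i j x, B i x -> B j x -> i = j.
Hypothesis largeB : forall i, (1 <= (M + L)%:R%:E * sigma (B i))%E.
Hypothesis Kdiag : forall i x y, B i x -> B i y -> (kappa%:E <= K x y)%E.

Local Notation N := (M + L)%N.

Let v i : R := fine (sigma (B i)).

Let vE i : sigma (B i) = (v i)%:E.
Proof. by rewrite fineK// fin_num_measure. Qed.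

Let Nv i : 1 <= N%:R * v i.
Proof. by have := largeB i; rewrite vE -EFinM lee_fin. Qed.

Let v0 i : 0 < v i.
Proof.
rewrite lt_neqAle; apply/andP; split.
  by apply/eqP => e; have := Nv i; rewrite -e mulr0 ler10.
by rewrite -lee_fin -vE.
Qed.

Definition cell_density i x : R := (v i)^-1 * \1_(B i) x.

(** What is left of N times sigma once the M cells have been served, shared
    equally by the L remaining points; it is nonnegative because each cell has
    measure at least 1/N and the cells are disjoint. *)
Definition rest_density x : R := (N%:R - \sum_i cell_density i x) / L%:R.

Definition jittered_density (k : 'I_N) : T -> R :=
  match fintype.split k with inl i => cell_density i | inr _ => rest_density end.

Lemma measurable_cell_density i : measurable_fun setT (cell_density i).
Proof. by apply: measurable_funM => //; exact: measurable_indic. Qed.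

Lemma density_cell i : density sigma (cell_density i).
Proof.
split; first exact: measurable_cell_density.
  by move=> x; rewrite mulr_ge0// invr_ge0 ltW.
under eq_integral do rewrite EFinM.
rewrite ge0_integralZl//.
- have -> : (\int[sigma]_x (\1_(B i) x)%:E = (v i)%:E)%E.
    by rewrite integral_indic// setIT; exact: vE.
  by rewrite -EFinM mulVf// gt_eqF.
- by apply/measurable_EFinP; exact: measurable_indic.
- by rewrite lee_fin invr_ge0 ltW.
Qed.

Lemma cell_density_sum_le x : \sum_i cell_density i x <= N%:R.
Proof.
have [[i Bix]|none] := pselect (exists i, B i x).
  rewrite (bigD1 i)//= big1 => [|j ji].
    rewrite addr0 /cell_density indicE mem_set// mulr1.
    by rewrite -[leLHS]mul1r ler_pdivrMr.
  rewrite /cell_density indicE memNset ?mulr0// => Bjx.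
  by move/eqP: ji; apply; exact: disjB Bix.
rewrite big1// => i _; rewrite /cell_density indicE memNset ?mulr0// => Bix.
by apply: none; exists i.
Qed.

Lemma density_rest : density sigma rest_density.
Proof.
have LR : (0 : R) < L%:R by rewrite ltr0n.
have mS : measurable_fun setT (fun x => \sum_i cell_density i x).
  by apply: measurable_sum => i; exact: measurable_cell_density.
have mr : measurable_fun setT rest_density.
  by apply: measurable_funM => //; apply: measurable_funB.
have r0 x : 0 <= rest_density x.
  by rewrite divr_ge0 ?(ltW LR)// subr_ge0 cell_density_sum_le.
split=> //.
have : (\int[sigma]_x (N%:R : R)%:E = L%:R%:E * \int[sigma]_x (rest_density x)%:E +
    \sum_i \int[sigma]_x (cell_density i x)%:E)%E.
  rewrite -ge0_integralZl//; last 2 first.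
  - exact/measurable_EFinP.
  - by move=> x _; rewrite lee_fin.
  rewrite -ge0_integral_sum//; last 2 first.
  - by move=> i; apply/measurable_EFinP; exact: measurable_cell_density.
  - by move=> i x _; rewrite lee_fin; have [_ + _] := density_cell i; apply.
  rewrite -ge0_integralD//; last 4 first.
  - by move=> x _; rewrite mule_ge0 ?lee_fin.
  - by apply: measurable_funeM; exact/measurable_EFinP.
  - move=> x _; apply: sume_ge0 => i _.
    by rewrite lee_fin; have [_ + _] := density_cell i; apply.
  - by apply: emeasurable_sum => i; apply/measurable_EFinP; exact: measurable_cell_density.
  apply: eq_integral => x _; rewrite sumEFin -EFinM -EFinD; congr EFin.
  by rewrite /rest_density mulrC divfK ?gt_eqF// subrK.
rewrite integral_cst// [X in (_ * X)%E](probability_setT sigma) mule1.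
have -> : (\sum_i \int[sigma]_x (cell_density i x)%:E = M%:R%:E)%E.
  under eq_bigr => i _ do (have [_ _ ->] := density_cell i).
  by rewrite sumEFin sumr_const card_ord.
case: (\int[sigma]_x (rest_density x)%:E)%E => [r| |].
- rewrite -EFinM -EFinD => -[] e; congr EFin.
  have : L%:R * r = L%:R * 1 by move: e; rewrite natrD; lra.
  by move/(mulfI (lt0r_neq0 LR)).
- by rewrite gt0_muley ?lte_fin.
- by rewrite gt0_muleNy ?lte_fin.
Qed.

Lemma density_jittered k : density sigma (jittered_density k).
Proof.
rewrite /jittered_density; case: fintype.split => [i|_]; first exact: density_cell.
exact: density_rest.
Qed.

Lemma jittered_lshift i : jittered_density (lshift L i) = cell_density i.
Proof. by rewrite /jittered_density (unsplitK (inl i)). Qed.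

Lemma jittered_rshift i : jittered_density (rshift M i) = rest_density.
Proof. by rewrite /jittered_density (unsplitK (inr i)). Qed.

Lemma jittered_density_sum x : \sum_k jittered_density k x = N%:R.
Proof.
have LR : (0 : R) < L%:R by rewrite ltr0n.
rewrite big_split_ord /=.
under eq_bigr => i _ do rewrite jittered_lshift.
under [X in _ + X]eq_bigr => i _ do rewrite jittered_rshift.
rewrite sumr_const card_ord -(mulr_natl (rest_density x)) /rest_density.
by rewrite mulrC divfK ?gt_eqF// addrC subrK.
Qed.

(** The densities add up to N, so that the double sum over all pairs, the
    diagonal included, is N^2 times the energy integral. *)
Lemma jittered_total : (\sum_k \sum_l
  mutual_energy sigma K (jittered_density k) (jittered_density l) =
  (N%:R ^+ 2 * u)%:E)%E.
Proof.
have u0 : 0 <= u by rewrite -lee_fin -(Ku point); apply: integral_ge0.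
have mP l := measurable_potential mK K0 (density_jittered l).
have pot x : (\sum_l potential sigma K (jittered_density l) x = (N%:R * u)%:E)%E.
  rewrite /potential /mean -ge0_integral_sum//; last 2 first.
  - move=> l; apply: measurable_mean (density_jittered l) _.
    exact: measurable_kernel_row.
  - move=> l y _; have [_ f0 _] := density_jittered l.
    by rewrite mule_ge0 ?lee_fin.
  rewrite EFinM -(Ku x) -ge0_integralZl//; last first.
    exact: measurable_kernel_row.
  apply: eq_integral => y _; rewrite -ge0_sume_distrr; last first.
    by move=> l _; have [_ f0 _] := density_jittered l; rewrite lee_fin.
  by rewrite sumEFin jittered_density_sum muleC.
transitivity (\sum_(k < N) (N%:R * u)%:E)%E; last first.
  by rewrite sumEFin sumr_const card_ord -(mulr_natl (N%:R * u)) mulrA expr2.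
apply: eq_bigr => k _; rewrite /mutual_energy -mean_sum//; last 2 first.
- exact: density_jittered.
- by move=> l x; apply: potential_ge0 => //; exact: density_jittered.
rewrite -[RHS](mean_cst (density_jittered k)) ?mulr_ge0//.
by congr mean; apply/funext.
Qed.

(** Leaving out the diagonal saves the self-energies; those of the points
    confined to the cells B i are at least kappa each. *)
Lemma jittered_config : exists w : 'I_N -> T,
  (\sum_i \sum_(j | j != i) K (w i) (w j) <= (N%:R ^+ 2 * u - M%:R * kappa)%:E)%E.
Proof.
have dj := density_jittered.
have [||| w] := @derandomization _ _ _ sigma K mK K0 Ksym N jittered_density
  (fun _ _ => 0%E).
- exact: dj.
- by move=> i; exact: measurable_cst.
- by [].
rewrite big1// add0e [X in (_ <= X + _)%E]big1 ?add0e; last first.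
  by move=> i _; exact: mean_cst.
move=> le; exists w; apply: (le_trans le); rewrite EFinB leeBrDr//.
rewrite -jittered_total.
have -> : (\sum_k \sum_l mutual_energy sigma K (jittered_density k) (jittered_density l) =
    \sum_k \sum_(l | l != k) mutual_energy sigma K (jittered_density k) (jittered_density l) +
    \sum_k mutual_energy sigma K (jittered_density k) (jittered_density k))%E.
  by rewrite -big_split; apply: eq_bigr => k _; rewrite (bigD1 k)//= addeC.
apply: leeD2l; rewrite big_split_ord /=.
have m0 k : (0 <= mutual_energy sigma K (jittered_density k) (jittered_density k))%E.
  by apply: mean_ge0 => // x; exact: potential_ge0.
apply: (@le_trans _ _ (\sum_(i < M)
  mutual_energy sigma K (jittered_density (lshift L i)) (jittered_density (lshift L i)))%E);
  last by rewrite leeDl// sume_ge0.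
rewrite mulr_natl -[M in _ *+ M]card_ord -sumr_const -sumEFin; apply: lee_sum => i _.
have mass x : cell_density i x != 0 -> B i x.
  apply: contra_neqP => nB.
  by rewrite /cell_density indicE memNset ?mulr0.
rewrite jittered_lshift; have dc := density_cell i.
apply: mean_ge => //; [exact: measurable_potential | by move=> x; exact: potential_ge0 |].
move=> x /mass Bx; apply: mean_ge => //; first exact: measurable_kernel_row.
by move=> y /mass By; exact: Kdiag Bx By.
Qed.

End jittered.

(** * Borel measures on projective space *)

Section projective.
Context {R : realType} {F : division_algebra} {n : nat}.
Hypotheses (n2 : (2 <= n)%N) (hO : F = Octonions -> n = 2%N).
Local Notation A := (scalars R F).
Local Notation T := (projspace R F n).
Local Notation BT := (borel_projspace R F n).
Local Notation D := (projdim F n).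
Implicit Types x y z : T.

Let h : composition_spec A := scalars_composition R F.
Let hs : star_algebra_spec A := ca_spec h.

Lemma measurable_open (U : set T) : open U -> measurable (U : set BT).
Proof. by move=> oU; apply: sub_sigma_algebra. Qed.

Lemma open_chordal (U : set T) :
  (forall x, U x -> exists2 e, 0 < e & forall y, chordal x y < e -> U y) -> open U.
Proof.
move=> H; rewrite openE => x /H[e e0 xU].
by apply/nbhs_ballP; exists e => // y; rewrite ballEmdist; exact: xU.
Qed.

Lemma chordal_open (U : set T) x : open U -> U x ->
  exists2 e, 0 < e & forall y, chordal x y < e -> U y.
Proof.
by rewrite openE => oU /oU /nbhs_ballP[e e0 xU]; exists e.
Qed.

Lemma lipschitz_measurable (f : T -> R) :
  (forall x y, `|f x - f y| <= 2 * chordal x y) ->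
  measurable_fun setT (f : BT -> R).
Proof.
move=> lf; apply: (measurability _ (RGenOpens.measurableE R)).
move=> _ [_ [a [b ->] <-]]; rewrite setTI; apply: measurable_open.
apply: open_chordal => x /= xab; have oab := @interval_open R (BRight a) (BLeft b) isT isT.
have /nbhs_ballP[e /= e0 xU] := open_nbhs_nbhs (conj oab xab).
exists (e / 2) => [|y xy]; first by rewrite divr_gt0.
apply: xU; rewrite /ball /=; apply: le_lt_trans (lf x y) _.
by move: xy; lra.
Qed.

Lemma isometry_measurable (g : T -> T) :
  (forall x y, chordal (g x) (g y) = chordal x y) ->
  measurable_fun setT (g : BT -> BT).
Proof.
move=> gi; apply: measurability => //.
move=> _ [U oU <-]; rewrite setTI; apply: measurable_open.
apply: open_chordal => x /(chordal_open oU)[e e0 xU]; exists e => // y xy.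
by apply: xU; rewrite gi.
Qed.

Section coordinates.
Variables (J : finType) (b : J -> A).
Hypothesis ob : orthonormal_basis b.

(** Real coordinates of the matrix, for which the inner product of projectors
    is a Gram kernel. *)
Definition coordinate (i : 'I_n.+1 * 'I_n.+1 * J) (x : BT) : R :=
  sa_dot (projspace_mx (x : T) i.1.1 i.1.2) (b i.2).

Lemma gram_coordinate (x y : BT) : gram coordinate x y = inner_mx (x : T) (y : T).
Proof.
rewrite /gram (inner_mxE hs) -(pair_bigA _ (fun i e => coordinate (i, e) x * coordinate (i, e) y)) /=.
rewrite -(pair_bigA _ (fun i j => \sum_e coordinate (i, j, e) x * coordinate (i, j, e) y)) /=.
by apply: eq_bigr => i _; apply: eq_bigr => j _; rewrite ob.2.
Qed.

Lemma coordinate_dist i x y :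
  `|coordinate i x - coordinate i y| <= 2 * chordal x y.
Proof.
have -> : 2 * chordal x y = Num.sqrt (4 * chordal x y ^+ 2).
  by rewrite (_ : 4 * _ = (2 * chordal x y) ^+ 2) ?sqrtr_sqr ?ger0_norm ?mulr_ge0 ?sqrtr_ge0//; ring.
rewrite -sqrtr_sqr ler_wsqrtr// chordalE /=.
set U := projspace_mx x - projspace_mx y.
have I0 := inner_mx_ge0 hs U.
rewrite sqr_sqrtr ?divr_ge0//.
have : (coordinate i x - coordinate i y) ^+ 2 <= inner_mx U U.
  case: i => -[i j] e; rewrite /coordinate /= -(dotBl h).
  have -> : projspace_mx x i j - projspace_mx y i j = U i j by rewrite !mxE.
  rewrite (inner_mxE hs) (bigD1 i)//= (bigD1 j)//= (norm_parseval ob) (bigD1 e)//=.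
  rewrite -!addrA lerDl !addr_ge0// sumr_ge0// => k _; rewrite ?sqr_ge0 ?(norm_ge0)//.
  by rewrite sumr_ge0// => l _; exact: norm_ge0.
by lra.
Qed.

Lemma measurable_coordinate i : measurable_fun setT (coordinate i).
Proof. exact: lipschitz_measurable (coordinate_dist i).
Qed.

End coordinates.
Variable sigma : probability BT R.
Hypothesis hsigma : isometry_invariant sigma.

Lemma integral_isometry (g : T -> T) (G : BT -> \bar R) :
  bijective g -> (forall x y, chordal (g x) (g y) = chordal x y) ->
  measurable_fun setT G -> (forall y, (0 <= G y)%E) ->
  (\int[sigma]_y G (g y) = \int[sigma]_y G y)%E.
Proof.
move=> gb gi mG G0; have mg := isometry_measurable gi.
transitivity (\int[pushforward sigma (g : BT -> BT)]_y G y)%E.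
  by rewrite ge0_integral_pushforward ?preimage_setT.
by apply: (eq_measure_integral sigma) => U mU _; exact: hsigma.
Qed.

Section gram_facts.
Variables (J : finType) (b : J -> A).
Hypothesis ob : orthonormal_basis b.
Local Notation X := (coordinate b).

Lemma gram_coordinate01 (x y : BT) : 0 <= gram X x y <= 1.
Proof. by rewrite (gram_coordinate ob) (inner_ge0 n2 hO) (inner_le1 x y). Qed.

(** Isometries act transitively and preserve sigma. *)
Lemma gram_homogeneous (f : R -> \bar R) : measurable_fun setT f ->
  (forall r, (0 <= f r)%E) -> forall x x' : BT,
  (\int[sigma]_y f (gram X x y) = \int[sigma]_y f (gram X x' y))%E.
Proof.
move=> mf f0.
suff H (x : BT) : (\int[sigma]_y f (gram X x y) =
    \int[sigma]_y f (gram X (point : T) y))%E by move=> x x'; rewrite H [RHS]H.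
have [g [gb gi gx ginner]] := equivalent_inner n2 hO (x : T).
rewrite -[RHS](integral_isometry gb gi).
- by apply: eq_integral => y _; rewrite !(gram_coordinate ob) -gx ginner.
- by apply: measurableT_comp mf _; apply: measurable_gram1; exact: measurable_coordinate.
- by [].
Qed.

Lemma gram_ballP (x y : BT) r : 0 < r -> gram_ball X x r y <-> chordal (x : T) y < r.
Proof.
move=> r0; rewrite /gram_ball /= (gram_coordinate ob) inner_chordal opprB addrC subrK.
by rewrite ltr_pXn2r// ?nnegrE ?chordal_ge0// ltW.
Qed.

Let mball (x : BT) r : measurable (gram_ball X x r).
Proof. by apply: measurable_gram_ball; exact: measurable_coordinate. Qed.

Lemma gram_ball_measure (x x' : BT) r :
  sigma (gram_ball X x r) = sigma (gram_ball X x' r).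
Proof.
pose f (tau : R) : \bar R := (\1_(`]1 - r ^+ 2, +oo[%classic) tau)%:E.
have ballE z : sigma (gram_ball X z r) = (\int[sigma]_y f (gram X z y))%E.
  have := integral_indic sigma measurableT (mball z r); rewrite setIT => <-.
  apply: eq_integral => y _; congr EFin; rewrite !indicE; congr (_%:R).
  congr (nat_of_bool _); apply/idP/idP; rewrite !inE /gram_ball /= in_itv /= andbT.
    by rewrite ltrBlDr ltrBlDl.
  by rewrite ltrBlDr ltrBlDl.
rewrite !ballE; apply: gram_homogeneous; last by move=> tau; rewrite lee_fin.
by apply/measurable_EFinP; apply: measurable_indic; exact: measurable_itv.
Qed.

Lemma sum_measure (I : finType) (B : I -> set BT) : (forall i, measurable (B i)) ->
  (\sum_i sigma (B i) = \int[sigma]_y (\sum_i \1_(B i) y)%:E)%E.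
Proof.
move=> mB; under eq_integral do rewrite -sumEFin.
rewrite ge0_integral_sum//; last first.
  by move=> i; apply/measurable_EFinP; exact: measurable_indic.
by apply: eq_bigr => i _; rewrite integral_indic// setIT.
Qed.

Let msum (I : finType) (B : I -> set BT) : (forall i, measurable (B i)) ->
  measurable_fun setT (fun y : BT => (\sum_i \1_(B i) y : R)%:E).
Proof.
move=> mB; apply/measurable_EFinP; apply: measurable_sum => i.
exact: measurable_indic.
Qed.

Lemma disjoint_balls (I : finType) (p : I -> BT) r : 0 < r ->
  (forall i j, i != j -> 2 * r <= chordal (p i : T) (p j)) ->
  forall i j y, gram_ball X (p i) r y -> gram_ball X (p j) r y -> i = j.
Proof.
move=> r0 sep i j y /(gram_ballP _ _ r0) iy /(gram_ballP _ _ r0) jy.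
apply/eqP; apply/negPn/negP => /sep; apply/negP; rewrite -ltNge.
apply: (le_lt_trans (chordal_triangle (y : T) _ _)).
by rewrite (chordalC (y : T)) mulr_natl mulr2n ltrD.
Qed.

(** Disjoint balls centred at a packing have the same measure, and their
    measures add up to at most 1. *)
Lemma ball_measure_upper : exists2 C : R, 0 < C & forall (x : BT) r, 0 < r ->
  (sigma (gram_ball X x r) <= (C * r ^+ D)%:E)%E.
Proof.
have [c c0 pack] := @packing R F n hO.
exists (2 ^+ D / c); first by rewrite divr_gt0 ?exprn_gt0.
move=> x r r0; have [I [p [I0 cI sep]]] := pack (2 * r) (mulr_gt0 (ltr0n _ 2) r0).
have disj := @disjoint_balls I p r r0 sep.
have le1 : (\sum_i sigma (gram_ball X (p i : BT) r) <= 1)%E.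
  rewrite sum_measure//; apply: (@le_trans _ _ (\int[sigma]_y (1 : R)%:E)%E).
    apply: ge0_le_integral => //; first by move=> y _; rewrite lee_fin sumr_ge0.
      exact: msum.
    move=> y _; rewrite lee_fin.
    have [[i Bi]|none] := pselect (exists i, gram_ball X (p i : BT) r y).
      rewrite (bigD1 i)//= big1 ?addr0 => [|j ji]; first by rewrite indicE; case: (_ \in _).
      by rewrite indicE memNset// => Bj; move/eqP: ji; apply; exact: disj Bj Bi.
    by rewrite big1// => i _; rewrite indicE memNset// => Bi; apply: none; exists i.
  by rewrite integral_cst// mul1e; exact: probability_le1.
set v := sigma (gram_ball X x r) in le1 *.
have vE : v = (fine v)%:E by rewrite fineK// fin_num_measure.
have := le1; rewrite (eq_bigr (fun=> (fine v)%:E)); last first.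
  by move=> i _; rewrite -vE; exact: gram_ball_measure.
rewrite sumEFin sumr_const lee_fin => Iv.
have {}Iv : #|I|%:R * fine v <= 1 by rewrite mulr_natl.
rewrite vE lee_fin.
have IR : (0 : R) < #|I|%:R by rewrite ltr0n.
have r2 : 0 < (2 * r) ^+ D by rewrite exprn_gt0// mulr_gt0.
apply: (@le_trans _ _ #|I|%:R^-1).
  by rewrite -[leRHS]mul1r ler_pdivlMr// mulrC.
have -> : 2 ^+ D / c * r ^+ D = (2 * r) ^+ D / c by rewrite exprMn; ring.
by rewrite ler_pdivlMr// mulrC ler_pdivrMr// mulrC.
Qed.

(** Each cell of a covering lies in the ball of radius r around any of its
    points, and the measures of these balls are equal. *)
Lemma ball_measure_lower : exists2 C : R, 0 < C & forall (x : BT) r, 0 < r -> r <= 1 ->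
  ((r ^+ D / C)%:E <= sigma (gram_ball X x r))%E.
Proof.
have [C C0 cover] := @covering R F n.
exists C => // x r r0 r1; have [I [cell [IC close]]] := cover r r0 r1.
pose center i : T := if pselect (exists y, cell y = i) is left e then projT1 (cid e) else point.
have centerP y : chordal (center (cell y)) y < r.
  apply: close; rewrite /center; case: pselect => [e|]; first exact: (projT2 (cid e)).
  by move=> []; exists y.
have ge1 : (1 <= \sum_i sigma (gram_ball X (center i : BT) r))%E.
  rewrite sum_measure//; apply: (@le_trans _ _ (\int[sigma]_y (1 : R)%:E)%E).
    by rewrite integral_cst// mul1e [leRHS](probability_setT sigma).
  apply: ge0_le_integral => //; first exact: msum.
  move=> y _; rewrite lee_fin (bigD1 (cell y))//= indicE mem_set; last first.
    by apply/gram_ballP.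
  by rewrite lerDl sumr_ge0.
set v := sigma (gram_ball X x r).
have vE : v = (fine v)%:E by rewrite fineK// fin_num_measure.
have := ge1; rewrite (eq_bigr (fun=> (fine v)%:E)); last first.
  by move=> i _; rewrite -vE; exact: gram_ball_measure.
rewrite sumEFin sumr_const lee_fin => Iv.
have {}Iv : 1 <= #|I|%:R * fine v by rewrite mulr_natl.
rewrite vE lee_fin ler_pdivrMr//.
have v0 : 0 <= fine v by apply: fine_ge0; exact: measure_ge0.
have rD : 0 < r ^+ D by rewrite exprn_gt0.
apply: (@le_trans _ _ (#|I|%:R * fine v * r ^+ D)).
  by rewrite ler_peMl// ltW.
by rewrite mulrAC [leRHS]mulrC ler_wpM2r.
Qed.

End gram_facts.
End projective.

(** * Riesz energies on projective space *)

Section riesz_energy.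
Context {R : realType} {F : division_algebra} {n : nat}.
Hypotheses (n2 : (2 <= n)%N) (hO : F = Octonions -> n = 2%N).
Local Notation A := (scalars R F).
Local Notation T := (projspace R F n).
Local Notation BT := (borel_projspace R F n).
Local Notation D := (projdim F n).
Variable sigma : probability BT R.
Hypothesis hsigma : isometry_invariant sigma.
Variables (J : finType) (b : J -> A).
Hypothesis ob : orthonormal_basis b.
Local Notation X := (@coordinate R F n J b).
Variable s : R.
Hypotheses (s0 : 0 < s) (sD : s < D%:R).

Let mX j : measurable_fun setT (X j). Proof. exact: measurable_coordinate. Qed.

Lemma rieszE (x y : BT) : @riesz R F n s x y = riesz_profile (s / 2) (gram X x y).
Proof.
rewrite /riesz /riesz_profile (gram_coordinate ob) inner_chordal.
have -> : (1 - chordal (x : T) y ^+ 2 == 1) = (x == y :> T).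
  apply/eqP/eqP => [e|->]; last by rewrite chordalxx expr0n subr0.
  apply: chordal_eq0; apply/eqP; rewrite -sqrf_eq0; apply/eqP.
  by move: e; lra.
case: ifP => // _; congr EFin; rewrite opprB addrC subrK.
rewrite -powR_mulrn ?chordal_ge0// -powRrM; congr (_ `^ _).
by field.
Qed.

Let mK : measurable_fun setT (fun z : BT * BT => @riesz R F n s z.1 z.2).
Proof.
have -> : (fun z : BT * BT => @riesz R F n s z.1 z.2) =
    (fun z => riesz_profile (s / 2) (gram X z.1 z.2)).
  by apply/funext => z; exact: rieszE.
by apply: measurableT_comp (measurable_riesz_profile _) _; exact: measurable_gram.
Qed.

Lemma riesz_ge0 (x y : T) : (0 <= riesz s x y)%E.
Proof. by rewrite (rieszE x y) riesz_profile_ge0. Qed.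

Lemma riesz_sym (x y : T) : riesz s x y = riesz s y x.
Proof. by rewrite /riesz eq_sym chordalC. Qed.

Lemma riesz_near (x y : T) r : 0 < r -> chordal x y < r ->
  ((r `^ (- s))%:E <= riesz s x y)%E.
Proof.
move=> r0 xy; rewrite /riesz; case: eqVneq => [_|ne]; first by rewrite leey.
have d0 : 0 < chordal x y.
  by rewrite lt_neqAle chordal_ge0 andbT; apply: contra_neq ne => /esym/chordal_eq0.
rewrite lee_fin !powRN lef_pV2 ?posrE ?powR_gt0//.
by rewrite ge0_ler_powR ?nnegrE ?(ltW s0) ?(ltW r0) ?(ltW d0) ?(ltW xy).
Qed.

Variable u : R.
Hypothesis Uu : forall x : BT, (\int[sigma]_y @riesz R F n s x y = u%:E)%E.

(** A positive fraction of the N points is spread over disjoint balls of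
    measure at least 1/N and radius of order N^(-1/D); each such point saves
    its self-energy, of order N^(s/D). *)
Lemma riesz_upper_bound : exists2 C : R, 0 < C & forall N, (2 <= N)%N ->
  exists w : 'I_N -> T, (config_energy (riesz s) w <=
    (u * N%:R ^+ 2 - C * N%:R `^ (1 + s / D%:R))%:E)%E.
Proof.
have [C C0 lower] := ball_measure_lower n2 hO hsigma ob.
have [c c0 pack] := @packing R F n hO.
have D0 : (0 : R) < D%:R := lt_trans s0 sD.
pose c3 : R := Num.min (1 / 2) (c / (2 ^+ D * C)).
have c30 : 0 < c3.
  by rewrite lt_min divr_gt0//= divr_gt0// mulr_gt0// exprn_gt0.
exists (c3 * (2 `^ (- s) * C `^ (- s / D%:R))).
  by apply: mulr_gt0 c30 _; apply: mulr_gt0; exact: powR_gt0.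
move=> N N2; have N0 : (0 < N)%N by exact: ltn_trans N2.
have NR : (0 : R) < N%:R by rewrite ltr0n.
pose r : R := (C / N%:R) `^ D%:R^-1.
have CN : 0 < C / N%:R by rewrite divr_gt0.
have r0 : 0 < r by rewrite powR_gt0.
have rD : r ^+ D = C / N%:R.
  by rewrite -powR_mulrn ?(ltW r0)// -powRrM mulVf ?gt_eqF// powRr1// ltW.
have [I [p [I0 cI sep]]] := pack (2 * r) (mulr_gt0 (ltr0n _ 2) r0).
pose M := minn #|I| N.-1; pose L := (N - M)%N.
have MN : (M <= N.-1)%N := geq_minr _ _.
have ML : (M + L)%N = N by rewrite subnKC// (leq_trans MN)// leq_pred.
have L0 : (0 < L)%N by rewrite subn_gt0 (leq_ltn_trans MN)// ltn_predL.
have MI : (M <= #|I|)%N := geq_minl _ _.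
pose q (i : 'I_M) : BT := p (enum_val (widen_ord MI i)).
have sepq i j : i != j -> 2 * r <= chordal (q i : T) (q j : T).
  move=> ij; apply: sep; apply: contra_neq ij => /enum_val_inj.
  by move/(congr1 val) => /= e; exact: val_inj.
have c3M : c3 * N%:R <= M%:R.
  have [MIe|MNe] : M = #|I| \/ M = N.-1.
  - by rewrite /M /minn; case: ifP => _; [left|right].
  - apply: (@le_trans _ _ (c / (2 ^+ D * C) * N%:R)).
      by rewrite ler_wpM2r ?(ltW NR)// /c3 ge_min lexx orbT.
    have -> : c / (2 ^+ D * C) * N%:R = c / (2 ^+ D * (C / N%:R)).
      by field; rewrite !gt_eqF// exprn_gt0.
    have pos : 0 < 2 ^+ D * (C / N%:R) by apply: mulr_gt0 CN; exact: exprn_gt0.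
    by rewrite ler_pdivrMr// -rD -exprMn MIe.
  - apply: (@le_trans _ _ (1 / 2 * N%:R)).
      by rewrite ler_wpM2r ?(ltW NR)// /c3 ge_min lexx.
    have -> : M%:R = N%:R - 1 :> R by rewrite MNe -subn1 natrB.
    have : (2 : R) <= N%:R by rewrite ler_nat.
    by lra.
have : exists w : 'I_(M + L) -> BT,
    (\sum_i \sum_(j | j != i) @riesz R F n s (w i) (w j) <=
     ((M + L)%:R ^+ 2 * u - M%:R * (2 * r) `^ (- s))%:E)%E.
  apply: (@jittered_config _ BT R sigma (fun x y => @riesz R F n s x y) mK
    riesz_ge0 riesz_sym u Uu M L (fun i => gram_ball X (q i) r) ((2 * r) `^ (- s)) L0).
  - exact: powR_ge0.
  - by move=> i; apply: measurable_gram_ball.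
  - exact: disjoint_balls ob _ _ _ r0 sepq.
  - move=> i; rewrite ML.
    have [r1|r1] := leP r 1.
      apply: (@le_trans _ _ (N%:R%:E * (r ^+ D / C)%:E)%E); last first.
        by rewrite lee_wpmul2l ?lee_fin ?lower// ltW.
      rewrite -EFinM lee_fin rD (_ : N%:R * _ = 1)//.
      by field; rewrite !gt_eqF.
    rewrite (_ : gram_ball X (q i) r = setT) ?probability_setT; last first.
      apply/seteqP; split=> // y _; apply/(gram_ballP ob _ _ r0).
      exact: le_lt_trans (chordal_le1 n2 hO _ _) r1.
    by rewrite mule1 lee_fin ler1n.
  - move=> i x y /(gram_ballP ob _ _ r0) ix /(gram_ballP ob _ _ r0) iy.
    apply: riesz_near; first by rewrite mulr_gt0.
    apply: (le_lt_trans (chordal_triangle (q i : T) _ _)).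
    by rewrite chordalC mulr_natl mulr2n ltrD.
rewrite ML => -[w le]; exists w; apply: (le_trans le); rewrite lee_fin.
rewrite mulrC lerD2l lerN2.
have -> : c3 * (2 `^ (- s) * C `^ (- s / D%:R)) * N%:R `^ (1 + s / D%:R) =
    c3 * N%:R * (2 * r) `^ (- s).
  have Nx x : (N%:R^-1) `^ x = N%:R `^ (- x) :> R.
    by rewrite -powR_inv1 ?(ltW NR)// -powRrM mulN1r.
  have -> : N%:R `^ (1 + s / D%:R) = N%:R * N%:R `^ (s / D%:R).
    by rewrite powRD ?powRr1 ?(ltW NR)//; apply/implyP => _; rewrite gt_eqF.
  rewrite powRM ?(ltW r0)// /r -powRrM powRM ?invr_ge0 ?(ltW NR) ?(ltW C0)// Nx.
  rewrite mulrN opprK mulNr (mulrC D%:R^-1 s); ring.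
by rewrite ler_wpM2r ?powR_ge0.
Qed.

End riesz_energy.

Theorem theorem1p2 (R : realType) (F : division_algebra) (d : nat)
    (hd : (3 <= d)%N) (hO : F = Octonions -> d = 3%N)
    (sigma : probability (borel_projspace R F d.-1) R)
    (hsigma : isometry_invariant sigma)
    (s : R) (hs0 : 0 < s) (hs : s < (projdim F d.-1)%:R) :
  exists C C' : R, [/\ 0 < C, 0 < C' &
    forall N : nat, (2 <= N)%N ->
      ((- C * N%:R `^ (1 + s / (projdim F d.-1)%:R))%:E
       <= min_energy (@riesz R F d.-1 s) N
          - energy_integral sigma (@riesz R F d.-1 s) * (N%:R ^+ 2)%:E
       <= (- C' * N%:R `^ (1 + s / (projdim F d.-1)%:R))%:E)%E].
Proof.
have n2 : (2 <= d.-1)%N by case: d hd {hO sigma hsigma hs} => [|[|[]]].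
have hO' : F = Octonions -> d.-1 = 2%N by move=> /hO ->.
have [J [b [_ ob]]] := scalars_basis R F.
have [c c0 ballc] := ball_measure_upper n2 hO' hsigma ob.
have a0 : 0 < s / 2 by rewrite divr_gt0.
have aD : s / 2 < (projdim F d.-1)%:R / 2 by rewrite ltr_pM2r.
have [u [C [Uu' C0 lower]]] := energy_lower_bound
  (measurable_coordinate ob) (gram_coordinate01 n2 hO' ob)
  (gram_homogeneous n2 hO' hsigma ob) a0 aD c0 (ballc point).
have Uu (x : borel_projspace R F d.-1) :
    (\int[sigma]_y @riesz R F d.-1 s x y = u%:E)%E.
  rewrite -(Uu' x); apply: eq_integral => y _; exact: rieszE.
have [C' C'0 upper] := riesz_upper_bound n2 hO' hsigma ob hs0 hs Uu.
have s2 : (s / 2) *+ 2 = s by rewrite -mulr_natr divfK.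
exists C, C'; split=> // N N2.
set P := N%:R `^ _.
have low (w : 'I_N -> projspace R F d.-1) :
    ((u * N%:R ^+ 2 - C * P)%:E <= config_energy (riesz s) w)%E.
  have := lower N w (ltn_trans (isT : 0 < 1)%N N2); rewrite s2 => /le_trans; apply.
  apply: lee_sum => i _; apply: lee_sum => j _.
  by rewrite -(rieszE ob).
have -> : energy_integral sigma (@riesz R F d.-1 s) = u%:E.
  rewrite /energy_integral; under eq_integral do rewrite Uu.
  by rewrite integral_cst// [X in (_ * X)%E](probability_setT sigma) mule1.
have [w upw] := upper N N2.
have minL : ((u * N%:R ^+ 2 - C * P)%:E <= min_energy (@riesz R F d.-1 s) N)%E.
  by apply: le_ereal_inf_tmp => _ [v _ <-]; exact: low.
have minU : (min_energy (@riesz R F d.-1 s) N <= (u * N%:R ^+ 2 - C' * P)%:E)%E.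
  by apply: le_trans upw; apply: ereal_inf_lbound; exists w.
rewrite -EFinM leeBrDr// leeBlDr// -!EFinD.
rewrite !mulNr !(addrC (- _)) minL; exact: minU.
Qed.
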